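(* Let $m\ge1$ and let $a_1,\dots,a_m$ be nonzero real numbers; let $\mathcal{L}$ be the operator with symbol $\alpha(\xi)=\prod_{i=1}^m(\xi^2+a_i^2)$, i.e. $\mathcal{L}v=\mathcal{F}^{-1}[\alpha(\xi)\,\mathcal{F}v(\xi)]$. Let $f\in C^2(\mathbb{R})$ satisfy: (F1) $f(0)=0$ and $f(r)>0$ for all $r>0$; (F2) there exists $p>1$ such that $r^2f'(r)\ge p\,r f(r)$ for all $r\in\mathbb{R}$; (F3) there exist $2\le q_1\le q_2$ and $C>0$ such that $|f'(r)|\le C(|r|^{q_1-1}+|r|^{q_2-1})$ for all $r\in\mathbb{R}$. Then (a) there exists a positive solution $\varphi\in H^m(\mathbb{R})$ of $\mathcal{L}\varphi=f(\varphi)$; and (b) every positive solution $\varphi\in H^m(\mathbb{R})$ of $\mathcal{L}\varphi=f(\varphi)$ is a translate of an even function, i.e. there is $\lambda\in\mathbb{R}$ such that $\varphi(2\lambda-x)=\varphi(x)$ for all $x\in\mathbb{R}$.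
   Context: Fourier transform convention: $\mathcal{F}g(\xi)=\int_{\mathbb{R}}e^{ix\xi}g(x)\,dx$. ''Positive'' means $\varphi(x)>0$ for all $x\in\mathbb{R}$. *)

(* Defs.v *)
From HB Require Import structures.
From mathcomp Require Import all_boot all_order all_algebra.
From mathcomp Require Import all_classical all_reals all_analysis.
Set Implicit Arguments. Unset Strict Implicit. Unset Printing Implicit Defensive.
Import Order.TTheory GRing.Theory Num.Theory.
Import numFieldNormedType.Exports.
Local Open Scope classical_set_scope.
Local Open Scope ring_scope.

Section Defs.
Variable R : realType.
Notation mu := (@lebesgue_measure R).

Definition dern (k : nat) (g : R -> R) : R -> R := iter k (fun h => derive1 h) g.

Definition test_fun (psi : R -> R) : Prop :=
  (forall k x, derivable (dern k psi) x 1) /\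
  (exists M : R, forall x, M < `|x| -> psi x = 0).

Definition L2 (g : R -> R) : Prop :=
  measurable_fun setT g /\
  (\int[mu]_x ((`|g x| ^+ 2)%:E) < +oo)%E.

Definition weak_deriv (k : nat) (phi g : R -> R) : Prop :=
  forall psi, test_fun psi ->
    Rintegral mu setT (fun x => phi x * dern k psi x)
    = (-1) ^+ k * Rintegral mu setT (fun x => g x * psi x).

Definition Hm (m : nat) (phi : R -> R) : Prop :=
  L2 phi /\ forall k, (1 <= k <= m)%N -> exists g, L2 g /\ weak_deriv k phi g.

(* L = prod_i (a_i^2 - d^2/dx^2), the operator with symbol prod_i (xi^2 + a_i^2)
   (for F g(xi) = int e^{i x xi} g(x) dx one has F(-g'') = xi^2 F g). *)
Definition Lop (a : seq R) (psi : R -> R) : R -> R :=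
  foldr (fun ai h => fun x => ai ^+ 2 * h x - dern 2 h x) psi a.

(* phi is a positive H^m solution of L phi = f(phi) (in the distributional sense);
   phi is the continuous representative of its H^m class. *)
Definition pos_solution (a : seq R) (f : R -> R) (phi : R -> R) : Prop :=
  Hm (size a) phi /\ continuous phi /\ (forall x, 0 < phi x) /\
  forall psi, test_fun psi ->
    Rintegral mu setT (fun x => phi x * Lop a psi x)
    = Rintegral mu setT (fun x => f (phi x) * psi x).

Definition C2 (f : R -> R) : Prop :=
  (forall x, derivable f x 1) /\ (forall x, derivable (derive1 f) x 1) /\
  continuous (dern 2 f).

End Defs.

(* Main.v *)
Require Import Defs.
From HB Require Import structures.
From mathcomp Require Import all_boot all_order all_algebra.
From mathcomp Require Import all_classical all_reals all_analysis.
From mathcomp Require Import measurable_realfun ring lra.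
Set Implicit Arguments. Unset Strict Implicit. Unset Printing Implicit Defensive.
Import Order.TTheory GRing.Theory Num.Theory.
Import numFieldNormedType.Exports.
Local Open Scope classical_set_scope.
Local Open Scope ring_scope.

(** For a > 0 the equation a^2 y - y'' = w with w bounded and continuous has exactly one
    bounded solution, the resolvent of w. Composing the resolvents for |a_1|, ..., |a_m|
    gives an operator K, the inverse of L, and the solutions are the fixed points
    phi = K (f o phi). Everything about K is deduced from the differential equations
    rather than from its convolution kernel: uniqueness gives its commutation rules, the
    maximum principle its monotonicity properties, integration by parts its symmetry and
    its coercivity.

    Symmetry. Testing the weak equation against cut-offs of K eta, with eta a bump, gives
    phi = K (f o phi); the Harnack inequality |(K w)'| <= a K w for w >= 0 makes phi bounded
    and decaying. Then the planes are moved: z = f(phi) - f(phi(2l - .)) is odd about l, and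
    an upper bound m for z on the left half-line gives the bound m / prod a_i^2 for K z there.

    Existence. On the cone of even decreasing functions w >= 0, with v = K w, one minimizes
    (1/2) int w v - int F(v), F' = f, under the Nehari constraint int w v = int v f(v).
    Minimizing sequences are equi-Lipschitz, so v_n -> v along a subsequence. Let
    u = K (f o v), rho = f(v)/v, A = int v f(v), b = int u f(v), c = int rho u^2. Positivity of
    K on w_n - f(v) gives A <= b; as F is a convex function of r^2, comparing the Nehari
    multiple of u with v gives c <= b. Hence int rho (v - u)^2 = A - 2b + c <= 0 and u = v. *)

(** * Calculus *)

(** Two obstacles shape the existence proof. The functions w_n of a minimizing sequence need not
    converge, so the limit v is not known to be K w for some w in the cone and is not itself a
    competitor. Only quantities expressed through v_n pass to the limit, and the comparison is made
    with the Nehari multiple of f(v), which is admissible because K and composition with f preserve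
    the cone. The cone also supplies compactness: a decreasing v with int v^2 <= Q satisfies v(x)^2
    |x| <= Q, so v f(v) <= C v^3 has an integrable majorant and no mass escapes to infinity. The
    moving planes reach an operator of order 2m because each second-order factor obeys the maximum
    principle separately: a resolvent keeps oddness about l, hence the boundary value 0 at l, and
    bounds on the half-line pass from factor to factor. (F3) and the C^2 regularity enter through
    f'(r) <= C r on bounded intervals. This makes f(phi) integrable for bounded phi in L^2, and
    makes the increments of f small relative to those of phi where phi is small. *)

Definition Der (R : realType) (y d : R -> R) : Prop :=
  forall x : R, is_derive x 1 y (d x).

Section Calculus.
Variable R : realType.
Implicit Types (y d e : R -> R).

Lemma is_derive_cont (x : R) y l : is_derive x 1 y l -> {for x, continuous y}.
Proof. by move=> [dy _]; apply/differentiable_continuous/derivable1_diffP. Qed.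

Lemma Der_cont y d : Der y d -> continuous y.
Proof. by move=> dy x; apply: is_derive_cont (dy x). Qed.

Lemma MVT_on y d (a b : R) : a < b -> (forall x, a <= x <= b -> is_derive x 1 y (d x)) ->
  exists2 c, a < c < b & y b - y a = d c * (b - a).
Proof.
move=> ab dy.
have [||c cab E] := @MVT R y d a b ab.
- by move=> x; rewrite in_itv/= => /andP[/ltW ax /ltW xb]; apply: dy; rewrite ax.
- apply: derivable_within_continuous => x; rewrite in_itv/= => /dy.
  by move=> h; apply: ex_derive.
by exists c => //; move: cab; rewrite in_itv.
Qed.

(** The sign is asked for in the open interval only, since the differential inequalities below stop
    short of the endpoint [l]. *)
Lemma ndecr_on y d (a b : R) : a <= b -> (forall x, a <= x <= b -> is_derive x 1 y (d x)) ->
  (forall x, a < x < b -> 0 <= d x) -> y a <= y b.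
Proof.
rewrite le_eqVlt => /predU1P[->//|ab] dy d0.
have [c cab E] := MVT_on ab dy.
by rewrite -subr_ge0 E mulr_ge0 ?d0// subr_ge0 ltW.
Qed.

Lemma nincr_on y d (a b : R) : a <= b -> (forall x, a <= x <= b -> is_derive x 1 y (d x)) ->
  (forall x, a < x < b -> d x <= 0) -> y b <= y a.
Proof.
rewrite le_eqVlt => /predU1P[->//|ab] dy d0.
have [c cab E] := MVT_on ab dy.
by rewrite -subr_le0 E mulr_le0_ge0 ?d0// subr_ge0 ltW.
Qed.

Lemma incr_on y d (a b : R) : a < b -> (forall x, a <= x <= b -> is_derive x 1 y (d x)) ->
  (forall x, a < x < b -> 0 < d x) -> y a < y b.
Proof.
move=> ab dy d0; have [c cab E] := MVT_on ab dy.
by rewrite -subr_gt0 E mulr_gt0 ?d0// subr_gt0.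
Qed.

Lemma decr_on y d (a b : R) : a < b -> (forall x, a <= x <= b -> is_derive x 1 y (d x)) ->
  (forall x, a < x < b -> d x < 0) -> y b < y a.
Proof.
move=> ab dy d0; have [c cab E] := MVT_on ab dy.
by rewrite -subr_lt0 E nmulr_rlt0 ?d0// subr_gt0.
Qed.

Lemma Der_cst (c : R) : Der (cst c) (cst 0).
Proof. by move=> x; apply: is_derive_cst. Qed.

Lemma Der_id : Der (@id R) (cst 1).
Proof. by move=> x; apply: is_derive_id. Qed.

Lemma DerD y d z e : Der y d -> Der z e -> Der (fun x => y x + z x) (fun x => d x + e x).
Proof. by move=> dy dz x; have := dy x; have := dz x => *; apply: is_deriveD. Qed.

Lemma DerN y d : Der y d -> Der (fun x => - y x) (fun x => - d x).
Proof. by move=> dy x; have := dy x => *; apply: is_deriveN. Qed.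

Lemma DerB y d z e : Der y d -> Der z e -> Der (fun x => y x - z x) (fun x => d x - e x).
Proof. by move=> dy dz x; have := dy x; have := dz x => *; apply: is_deriveB. Qed.

Lemma DerM y d z e : Der y d -> Der z e ->
  Der (fun x => y x * z x) (fun x => d x * z x + y x * e x).
Proof.
move=> dy dz x; have := dy x; have := dz x => h1 h2.
by apply: is_derive_eq (is_deriveM h2 h1) _; rewrite /GRing.scale/=; ring.
Qed.

Lemma DerZ (c : R) y d : Der y d -> Der (fun x => c * y x) (fun x => c * d x).
Proof.
move=> dy x; have := dy x => h.
by apply: is_derive_eq (is_deriveZ c h) _.
Qed.

Lemma Der_comp y d z e : Der y d -> Der z e ->
  Der (fun x => y (z x)) (fun x => d (z x) * e x).
Proof.
move=> dy dz x; have h1 := dy (z x); have h2 := dz x.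
exact: is_derive1_comp h1 h2.
Qed.

Lemma Der_eq y d e : d =1 e -> Der y d -> Der y e.
Proof. by move=> de dy x; rewrite -de. Qed.

Lemma Der_ext y z d e : y =1 z -> d =1 e -> Der y d -> Der z e.
Proof. by move=> /funext-> /funext->. Qed.

Lemma Der_expM (a : R) : Der (fun x => expR (a * x)) (fun x => a * expR (a * x)).
Proof.
have := Der_comp (fun x => is_derive_expR x) (DerZ a Der_id).
by apply: Der_eq => x; rewrite /cst/=; ring.
Qed.

Lemma DerX2 y d : Der y d -> Der (fun x => y x ^+ 2) (fun x => 2 * y x * d x).
Proof.
move=> dy; have h := DerM dy dy.
by apply: Der_ext h => x; ring.
Qed.

Lemma Der_derive1 y d : Der y d -> derive1 y = d.
Proof. by move=> dy; apply/funext => x; rewrite derive1E; case: (dy x). Qed.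

Lemma Der_derivable y d (x : R) : Der y d -> derivable y x 1.
Proof. by move=> dy; case: (dy x). Qed.

Lemma derivable_Der y : (forall x, derivable y x 1) -> Der y (derive1 y).
Proof. by move=> dy x; rewrite derive1E; apply/derivableP. Qed.

Lemma Der_cst_eq y : Der y (cst 0) -> forall x z, y x = y z.
Proof. by move=> dy x z; apply: is_derive_0_is_cst. Qed.

Lemma Der_shift y d (h : R) : Der y d -> Der (fun x => y (x + h)) (fun x => d (x + h)).
Proof.
move=> dy; have := Der_comp dy (DerD Der_id (Der_cst h)).
by apply: Der_eq => x /=; rewrite /cst/=; ring.
Qed.

Lemma Der_reflect y d (l : R) : Der y d -> Der (fun x => y (l - x)) (fun x => - d (l - x)).
Proof.
move=> dy; have := Der_comp dy (DerB (Der_cst l) Der_id).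
by apply: Der_eq => x /=; rewrite /cst/=; ring.
Qed.

(* The bound on an exponential by its tangent replaces any limit at infinity. *)
Lemma expR_unbounded (a c B : R) : 0 < a -> 0 < c -> exists2 x, 0 <= x & B < c * expR (a * x).
Proof.
move=> a0 c0; exists (`|B| / (c * a)); first by rewrite divr_ge0// mulr_ge0// ltW.
have -> : a * (`|B| / (c * a)) = `|B| / c by field; rewrite !gt_eqF.
rewrite -ltr_pdivrMl// mulrC; apply: lt_le_trans (expR_ge1Dx _).
have : B / c <= `|B| / c by rewrite ler_pM2r ?invr_gt0// ler_norm.
lra.
Qed.

End Calculus.

(** * Maximum principle and uniqueness for y'' = a^2 y *)

Section MaximumPrinciple.
Variables (R : realType) (a l : R) (y d e : R -> R).
Hypotheses (a0 : 0 < a) (yd : Der y d) (de : Der d e).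
Hypothesis sup : forall x, x < l -> a ^+ 2 * y x <= e x.

(** The expression y'' - a^2 y factors as (D - a)(D + a) y: [g] is the inner factor, [P] and [Q] are
    [g] and [y] times integrating factors. So [P] is nondecreasing up to [l], [g] can change sign
    only from negative to positive, and the monotonicity of [Q] follows the sign of [g]. *)
Let g x := d x + a * y x.
Let P x := g x * expR (- a * x).
Let Q x := y x * expR (a * x).

Let DP : Der P (fun x => (e x - a ^+ 2 * y x) * expR (- a * x)).
Proof.
have := DerM (DerD de (DerZ a yd)) (Der_expM (- a)).
by apply: Der_eq => x; rewrite /g; ring.
Qed.

Let DQ : Der Q (fun x => g x * expR (a * x)).
Proof.
by have := DerM yd (Der_expM a); apply: Der_eq => x; rewrite /g; ring.
Qed.

Let P_ndecr x z : x <= z -> z <= l -> P x <= P z.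
Proof.
move=> xz zl; apply: (ndecr_on xz) => [t _|t /andP[_ tz]]; first exact: DP.
by rewrite mulr_ge0 ?expR_ge0// subr_ge0 sup// (lt_le_trans tz).
Qed.

Let g_le0_left x z : x <= z -> z <= l -> g z <= 0 -> g x <= 0.
Proof.
move=> xz zl gz; rewrite -(pmulr_lle0 _ (expR_gt0 (- a * x))).
by apply: le_trans (P_ndecr xz zl) _; rewrite pmulr_lle0 ?expR_gt0.
Qed.

Let g_lt0_left x z : x <= z -> z <= l -> g z < 0 -> g x < 0.
Proof.
move=> xz zl gz; rewrite -(pmulr_llt0 _ (expR_gt0 (- a * x))).
by apply: le_lt_trans (P_ndecr xz zl) _; rewrite pmulr_llt0 ?expR_gt0.
Qed.

Let g_ge0_right x z : x <= z -> z <= l -> 0 <= g x -> 0 <= g z.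
Proof.
move=> xz zl; rewrite !leNgt => gx; apply: contra gx; exact: g_lt0_left.
Qed.

Let g_gt0_right x z : x <= z -> z <= l -> 0 < g x -> 0 < g z.
Proof.
move=> xz zl; rewrite !ltNge => gx; apply: contra gx; exact: g_le0_left.
Qed.

(** If y(x0) > 0 >= y(l), then [Q] decreases somewhere in between, so [g] < 0 there and everywhere
    to the left. Hence [Q] grows leftwards, and y(x0 - t) >= e^(at) y(x0) exceeds any bound. *)
Lemma max_principle (B : R) : (forall x, x < l -> y x <= B) -> y l <= 0 ->
  forall x, x < l -> y x <= 0.
Proof.
move=> yB yl x0 x0l; rewrite leNgt; apply/negP => y0.
have Q0 : 0 < Q x0 by rewrite mulr_gt0 ?expR_gt0.
have Ql : Q l <= 0 by rewrite pmulr_lle0 ?expR_gt0.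
have [c /andP[x0c cl] E] := MVT_on x0l (fun t _ => DQ t).
have gc : g c < 0.
  rewrite ltNge; apply/negP => gc.
  have : 0 <= g c * expR (a * c) * (l - x0).
    by rewrite mulr_ge0// ?mulr_ge0 ?expR_ge0// subr_ge0 ltW.
  rewrite -E; lra.
have [t t0 Bt] := expR_unbounded (c := y x0) (`|B| + 1) a0 y0.
have tx : x0 - t <= x0 by lra.
have : Q x0 <= Q (x0 - t).
  apply: (nincr_on tx) => [s _|s /andP[_ sx]]; first exact: DQ.
  rewrite pmulr_lle0 ?expR_gt0// ltW// (@g_lt0_left s c)// ltW//.
  exact: lt_trans x0c.
rewrite /Q leNgt => /negP; apply.
have -> : expR (a * x0) = expR (a * (x0 - t)) * expR (a * t).
  by rewrite -expRD; congr expR; ring.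
rewrite mulrCA [X in X < _]mulrC ltr_pM2l ?expR_gt0//.
apply: le_lt_trans (_ : `|B| + 1 < _); last by [].
have : y (x0 - t) <= B by apply: yB; lra.
have := ler_norm B; lra.
Qed.

Hypotheses (y_le0 : forall x, x < l -> y x <= 0) (yl0 : y l = 0).

(** At a zero x0 of [y] also g(x0) = 0: a positive value would make [Q] increase strictly from 0 at
    x0 to 0 at [l], a negative one would make it positive left of x0. Then [Q] has its minimum 0 at
    x0, while [Q] <= 0. *)
Lemma strong_max_principle (x0 : R) : x0 < l -> y x0 = 0 -> forall x, x < l -> y x = 0.
Proof.
move=> x0l yx0.
have Qx0 : Q x0 = 0 by rewrite /Q yx0 mul0r.
have Q_le0 x : x < l -> Q x <= 0 by move=> xl; rewrite pmulr_lle0 ?expR_gt0// y_le0.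
have Q_eq0 x : x < l -> 0 <= Q x -> y x = 0.
  move=> xl; rewrite pmulr_lge0 ?expR_gt0// => yx.
  by apply/eqP; rewrite eq_le yx y_le0.
have g0 : g x0 = 0.
  apply/eqP; rewrite eq_le; apply/andP; split; rewrite leNgt; apply/negP => gx.
  - have : Q x0 < Q l.
      apply: (incr_on x0l) => [s _|s /andP[xs sl]]; first exact: DQ.
      by rewrite mulr_gt0 ?expR_gt0// (@g_gt0_right x0 s)// ltW.
    by rewrite Qx0 /Q yl0 mul0r ltxx.
  - have x1 : x0 - 1 < x0 by lra.
    have : Q x0 < Q (x0 - 1).
      apply: (decr_on x1) => [s _|s /andP[xs sl]]; first exact: DQ.
      by rewrite pmulr_llt0 ?expR_gt0// (@g_lt0_left s x0)// ltW.
    rewrite Qx0 => h; have := Q_le0 (x0 - 1); lra.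
move=> x xl; apply: Q_eq0 => //; rewrite -Qx0; have [xx|/ltW xx] := leP x x0.
- apply: (nincr_on xx) => [s _|s /andP[_ sx]]; first exact: DQ.
  by rewrite pmulr_lle0 ?expR_gt0// (@g_le0_left s x0) ?g0// ltW.
- apply: (ndecr_on xx) => [s _|s /andP[xs sx]]; first exact: DQ.
  rewrite mulr_ge0 ?expR_ge0// (@g_ge0_right x0 s) ?g0// ltW//.
  exact: lt_trans xl.
Qed.

(** If d(l) <= 0 then g(l) <= 0, so [Q] is nonincreasing up to [l], where it vanishes; this
    contradicts y(x0) < 0. *)
Lemma hopf_lemma (x0 : R) : x0 < l -> y x0 < 0 -> 0 < d l.
Proof.
move=> x0l; rewrite !ltNge; apply: contra => dl.
have gl : g l <= 0 by rewrite /g yl0; lra.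
have : Q l <= Q x0.
  apply: (nincr_on (ltW x0l)) => [s _|s /andP[_ sx]]; first exact: DQ.
  by rewrite pmulr_lle0 ?expR_gt0// (@g_le0_left s l)// ltW.
by rewrite /Q yl0 mul0r pmulr_lge0 ?expR_gt0.
Qed.

End MaximumPrinciple.

Definition bounded_fun (R : realType) (w : R -> R) := exists M, forall x, `|w x| <= M.

Section Uniqueness.
Variable R : realType.
Implicit Types (y d w : R -> R).

(** Integrating the two first-order factors in turn gives y = c/(2a) e^(ax) + D e^(-ax). Boundedness
    at +oo forces c = 0, then boundedness at -oo forces D = 0. *)
Lemma bounded_homogeneous_eq0 (a : R) y d : 0 < a -> Der y d ->
  Der d (fun x => a ^+ 2 * y x) -> bounded_fun y -> forall x, y x = 0.
Proof.
move=> a0 yd dd [B yB].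
pose P x := (d x + a * y x) * expR (- a * x).
have DP : Der P (cst 0).
  have := DerM (DerD dd (DerZ a yd)) (Der_expM (- a)).
  by apply: Der_eq => x; rewrite /cst; ring.
have [c Pc] : exists c, forall x, P x = c.
  by exists (P 0) => x; exact: Der_cst_eq DP x 0.
have EN x : expR (- a * x) * expR (a * x) = 1.
  by rewrite -expRD mulNr addNr expR0.
have gE x : d x + a * y x = c * expR (a * x).
  by rewrite -(Pc x) /P -mulrA EN mulr1.
pose Q x := (y x - c / (2 * a) * expR (a * x)) * expR (a * x).
have DQ : Der Q (cst 0).
  have := DerM (DerB yd (DerZ (c / (2 * a)) (Der_expM a))) (Der_expM a).
  apply: Der_eq => x; rewrite /cst.
  have -> : d x = c * expR (a * x) - a * y x by rewrite -gE; ring.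
  by field; rewrite gt_eqF.
have [D QD] : exists D, forall x, Q x = D.
  by exists (Q 0) => x; exact: Der_cst_eq DQ x 0.
have yE x : y x = c / (2 * a) * expR (a * x) + D * expR (- a * x).
  rewrite -(QD x) /Q -[_ * expR (a * x) * _]mulrA [expR (a * x) * expR (- a * x)]mulrC EN.
  ring.
have B0 : 0 <= B := le_trans (normr_ge0 _) (yB 0).
have c0 : c = 0.
  apply/eqP; rewrite -normr_le0 leNgt; apply/negP => cp.
  have k0 : 0 < `|c| / (2 * a) by rewrite divr_gt0// mulr_gt0.
  have [x x0] := expR_unbounded (B + `|D|) a0 k0; apply/negP; rewrite -leNgt.
  have -> : `|c| / (2 * a) * expR (a * x) = `|y x - D * expR (- a * x)|.
    by rewrite yE addrK !normrM normfV normrM (gtr0_norm a0) normr_nat (ger0_norm (expR_ge0 (a * x))).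
  apply: (le_trans (ler_normB _ _)); apply: lerD => //.
  rewrite normrM (ger0_norm (expR_ge0 _)) ler_piMr// -expR0 ler_expR.
  by rewrite mulNr oppr_le0 mulr_ge0// ltW.
have D0 : D = 0.
  apply/eqP; rewrite -normr_le0 leNgt; apply/negP => Dp.
  have [x x0] := expR_unbounded B a0 Dp; apply/negP; rewrite -leNgt.
  suff -> : `|D| * expR (a * x) = `|y (- x)| by apply: yB.
  rewrite yE c0 mul0r mul0r add0r normrM (ger0_norm (expR_ge0 _)).
  by congr (_ * expR _); ring.
by move=> x; rewrite yE c0 D0 !mul0r addr0.
Qed.

End Uniqueness.

(** * The resolvent of a^2 - d^2/dx^2 on bounded continuous functions *)

Section Primitive.
Variable R : realType.
Notation mu := (@lebesgue_measure R).

(** The integral from a fixed base point is a primitive only to the right of it. The integrals from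
    -(n+1), normalized to vanish at 0, agree wherever two of them are valid, and are glued. *)
Lemma continuous_primitive (g : R -> R) : continuous g -> exists P, Der P g.
Proof.
move=> cg.
pose F (n : nat) (x : R) := \int[mu]_(t in `[- n.+1%:R, x]) g t.
have DF n (x : R) : `|x| < n.+1%:R -> is_derive x 1 (F n) (g x).
  move=> xn.
  have [||||dF F'] := @continuous_FTC1_closed R g (- n.+1%:R) x (x + 1).
  - by rewrite ltrDl.
  - apply: continuous_compact_integrable; first exact: segment_compact.
    exact: continuous_subspaceT.
  - by move: xn; rewrite ltr_norml => /andP[].
  - exact: cg.
  by rewrite -F' derive1E; apply/derivableP.
pose H n x := F n x - F n 0.
have HE n m (x : R) : `|x| < n.+1%:R -> `|x| < m.+1%:R -> H n x = H m x.
  move=> xn xm; pose h t := F n t - F m t.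
  have Dh (t : R) : `|t| <= `|x| -> is_derive t 1 h 0.
    move=> tx; have h1 := DF n t (le_lt_trans tx xn).
    have h2 := DF m t (le_lt_trans tx xm).
    by apply: is_derive_eq (is_deriveB h1 h2) _; rewrite subrr.
  suff : h x = h 0 by rewrite /h /H; lra.
  have [x0|x0] := leP 0 x.
    have D (t : R) : 0 <= t <= x -> is_derive t 1 h 0.
      by move=> /andP[t0 tx]; apply: Dh; rewrite !ger0_norm.
    by apply/eqP; rewrite eq_le (nincr_on x0 D)// (ndecr_on x0 D).
  have D (t : R) : x <= t <= 0 -> is_derive t 1 h 0.
    move=> /andP[xt t0]; apply: Dh; rewrite !ler0_norm ?lerN2//.
    exact: ltW.
  by apply/eqP; rewrite eq_le (nincr_on (ltW x0) D)// (ndecr_on (ltW x0) D).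
pose N (x : R) := Num.bound `|x|.
have NP x : `|x| < (N x).+1%:R.
  by apply: lt_le_trans (archi_boundP (normr_ge0 x)) _; rewrite ler_nat.
exists (fun x => H (N x) x) => x.
(* The index [N t] varies with t; the single index [(N x).+1] is valid for all t at distance less
   than 1 from x. *)
have near_H : \forall t \near x, H (N x).+1 t = H (N t) t.
  near=> t; apply: HE; last exact: NP.
  have : `|x - t| < 1 by near: t; apply: (@cvgr_dist_lt _ _ _ _ _ id x cvg_id _ ltr01).
  move=> xt; have {1}-> : t = x - (x - t) by ring.
  by apply: le_lt_trans (ler_normB _ _) _; rewrite -[X in _ < X]natr1 ltrD// NP.
apply: near_eq_is_derive near_H _.
have h : is_derive x 1 (F (N x).+1) (g x).
  by apply: DF; apply: lt_trans (NP x) _; rewrite ltr_nat.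
by apply: is_derive_eq (is_deriveB h (is_derive_cst _ _ _)) _; rewrite subr0.
Unshelve. all: by end_near. Qed.

End Primitive.

Definition BC (R : realType) (w : R -> R) := continuous w /\ bounded_fun w.

(* The bounded solution of y' + a y = w is built from a primitive G of e^(ax) w by
   subtracting its limit at -oo, obtained as the supremum of G - (M/a) e^(ax). *)
Lemma bounded_first_order (R : realType) (a M : R) (w : R -> R) : 0 < a ->
  continuous w -> (forall x, `|w x| <= M) ->
  exists y, [/\ Der y (fun x => w x - a * y x), (forall x, `|y x| <= M / a) &
    (forall x, 0 <= w x) -> forall x, 0 <= y x].
Proof.
move=> a0 cw wM.
have [G DG] : exists G, Der G (fun x => expR (a * x) * w x).
  apply: continuous_primitive => x; apply: cvgM; last exact: cw.
  exact: (Der_cont (Der_expM a)).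
have DE : Der (fun x => M / a * expR (a * x)) (fun x => M * expR (a * x)).
  by apply: Der_eq (DerZ (M / a) (Der_expM a)) => x; field; rewrite gt_eqF.
pose L x := G x - M / a * expR (a * x).
pose U x := G x + M / a * expR (a * x).
have L_nincr x z : x <= z -> L z <= L x.
  move=> xz; apply: (nincr_on xz) => [t _|t _]; first exact: (DerB DG DE).
  rewrite /= [M * _]mulrC -mulrBr pmulr_rle0 ?expR_gt0// subr_le0.
  by apply: le_trans (wM t); exact: ler_norm.
have U_ndecr x z : x <= z -> U x <= U z.
  move=> xz; apply: (ndecr_on xz) => [t _|t _]; first exact: (DerD DG DE).
  rewrite /= [M * _]mulrC -mulrDr mulr_ge0 ?expR_ge0//.
  by have := wM t; rewrite ler_norml => /andP[]; lra.
have M0 : 0 <= M := le_trans (normr_ge0 _) (wM 0).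
have LU x z : L x <= U z.
  have E0 t : 0 <= M / a * expR (a * t).
    by rewrite mulr_ge0 ?expR_ge0// divr_ge0// ltW.
  have LUx t : L t <= U t by rewrite /L /U; have := E0 t; lra.
  have [/U_ndecr xz|/ltW /L_nincr zx] := leP x z; first exact: le_trans (LUx _) xz.
  exact: le_trans zx (LUx _).
pose c := sup (range L).
(* Together with [cL] this says |G - c| <= (M/a) e^(ax), which is the bound claimed for the
   solution. *)
have cU x : c <= U x.
  by apply: ge_sup => [|_ [z _ <-]]; [exists (L 0), 0|exact: LU].
have cL x : L x <= c.
  by apply: ub_le_sup; [exists (U 0) => _ [z _ <-]|exists x].
exists (fun x => (G x - c) * expR (- a * x)).
have EN x : expR (- a * x) * expR (a * x) = 1.
  by rewrite -expRD mulNr addNr expR0.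
split.
- have := DerM (DerB DG (Der_cst c)) (Der_expM (- a)).
  apply: Der_eq => x; rewrite /cst subr0 mulrAC [expR (a * x) * _]mulrC EN.
  by ring.
- move=> x; rewrite normrM (ger0_norm (expR_ge0 _)).
  rewrite -(@ler_pM2r _ (expR (a * x))) ?expR_gt0// -mulrA EN mulr1.
  by have := cU x; have := cL x; rewrite /L /U ler_norml => *; apply/andP; split; lra.
- move=> w0 x; rewrite mulr_ge0 ?expR_ge0// subr_ge0.
  apply: ge_sup => [|_ [z _ <-]]; first by exists (L 0), 0.
  have LG t : L t <= G t.
    by rewrite /L gerBl mulr_ge0 ?expR_ge0// divr_ge0// ltW.
  have [zx|/ltW/L_nincr xz] := leP z x; last exact: le_trans xz (LG _).
  apply: le_trans (LG z) _; apply: (ndecr_on zx) => [t _|t _]; first exact: DG.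
  by rewrite mulr_ge0 ?expR_ge0.
Qed.

Section Resolvent.
Variable R : realType.
Implicit Types (a : R) (w y : R -> R).

Definition solves a w y := bounded_fun y /\
  exists2 d, Der y d & Der d (fun x => a ^+ 2 * y x - w x).

Lemma solves_unique a w y z : 0 < a -> solves a w y -> solves a w z -> y =1 z.
Proof.
move=> a0 [[B yB] [d yd dd]] [[C zC] [e ze ee]] x.
apply/eqP; rewrite -subr_eq0; apply/eqP.
apply: (bounded_homogeneous_eq0 a0 (DerB yd ze)).
  by have := DerB dd ee; apply: Der_eq => t; ring.
by exists (B + C) => t; apply: le_trans (ler_normB _ _) _; rewrite lerD.
Qed.

(** Partial fractions: the inverse of a^2 - D^2 is 1/(2a) times the sum of the inverses of a + D and
    a - D, which give A and B; the second is the first conjugated by x -> -x. For w >= 0 both are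
    nonnegative, so |y'| = |B - A|/2 <= (A + B)/2 = a y. *)
Lemma solves_exists a w : 0 < a -> BC w -> exists y d, [/\ solves a w y, Der y d,
  bounded_fun d & (forall x, 0 <= w x) -> forall x, 0 <= y x /\ `|d x| <= a * y x].
Proof.
move=> a0 [cw [M wM]].
have [A [DA AM A0]] := bounded_first_order a0 cw wM.
have cwN : continuous (fun x => w (- x)).
  by move=> x; apply: continuous_comp; [exact: oppr_continuous|exact: cw].
have [B' [DB' B'M B'0]] := bounded_first_order a0 cwN (fun x => wM (- x)).
pose B x := B' (- x).
have DB : Der B (fun x => a * B x - w x).
  have := Der_reflect 0 DB'; apply: Der_ext => x; rewrite /B sub0r //.
  by rewrite opprK; ring.
have {B'M}BM x : `|B x| <= M / a by exact: B'M.
pose y x := (2 * a)^-1 * (A x + B x); pose d x := 2^-1 * (B x - A x).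
have yd : Der y d.
  have := DerZ (2 * a)^-1 (DerD DA DB); apply: Der_eq => x.
  by rewrite /d; field; rewrite gt_eqF.
have dd : Der d (fun x => a ^+ 2 * y x - w x).
  have := DerZ 2^-1 (DerB DB DA); apply: Der_eq => x.
  by rewrite /y; field; rewrite gt_eqF.
exists y, d; split => //.
- split; last by exists d.
  exists ((2 * a)^-1 * (M / a + M / a)) => x.
  rewrite /y normrM gtr0_norm ?invr_gt0 ?mulr_gt0// ler_pM2l ?invr_gt0 ?mulr_gt0//.
  by apply: le_trans (ler_normD _ _) _; rewrite lerD.
- exists (2^-1 * (M / a + M / a)) => x.
  rewrite /d normrM gtr0_norm ?invr_gt0// ler_pM2l ?invr_gt0//.
  by apply: le_trans (ler_normB _ _) _; rewrite lerD.
- move=> w0 x; have A1 := A0 w0 x.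
  have B1 : 0 <= B x by apply: B'0 => t; exact: w0.
  split; first by rewrite mulr_ge0 ?invr_ge0 ?mulr_ge0 ?addr_ge0// ltW.
  rewrite /d /y; have -> : a * ((2 * a)^-1 * (A x + B x)) = 2^-1 * (A x + B x).
    by field; rewrite gt_eqF.
  rewrite normrM gtr0_norm ?invr_gt0// ler_pM2l ?invr_gt0// ler_norml.
  by apply/andP; split; lra.
Qed.

(** Choice makes this total in [a] and [w]. The default [cst 0] is taken only when no solution
    exists, which [solves_exists] excludes for [0 < a] and [BC w]. *)
Definition resolvent a w : R -> R := xget (cst 0) [set y | solves a w y].

Lemma resolvent_unique a w y : 0 < a -> solves a w y -> resolvent a w = y.
Proof.
move=> a0 s; apply/funext; apply: (solves_unique (w := w) a0) => //.
by rewrite /resolvent; case: xgetP => [z _ //|/(_ y)].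
Qed.

End Resolvent.

Section BoundedContinuous.
Variable R : realType.
Implicit Types (w y : R -> R).

Lemma BC_ext w y : w =1 y -> BC w -> BC y.
Proof. by move=> /funext->. Qed.

Lemma BC_cst (c : R) : BC (fun=> c).
Proof. by split=> [x|]; [exact: cvg_cst|exists `|c|]. Qed.

Lemma BCD w y : BC w -> BC y -> BC (fun x => w x + y x).
Proof.
move=> [cw [M wM]] [cy [N yN]]; split=> [x|]; first by apply: cvgD; [exact: cw|exact: cy].
by exists (M + N) => x; apply: le_trans (ler_normD _ _) _; rewrite lerD.
Qed.

Lemma BCM w y : BC w -> BC y -> BC (fun x => w x * y x).
Proof.
move=> [cw [M wM]] [cy [N yN]]; split=> [x|]; first by apply: cvgM; [exact: cw|exact: cy].
by exists (M * N) => x; rewrite normrM ler_pM.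
Qed.

Lemma BCZ (c : R) w : BC w -> BC (fun x => c * w x).
Proof. by move=> ?; apply: BCM => //; exact: BC_cst. Qed.

Lemma BCN w : BC w -> BC (fun x => - w x).
Proof. by move=> /(BCZ (-1)); apply: BC_ext => x; rewrite mulN1r. Qed.

Lemma BCB w y : BC w -> BC y -> BC (fun x => w x - y x).
Proof. by move=> bw by_; apply: BCD => //; exact: BCN. Qed.

Lemma BC_norm w : BC w -> BC (fun x => `|w x|).
Proof.
move=> [cw [M wM]]; split=> [x|]; first by apply: cvg_norm; exact: cw.
by exists M => x; rewrite normr_id.
Qed.

Lemma BC_comp w (h : R -> R) : continuous h -> BC w -> BC (fun x => w (h x)).
Proof.
move=> ch [cw [M wM]]; split=> [x|]; last by exists M => x; exact: wM.
by apply: continuous_comp; [exact: ch|exact: cw].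
Qed.

Lemma cont_shift (h : R) : continuous (fun x : R => x + h).
Proof. exact: Der_cont (DerD (@Der_id R) (Der_cst h)). Qed.

Lemma cont_reflect (l : R) : continuous (fun x : R => l - x).
Proof. exact: Der_cont (DerB (Der_cst l) (@Der_id R)). Qed.

Lemma BC_shift (h : R) w : BC w -> BC (fun x => w (x + h)).
Proof. exact/BC_comp/cont_shift. Qed.

Lemma BC_reflect (l : R) w : BC w -> BC (fun x => w (l - x)).
Proof. exact/BC_comp/cont_reflect. Qed.

Lemma BC_Der w d : Der w d -> bounded_fun w -> BC w.
Proof. by move=> dw bw; split=> //; exact: Der_cont dw. Qed.

(** The hypothesis says that y e^(ax) is nondecreasing and y e^(-ax) nonincreasing; one is used for
    h >= 0, the other for h <= 0. *)
Lemma harnack (a : R) y d : Der y d -> (forall x, `|d x| <= a * y x) ->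
  forall x h, expR (- a * `|h|) * y x <= y (x + h).
Proof.
move=> dy dE x h.
have dE1 t : - (a * y t) <= d t by have := dE t; rewrite ler_norml => /andP[].
have dE2 t : d t <= a * y t by have := dE t; rewrite ler_norml => /andP[].
have [h0|/ltW h0] := leP 0 h.
- have xh : x <= x + h by rewrite lerDl.
  have D := DerM dy (Der_expM a).
  have := ndecr_on xh (fun t _ => D t).
  rewrite /= ger0_norm// => H.
  have : y x * expR (a * x) <= y (x + h) * expR (a * (x + h)).
    by apply: H => t _; have := dE1 t; have := expR_gt0 (a * t); nra.
  have -> : expR (a * (x + h)) = expR (a * x) * expR (a * h).
    by rewrite -expRD; congr expR; ring.
  rewrite mulrCA [_ * expR (a * x)]mulrC ler_pM2l ?expR_gt0// => yy.
  by rewrite mulNr expRN mulrC ler_pdivrMr ?expR_gt0.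
- have xh : x + h <= x by rewrite gerDl.
  have D := DerM dy (Der_expM (- a)).
  have := nincr_on xh (fun t _ => D t).
  rewrite /= ler0_norm// => H.
  have : y x * expR (- a * x) <= y (x + h) * expR (- a * (x + h)).
    by apply: H => t _; have := dE2 t; have := expR_gt0 (- a * t); nra.
  have -> : expR (- a * (x + h)) = expR (- a * x) * expR (- a * h).
    by rewrite -expRD; congr expR; ring.
  rewrite mulrCA [_ * expR (- a * x)]mulrC ler_pM2l ?expR_gt0// => yy.
  rewrite mulrN mulNr opprK mulrC -ler_pdivlMr ?expR_gt0//.
  by rewrite -expRN -mulNr.
Qed.

End BoundedContinuous.

(** * Positivity, linearity and commutation rules of a single resolvent *)

Section ResolventTheory.
Variables (R : realType) (a : R).
Hypothesis a0 : 0 < a.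
Implicit Types (w y d : R -> R).
Notation K := (resolvent a).

Lemma resolvent_solves w : BC w -> solves a w (K w).
Proof.
by move=> /(solves_exists a0) [y [d [s _ _ _]]]; rewrite (resolvent_unique a0 s).
Qed.

Lemma resolvent_derive w : BC w -> exists d, [/\ Der (K w) d,
  Der d (fun x => a ^+ 2 * K w x - w x), BC d &
  (forall x, 0 <= w x) -> forall x, `|d x| <= a * K w x].
Proof.
move=> bw; have [y [d [s yd bd p]]] := solves_exists a0 bw.
have yE := resolvent_unique a0 s; move: (s) => [_ [d' yd' dd']].
have dE : d' = d by rewrite -(Der_derive1 yd) -(Der_derive1 yd').
rewrite dE in dd'; exists d; rewrite yE; split => //.
  exact: BC_Der dd' bd.
by move=> w0 x; case: (p w0 x).
Qed.

Lemma resolvent_BC w : BC w -> BC (K w).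
Proof.
by move=> bw; have [b [d yd _]] := resolvent_solves bw; exact: BC_Der yd b.
Qed.

Lemma resolvent_ge0 w : BC w -> (forall x, 0 <= w x) -> forall x, 0 <= K w x.
Proof.
move=> bw w0 x; have [y [d [s _ _ p]]] := solves_exists a0 bw.
by rewrite (resolvent_unique a0 s); case: (p w0 x).
Qed.

Lemma resolventD w y : BC w -> BC y -> K (fun x => w x + y x) = fun x => K w x + K y x.
Proof.
move=> bw by_; apply: resolvent_unique => //.
have [[M wM] [d dK dd]] := resolvent_solves bw.
have [[N yN] [e eK ee]] := resolvent_solves by_.
split; first by apply: (BCD _ _).2; exact: resolvent_BC.
exists (fun x => d x + e x); first exact: DerD.
by have := DerD dd ee; apply: Der_eq => x; ring.
Qed.

Lemma resolventZ (c : R) w : BC w -> K (fun x => c * w x) = fun x => c * K w x.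
Proof.
move=> bw; apply: resolvent_unique => //.
have [[M wM] [d dK dd]] := resolvent_solves bw.
split; first by apply: (BCZ c _).2; exact: resolvent_BC.
exists (fun x => c * d x); first exact: DerZ.
by have := DerZ c dd; apply: Der_eq => x; ring.
Qed.

Lemma resolventB w y : BC w -> BC y -> K (fun x => w x - y x) = fun x => K w x - K y x.
Proof.
move=> bw by_; have -> : (fun x => w x - y x) = fun x => w x + (-1) * y x.
  by apply/funext => x; rewrite mulN1r.
rewrite resolventD ?resolventZ//; last exact: BCZ.
by apply/funext => x; rewrite mulN1r.
Qed.

Lemma resolvent_le w y : BC w -> BC y -> (forall x, w x <= y x) ->
  forall x, K w x <= K y x.
Proof.
move=> bw by_ wy x; rewrite -subr_ge0.
have := resolvent_ge0 (BCB by_ bw); rewrite resolventB//; apply => t.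
by rewrite subr_ge0.
Qed.

Lemma resolvent_norm w : BC w -> forall x, `|K w x| <= K (fun x => `|w x|) x.
Proof.
move=> bw x; have bn := BC_norm bw; rewrite ler_norml; apply/andP; split.
- rewrite lerNl -mulN1r -[_ * _]/((fun x => -1 * K w x) x) -resolventZ//.
  apply: resolvent_le => //; first exact: BCZ.
  by move=> t; rewrite mulN1r -normrN ler_norm.
- by apply: resolvent_le => // t; exact: ler_norm.
Qed.

Lemma resolvent_shift (h : R) w : BC w ->
  K (fun x => w (x + h)) = fun x => K w (x + h).
Proof.
move=> bw; apply: resolvent_unique => //.
have [b [d dK dd]] := resolvent_solves bw.
split; first exact: (BC_shift h (resolvent_BC bw)).2.
by exists (fun x => d (x + h)); [exact: Der_shift|exact: Der_shift dd].
Qed.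

Lemma resolvent_reflect (l : R) w : BC w ->
  K (fun x => w (l - x)) = fun x => K w (l - x).
Proof.
move=> bw; apply: resolvent_unique => //.
have [b [d dK dd]] := resolvent_solves bw.
split; first exact: (BC_reflect l (resolvent_BC bw)).2.
exists (fun x => - d (l - x)); first exact: Der_reflect.
by have := DerN (Der_reflect l dd); apply: Der_eq => x; rewrite opprK.
Qed.

(** Differentiating the equation of K w shows that (K w)' is a bounded solution with right-hand side
    w'; uniqueness does the rest. *)
Lemma resolvent_Der w d : BC w -> BC d -> Der w d -> Der (K w) (K d).
Proof.
move=> bw bd dw; have [e [Ke De be _]] := resolvent_derive bw.
suff -> : K d = e by [].
apply: resolvent_unique => //; split; first exact: be.2.
exists (fun x => a ^+ 2 * K w x - w x) => //.
exact: DerB (DerZ _ Ke) dw.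
Qed.

(** By the Harnack inequality one zero of K w makes K w vanish identically, and the equation then
    gives w = 0. *)
Lemma resolvent_gt0 w : BC w -> (forall x, 0 <= w x) -> (exists x, 0 < w x) ->
  forall x, 0 < K w x.
Proof.
move=> bw w0 [x0 wx0] x; have [d [Kd dd _ /(_ w0) dE]] := resolvent_derive bw.
rewrite lt_neqAle eq_sym resolvent_ge0// andbT; apply/eqP => Kx.
have K0 t : K w t = 0.
  apply/eqP; rewrite eq_le resolvent_ge0// andbT.
  have := harnack Kd dE t (x - t); rewrite subrKC Kx.
  by rewrite pmulr_rle0 ?expR_gt0.
have d0 : d = cst 0.
  by rewrite -(Der_derive1 Kd) (_ : K w = cst 0) ?(Der_derive1 (Der_cst _))//; apply/funext.
have := Der_derive1 dd; rewrite d0 (Der_derive1 (Der_cst _)) => /(congr1 (@^~ x0)).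
rewrite /cst K0 mulr0 sub0r => /eqP; rewrite eq_sym oppr_eq0 => /eqP w00.
by rewrite w00 ltxx in wx0.
Qed.

End ResolventTheory.

(** With u the a-resolvent of w, two derivatives pass through the b-resolvent and fall on u, where
    u'' = a^2 u - w. So the b-resolvent of u solves the a-equation for the b-resolvent of w. *)
Lemma resolventC (R : realType) (a b : R) (w : R -> R) : 0 < a -> 0 < b -> BC w ->
  resolvent a (resolvent b w) = resolvent b (resolvent a w).
Proof.
move=> a0 b0 bw; have bu := resolvent_BC a0 bw.
have [d [ud dd bd _]] := resolvent_derive a0 bw.
apply: resolvent_unique => //; split; first exact: (resolvent_BC b0 bu).2.
exists (resolvent b d); first exact: resolvent_Der.
have := resolvent_Der b0 bd _ dd; rewrite resolventB ?resolventZ//.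
- by apply; apply: BCB => //; exact: BCZ.
- exact: BCZ.
Qed.

(** * Odd functions and products of resolvents *)

Definition odd_about (R : realType) (l : R) (z : R -> R) := forall x, z (2 * l - x) = - z x.

Section OddFunctions.
Variables (R : realType) (l : R).
Implicit Types z : R -> R.

Lemma odd_about_center z : odd_about l z -> z l = 0.
Proof.
move=> /(_ l); have -> : 2 * l - l = l by ring.
lra.
Qed.

Variable (a : R).
Hypothesis a0 : 0 < a.

Lemma resolvent_odd z : BC z -> odd_about l z -> odd_about l (resolvent a z).
Proof.
move=> bz oz x; have /(congr1 (@^~ x)) <- := resolvent_reflect a0 (2 * l) bz.
have -> : (fun x => z (2 * l - x)) = fun x => -1 * z x.
  by apply/funext => t; rewrite oz mulN1r.
by rewrite resolventZ// mulN1r.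
Qed.

(** Oddness puts the value 0 at [l], so the maximum principle applies on the half-line to K z -
    m/a^2. *)
Lemma resolvent_left_le z (m : R) : BC z -> odd_about l z -> 0 <= m ->
  (forall x, x < l -> z x <= m) -> forall x, x < l -> resolvent a z x <= m / a ^+ 2.
Proof.
move=> bz oz m0 zm x xl; rewrite -subr_le0.
have [d [zd dd bd _]] := resolvent_derive a0 bz.
have yd := DerB zd (Der_cst (m / a ^+ 2)).
have de : Der (fun x => d x - cst 0 x) (fun x => a ^+ 2 * resolvent a z x - z x).
  by apply: Der_ext dd => t //; rewrite subr0.
have [M zM] := (BCB (resolvent_BC a0 bz) (BC_cst (m / a ^+ 2))).2.
apply: (max_principle a0 yd de (B := M) (l := l) _ _ _ xl).
- move=> t /zm; rewrite /cst; have -> : a ^+ 2 * (resolvent a z t - m / a ^+ 2) = a ^+ 2 * resolvent a z t - m.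
    by field; rewrite gt_eqF.
  lra.
- by move=> t _; apply: le_trans (ler_norm _) _; exact: zM.
- by rewrite (odd_about_center (resolvent_odd bz oz)) sub0r oppr_le0 divr_ge0// sqr_ge0.
Qed.

(** A zero left of [l] would make K z vanish on the whole half-line by the strong maximum principle;
    its derivatives vanish there too, so the equation gives z = 0, contrary to z(x1) < 0. The
    derivative at [l] comes from Hopf's lemma. *)
Lemma resolvent_left_lt z : BC z -> odd_about l z ->
  (forall x, x < l -> z x <= 0) -> (exists2 x, x < l & z x < 0) ->
  (forall x, x < l -> resolvent a z x < 0) /\
  exists2 d, Der (resolvent a z) d & 0 < d l.
Proof.
move=> bz oz z0 [x1 x1l zx1].
have [d [zd dd bd _]] := resolvent_derive a0 bz.
have y0 x : x < l -> resolvent a z x <= 0.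
  by move=> xl; have := resolvent_left_le bz oz (lexx 0) z0 xl; rewrite mul0r.
have yl := odd_about_center (resolvent_odd bz oz).
have sub x : x < l -> a ^+ 2 * resolvent a z x <= a ^+ 2 * resolvent a z x - z x.
  by move=> /z0; lra.
have lt0 x : x < l -> resolvent a z x < 0.
  move=> xl; rewrite lt_neqAle y0// andbT; apply/eqP => yx.
  have y_eq0 := strong_max_principle zd dd sub y0 yl xl yx.
  have nl : \forall t \near x1, t < l by exact: lt_nbhsl.
  have yn : \forall t \near x1, resolvent a z t = 0.
    by apply: filterS nl => t; exact: y_eq0.
  have d_eq0 t : t < l -> d t = 0.
    move=> tl; have nt : \forall s \near t, s < l by exact: lt_nbhsl.
    have h : \forall s \near t, resolvent a z s = cst 0 s.
      by apply: filterS nt => s; exact: y_eq0.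
    have [_ <-] := zd t; rewrite (near_eq_derive _ h).
    exact: derive_val.
  have h : \forall s \near x1, d s = cst 0 s.
    by apply: filterS nl => s; exact: d_eq0.
  have [_] := dd x1; rewrite (near_eq_derive _ h) y_eq0// mulr0 sub0r.
  rewrite derive_val => /eqP; rewrite eq_sym oppr_eq0 => /eqP zE.
  by rewrite zE ltxx in zx1.
split=> //; exists d => //.
exact: (hopf_lemma zd dd sub yl x1l (lt0 _ x1l)).
Qed.

End OddFunctions.

(** The head of the list acts first, whereas in [Lop] it acts last; the two operators therefore
    cancel factor by factor, without commutation. *)
Definition Kop (R : realType) (s : seq R) (w : R -> R) : R -> R :=
  foldl (fun w a => resolvent a w) w s.

Section Kop.
Variable R : realType.
Implicit Types (s : seq R) (w z d : R -> R).
Notation allpos s := (all (fun a : R => 0 < a) s).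

Lemma Kop_BC s w : allpos s -> BC w -> BC (Kop s w).
Proof.
elim: s w => //= a s IH w /andP[a0 s0] bw; apply: IH => //.
exact: resolvent_BC.
Qed.

Lemma KopB s w z : allpos s -> BC w -> BC z ->
  Kop s (fun x => w x - z x) = fun x => Kop s w x - Kop s z x.
Proof.
elim: s w z => //= a s IH w z /andP[a0 s0] bw bz.
by rewrite resolventB// IH//; exact: resolvent_BC.
Qed.

Lemma KopZ s c w : allpos s -> BC w -> Kop s (fun x => c * w x) = fun x => c * Kop s w x.
Proof.
elim: s w => //= a s IH w /andP[a0 s0] bw.
by rewrite resolventZ// IH//; exact: resolvent_BC.
Qed.

Lemma Kop_shift s (h : R) w : allpos s -> BC w ->
  Kop s (fun x => w (x + h)) = fun x => Kop s w (x + h).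
Proof.
elim: s w => //= a s IH w /andP[a0 s0] bw.
by rewrite resolvent_shift// IH//; exact: resolvent_BC.
Qed.

Lemma Kop_reflect s (l : R) w : allpos s -> BC w ->
  Kop s (fun x => w (l - x)) = fun x => Kop s w (l - x).
Proof.
elim: s w => //= a s IH w /andP[a0 s0] bw.
by rewrite resolvent_reflect// IH//; exact: resolvent_BC.
Qed.

Lemma Kop_Der s w d : allpos s -> BC w -> BC d -> Der w d -> Der (Kop s w) (Kop s d).
Proof.
elim: s w d => //= a s IH w d /andP[a0 s0] bw bd dw.
by apply: IH => //; [exact: resolvent_BC|exact: resolvent_BC|exact: resolvent_Der].
Qed.

Lemma Kop_ge0 s w : allpos s -> BC w -> (forall x, 0 <= w x) -> forall x, 0 <= Kop s w x.
Proof.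
elim: s w => //= a s IH w /andP[a0 s0] bw w0.
by apply: IH => //; [exact: resolvent_BC|exact: resolvent_ge0].
Qed.

Lemma Kop_gt0 s w : (0 < size s)%N -> allpos s -> BC w -> (forall x, 0 <= w x) ->
  (exists x, 0 < w x) -> forall x, 0 < Kop s w x.
Proof.
case: s => //= a s _ /andP[a0 s0] bw w0 wx.
have bK := resolvent_BC a0 bw; have Kw0 := resolvent_gt0 a0 bw w0 wx.
elim: s s0 (resolvent a w) bK Kw0 => //= b s IH /andP[b0 s0] {bw w0 wx}w bw w0.
apply: IH => //; first exact: resolvent_BC.
by apply: resolvent_gt0 => //; [move=> x; exact/ltW|exists 0].
Qed.

Lemma resolvent_Kop (a : R) s w : 0 < a -> allpos s -> BC w ->
  resolvent a (Kop s w) = Kop s (resolvent a w).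
Proof.
move=> a0; elim: s w => //= b s IH w /andP[b0 s0] bw.
by rewrite -(resolventC a0 b0 bw); apply: IH => //; exact: resolvent_BC.
Qed.

Lemma Kop_left_le s (l m : R) z : allpos s -> BC z -> odd_about l z -> 0 <= m ->
  (forall x, x < l -> z x <= m) ->
  forall x, x < l -> Kop s z x <= m / \prod_(a <- s) a ^+ 2.
Proof.
elim: s z m => [|a s IH] z m /=.
  by move=> _ _ _ _ zm x xl; rewrite big_nil divr1; exact: zm.
move=> /andP[a0 s0] bz oz m0 zm x xl; rewrite big_cons invfM mulrA.
apply: IH => //; [exact: resolvent_BC|exact: resolvent_odd| |].
  by rewrite divr_ge0// sqr_ge0.
exact: resolvent_left_le.
Qed.

Lemma Kop_left_lt s (l : R) z : (0 < size s)%N -> allpos s -> BC z -> odd_about l z ->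
  (forall x, x < l -> z x <= 0) -> (exists2 x, x < l & z x < 0) ->
  (forall x, x < l -> Kop s z x < 0) /\ exists2 d, Der (Kop s z) d & 0 < d l.
Proof.
elim: s z => // a s IH z _ /= /andP[a0 s0] bz oz z0 zx.
have [lt0 dd] := resolvent_left_lt a0 bz oz z0 zx.
case: s => [|b s] in IH s0 *; first by split.
apply: IH => //; [exact: resolvent_BC|exact: resolvent_odd|by move=> x /lt0/ltW|].
by case: zx => x xl _; exists x => //; exact: lt0.
Qed.

(** The constant is that of the resolvent applied last, whose argument is nonnegative when [w] is;
    it does not depend on [w]. *)
Lemma Kop_derive s : (0 < size s)%N -> allpos s -> exists2 a : R, 0 < a & forall w, BC w ->
  exists d, [/\ Der (Kop s w) d, BC d &
    (forall x, 0 <= w x) -> forall x, `|d x| <= a * Kop s w x].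
Proof.
case/lastP: s => // s a _; rewrite all_rcons => /andP[a0 s0]; exists a => // w bw.
have bK := Kop_BC s0 bw.
have [d [Kd _ bd p]] := resolvent_derive a0 bK.
rewrite /Kop foldl_rcons -/(Kop s w); exists d; split => // w0.
by apply: p; exact: Kop_ge0.
Qed.

Lemma Kop_even_mono s w : allpos s -> BC w -> (forall x, w (- x) = w x) ->
  (forall x y, 0 <= x -> x <= y -> w y <= w x) ->
  (forall x, Kop s w (- x) = Kop s w x) /\
  (forall x y, 0 <= x -> x <= y -> Kop s w y <= Kop s w x).
Proof.
move=> s0 bw ew mw.
have eK x : Kop s w (- x) = Kop s w x.
  have <- : Kop s (fun t => w (0 - t)) x = Kop s w (- x) by rewrite Kop_reflect// sub0r.
  by have -> : (fun t => w (0 - t)) = w by apply/funext => t; rewrite sub0r ew.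
split => // x y x0; rewrite le_eqVlt => /predU1P[->//|xy].
have w_abs t : w `|t| = w t by case: (ger0P t) => // _; rewrite ew.
(* The plane midway between -y and -x: w minus its reflection is odd about it and nonpositive on the
   left, and the comparison is evaluated at -y. *)
pose l := - ((x + y) / 2).
have bz : BC (fun t => w t - w (2 * l - t)) by apply: BCB => //; exact: BC_reflect.
have oz : odd_about l (fun t => w t - w (2 * l - t)).
  move=> t; have -> : 2 * l - (2 * l - t) = t by ring.
  by rewrite opprB.
have yl : - y < l by rewrite /l; lra.
have := Kop_left_le s0 bz oz (lexx 0) _ yl.
rewrite KopB//; last exact: BC_reflect.
rewrite Kop_reflect// mul0r eK.
have -> : 2 * l - - y = - x by rewrite /l; field.
rewrite eK subr_le0; apply => t tl; rewrite subr_le0 -w_abs -[leRHS]w_abs.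
apply: mw; first exact: normr_ge0.
have t0 : t < 0 by rewrite /l in tl; lra.
rewrite (ltr0_norm t0) ler_norml; apply/andP; split; rewrite /l in tl *; lra.
Qed.

End Kop.

(** * Moving planes *)

(** The form in which (F1)-(F3) are used. [nl_super] is (F2) divided by r; [nl_small] makes f
    quadratically small at 0. *)
Record nonlinearity (R : realType) (p : R) (f f' : R -> R) : Prop := Nonlinearity {
  nl_der : Der f f';
  nl_p : 1 < p;
  nl_0 : f 0 = 0;
  nl_gt0 : forall r, 0 < r -> 0 < f r;
  nl_super : forall r, 0 < r -> p * f r <= r * f' r;
  nl_small : forall M, exists2 C, 0 < C & forall r, 0 <= r <= M -> f' r <= C * r }.

Section Lipschitz.
Variable R : realType.

Lemma Der_lipschitz (y d : R -> R) (L : R) : Der y d -> (forall x, `|d x| <= L) ->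
  forall x z, `|y x - y z| <= L * `|x - z|.
Proof.
move=> dy dL; suff H x z : x <= z -> `|y x - y z| <= L * `|x - z|.
  by move=> x z; have [/H//|/ltW/H] := leP x z; rewrite distrC [`|z - x|]distrC.
rewrite le_eqVlt => /predU1P[->|xz]; first by rewrite !subrr normr0 mulr0.
have [c _ E] := MVT_on xz (fun t _ => dy t).
by rewrite distrC E normrM distrC [leRHS]mulrC [leLHS]mulrC ler_wpM2l// dL.
Qed.

End Lipschitz.

Section NonlinearityTheory.
Variables (R : realType) (p : R) (f f' : R -> R).
Hypothesis nl : nonlinearity p f f'.

Lemma nl_cont : continuous f. Proof. exact: Der_cont (nl_der nl). Qed.

Lemma nl_der_gt0 (r : R) : 0 < r -> 0 < f' r.
Proof.
move=> r0; have := nl_super nl r0; have := nl_gt0 nl r0; have := nl_p nl.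
by move=> p1 fr h; rewrite -(pmulr_rgt0 _ r0); nra.
Qed.

Lemma nl_lt (r t : R) : 0 <= r -> r < t -> f r < f t.
Proof.
move=> r0 rt; apply: (incr_on rt) => [x _|x /andP[rx _]]; first exact: (nl_der nl).
by apply: nl_der_gt0; exact: le_lt_trans rx.
Qed.

Lemma nl_le (r t : R) : 0 <= r -> r <= t -> f r <= f t.
Proof.
by move=> r0; rewrite le_eqVlt => /predU1P[->//|rt]; rewrite ltW// nl_lt.
Qed.

Lemma nl_ge0 (r : R) : 0 <= r -> 0 <= f r.
Proof. by move=> r0; rewrite -(nl_0 nl); exact: nl_le. Qed.

(** The slope is controlled by the larger argument [t], which in the moving planes is phi(x), small
    far to the left. *)
Lemma nl_increment (M C : R) : 0 < C -> (forall r, 0 <= r <= M -> f' r <= C * r) ->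
  forall r t, 0 <= r -> r <= t -> t <= M -> f t - f r <= C * t * (t - r).
Proof.
move=> C0 fC r t r0; rewrite le_eqVlt => /predU1P[->|rt] tM.
  by rewrite !subrr mulr0.
have [c /andP[rc ct] ->] := MVT_on rt (fun x _ => nl_der nl x).
rewrite ler_pM2r ?subr_gt0//; apply: le_trans (fC _ _) _.
  by rewrite (le_trans r0 (ltW rc)) (ltW (lt_le_trans ct tM)).
by rewrite ler_pM2l// ltW.
Qed.

Lemma nl_quadratic (M C : R) : 0 < C -> (forall r, 0 <= r <= M -> f' r <= C * r) ->
  forall r, 0 <= r <= M -> f r <= C * r ^+ 2.
Proof.
move=> C0 fC r /andP[r0 rM]; have := nl_increment C0 fC (lexx 0) r0 rM.
by rewrite (nl_0 nl) !subr0 expr2 mulrA.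
Qed.

Lemma nl_BC (phi : R -> R) : BC phi -> (forall x, 0 <= phi x) -> BC (fun x => f (phi x)).
Proof.
move=> [cphi [M phiM]] phi0; split.
  by move=> x; apply: continuous_comp; [exact: cphi|exact: nl_cont].
exists (f M) => x; rewrite ger0_norm ?nl_ge0//; apply: nl_le => //.
by apply: le_trans (ler_norm _) _; exact: phiM.
Qed.

End NonlinearityTheory.

Section MovingPlanes.
Variables (R : realType) (s : seq R) (p : R) (f f' phi : R -> R).
Hypothesis nl : nonlinearity p f f'.
Hypotheses (s_gt0 : (0 < size s)%N) (s_pos : all (fun a : R => 0 < a) s).
Hypotheses (phiBC : BC phi) (phi_gt0 : forall x, 0 < phi x).
Hypothesis phi_decay : forall e, 0 < e -> exists N, forall x, N < `|x| -> phi x < e.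
Hypothesis phiE : phi = Kop s (fun x => f (phi x)).

Let w x := f (phi x).
Let Y l x := phi x - phi (2 * l - x).
Let z l x := w x - w (2 * l - x).

Let wBC : BC w.
Proof. by apply: (nl_BC nl) => // x; exact/ltW. Qed.

Let zBC l : BC (z l). Proof. by apply: BCB => //; exact: BC_reflect. Qed.

Let YE l : Y l = Kop s (z l).
Proof.
rewrite /z KopB//; last exact: BC_reflect.
by rewrite Kop_reflect//; apply/funext => x; rewrite /Y {1 2}phiE.
Qed.

Let z_odd l : odd_about l (z l).
Proof.
move=> x; rewrite /z; have -> : 2 * l - (2 * l - x) = x by ring.
by rewrite opprB.
Qed.

Let pi2 := \prod_(a <- s) a ^+ 2.

Let pi2_gt0 : 0 < pi2.
Proof.
rewrite /pi2; elim: s s_pos => [|a s' IH] /=; first by rewrite big_nil.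
by move=> /andP[a0 /IH h]; rewrite big_cons mulr_gt0// exprn_gt0.
Qed.

(* If m bounds phi - phi(2l - .) on the left then so does m/2, since phi is small where
   the difference is positive; hence the supremum of the difference is 0. *)
Let compact_check : exists N, forall l,
  (forall x, x < l -> - N <= x -> Y l x <= 0) -> forall x, x < l -> Y l x <= 0.
Proof.
have [M phiM] := phiBC.2.
have [C C0 fC] := nl_small nl M.
(* Below this threshold the slope of f is at most [pi2 / 2]; dividing by [pi2] leaves the factor
   1/2. *)
have e0 : 0 < pi2 / (2 * C) by rewrite divr_gt0// mulr_gt0.
have [N phiN] := phi_decay e0; exists N => l check.
have half m : 0 <= m -> (forall x, x < l -> Y l x <= m) ->
    forall x, x < l -> Y l x <= m / 2.
  move=> m0 Ym x xl; rewrite YE.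
  have -> : m / 2 = (C * (pi2 / (2 * C)) * m) / pi2.
    by field; rewrite !gt_eqF.
  apply: Kop_left_le => //.
    by rewrite mulr_ge0// mulr_ge0// ltW.
  move=> {xl}x xl; have [Yx|Yx] := leP (Y l x) 0.
    apply: (@le_trans _ _ 0).
      by rewrite /z subr_le0; apply: (nl_le nl); [exact: ltW|rewrite -subr_le0].
    by rewrite mulr_ge0// mulr_ge0// ltW.
  have xN : x < - N by rewrite ltNge; apply/negP => /(check _ xl); rewrite leNgt Yx.
  have px : phi x < pi2 / (2 * C).
    by apply: phiN; rewrite ltrNr in xN; apply: (lt_le_trans xN); rewrite -normrN ler_norm.
  have pxM : phi x <= M by apply: le_trans (ler_norm _) (phiM x).
  apply: le_trans (nl_increment nl C0 fC (ltW (phi_gt0 _)) _ pxM) _.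
    by rewrite -subr_ge0 ltW.
  apply: ler_pM; [by rewrite mulr_ge0// ltW|exact: ltW| |exact: Ym].
  by rewrite ler_pM2l// ltW.
(* Truncation at 0 makes the supremum nonnegative, as [half] requires. *)
pose E := [set Num.max 0 (Y l x) | x in [set x | x < l]].
have E0 : E !=set0 by exists (Num.max 0 (Y l (l - 1))), (l - 1) => //=; lra.
have EM : has_ubound E.
  exists M => _ [x _ <-]; rewrite ge_max (le_trans _ (phiM 0))//=.
  rewrite /Y lerBlDr; apply: le_trans (ler_norm _) _; apply: le_trans (phiM x) _.
  by rewrite lerDl ltW.
have supE x : x < l -> Num.max 0 (Y l x) <= sup E.
  by move=> xl; apply: ub_le_sup => //; exists x.
have sup0 : 0 <= sup E.
  by apply: le_trans (supE (l - 1) _); [rewrite le_max lexx|lra].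
have YS x : x < l -> Y l x <= sup E.
  by move=> /supE; rewrite ge_max => /andP[].
have : sup E <= sup E / 2.
  apply: ge_sup => // _ [x /= xl <-]; rewrite ge_max divr_ge0//=.
  exact: half.
move=> hS x xl; apply: le_trans (YS x xl) _; lra.
Qed.

Let lipschitz : exists2 L, 0 < L & forall x y, `|phi x - phi y| <= L * `|x - y|.
Proof.
have [a a0 /(_ _ wBC)[d]] := Kop_derive s_gt0 s_pos.
rewrite -phiE => -[pd [_ [L dL]] _]; exists (L + 1).
  by apply: ltr_wpDl => //; apply: le_trans (dL 0); exact: normr_ge0.
move=> x y; apply: (Der_lipschitz pd) => t; apply: le_trans (dL t) _.
by rewrite lerDl.
Qed.

(** Up to l - r/3 the difference Y l is at most -k on the compact part, and a small shift of the
    plane cannot undo this. Closer to the plane the Hopf lemma gives phi'(l) > 0, so phi increases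
    from x to 2m - x. The part beyond -N is left to [compact_check]. *)
Let continuation l : (forall x, x < l -> Y l x <= 0) -> (exists2 x, x < l & Y l x != 0) ->
  exists2 e, 0 < e & forall m, l <= m < l + e -> forall x, x < m -> Y m x <= 0.
Proof.
move=> Y0 [x1 x1l Yx1].
have z0 x : x < l -> z l x <= 0.
  by move=> /Y0; rewrite !subr_le0 => h; rewrite (nl_le nl)// ltW.
have zx1 : z l x1 < 0.
  have := Y0 _ x1l; rewrite le_eqVlt (negbTE Yx1)/= !subr_lt0 => h.
  by rewrite (nl_lt nl)// ltW.
have [] := Kop_left_lt s_gt0 s_pos (zBC l) (@z_odd l) z0.
  by exists x1.
rewrite -YE => Ylt [dY YdY dY0].
have [a a0 /(_ _ wBC)[d]] := Kop_derive s_gt0 s_pos.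
rewrite -phiE => -[pd [cd _] _].
have dl : 0 < d l.
  have YD : Der (Y l) (fun x => d x + d (2 * l - x)).
    by have := DerB pd (Der_reflect (2 * l) pd); apply: Der_eq => x; ring.
  have := Der_derive1 YD; rewrite (Der_derive1 YdY) => /(congr1 (@^~ l)).
  rewrite (_ : 2 * l - l = l); last by ring.
  by move=> /= E; move: dY0; rewrite E; lra.
have [r r0 dr] : exists2 r, 0 < r & forall t, `|l - t| < r -> 0 < d t.
  have : \forall t \near l, 0 < d t by exact: (cvgr_gt (d l) (cd l)).
  move=> /nbhs_ballP[r /= r0 h]; exists r => // t lt_; apply: h; exact: lt_.
have [N check] := compact_check.
have [L L0 phiL] := lipschitz.
have [k k0 Yk] : exists2 k, 0 < k & forall x, - N <= x -> x <= l - r / 3 -> Y l x <= - k.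
  have [Nl|lN] := leP (- N) (l - r / 3); last first.
    by exists 1 => // x Nx xl; have := le_trans Nx xl; rewrite leNgt lN.
  have cY : {within `[- N, l - r / 3], continuous (Y l)}.
    apply: continuous_subspaceT => x; apply: cvgB; first exact: phiBC.1.
    exact: (BC_reflect (2 * l) phiBC).1.
  have [c] := EVT_max Nl cY; rewrite in_itv/= => /andP[_ cl] cmax.
  exists (- Y l c); first by rewrite oppr_gt0 Ylt//; lra.
  by move=> x Nx xl; rewrite opprK cmax// in_itv/= Nx.
(* With m < l + r/3 and x > l - r/3 the point 2m - x stays within r of l; with m - l < k/(2L) the
   shift changes Y by less than k. *)
exists (Num.min (r / 3) (k / (2 * L))).
  by rewrite lt_min !divr_gt0// mulr_gt0.
move=> m /andP[lm]; rewrite -ltrBlDl lt_min => /andP[mr mk].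
apply: check => x xm Nx; have [xl|xl] := leP x (l - r / 3).
- have := Yk x Nx xl; have := phiL (2 * l - x) (2 * m - x).
  have -> : 2 * l - x - (2 * m - x) = - (2 * (m - l)) by ring.
  rewrite normrN (@ger0_norm _ (2 * (m - l))); last by rewrite mulr_ge0// subr_ge0.
  have : L * (2 * (m - l)) < k by move: mk; rewrite ltr_pdivlMr ?mulr_gt0//; lra.
  have := ler_norm (phi (2 * l - x) - phi (2 * m - x)).
  rewrite /Y; lra.
- rewrite subr_le0 ltW//; have xm2 : x < 2 * m - x by lra.
  apply: (incr_on xm2) => [t _|t /andP[xt tm]]; first exact: pd.
  by apply: dr; rewrite ltr_norml; apply/andP; split; lra.
Qed.

Theorem moving_planes : exists l, forall x, phi (2 * l - x) = phi x.
Proof.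
have [N check] := compact_check.
have [L L0 phiL] := lipschitz.
pose A := [set l | forall m, m <= l -> forall x, x < m -> Y m x <= 0].
have AN : A (- N).
  by move=> m mN; apply: check => x xm Nx; move: (lt_le_trans xm mN); rewrite ltNge Nx.
have [B phiB] := phi_decay (phi_gt0 0).
(* Past this bound phi(2l) < phi(0), although the plane at l > 0 would require phi(0) <= phi(2l). *)
have Aub : ubound A (`|B| + 1).
  move=> l Al; rewrite leNgt; apply/negP => Bl.
  have l0 : 0 < l by have := normr_ge0 B; lra.
  have : phi (2 * l) < phi 0.
    apply: phiB; rewrite gtr0_norm ?mulr_gt0//; have := ler_norm B; lra.
  have := Al l (lexx _) 0 l0; rewrite /Y subr0; lra.
have As : has_sup A by split; [exists (- N)|exists (`|B| + 1)].
pose l := sup A.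
have Ylt m : m < l -> forall x, x < m -> Y m x <= 0.
  move=> ml; have e0 : 0 < l - m by lra.
  have [t At] := sup_adherent e0 As; rewrite -/l => mt.
  by apply: At; lra.
have Yl x : x < l -> Y l x <= 0.
  move=> xl; rewrite leNgt; apply/negP => Y0.
  (* Moving the plane back by e keeps x to its left and changes Y by at most 2Le <= Y/2, so a
     positive value would survive at a plane where it is excluded. *)
  pose e := Num.min ((l - x) / 2) (Y l x / (4 * L)).
  have L4 : 0 < 4 * L by rewrite mulr_gt0.
  have e0 : 0 < e by rewrite lt_min; apply/andP; split; apply: divr_gt0 => //; lra.
  have ex : e <= (l - x) / 2 by rewrite ge_min lexx.
  have eY : e <= Y l x / (4 * L) by rewrite ge_min lexx orbT.
  have := Ylt (l - e) _ x; rewrite gtrBl e0 => /(_ isT).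
  have -> : x < l - e by lra.
  move=> /(_ isT).
  have := phiL (2 * (l - e) - x) (2 * l - x).
  have -> : 2 * (l - e) - x - (2 * l - x) = - (2 * e) by ring.
  rewrite normrN (@ger0_norm _ (2 * e)); last by rewrite mulr_ge0// ltW.
  have : e * (4 * L) <= Y l x by rewrite -ler_pdivlMr// mulr_gt0.
  have := ler_norm (phi (2 * (l - e) - x) - phi (2 * l - x)).
  rewrite /Y in Y0 *; lra.
have Y0 x : x < l -> Y l x = 0.
  move=> xl; apply/eqP; apply/negPn/negP => Yx.
  have [|e e0 cont] := continuation Yl; first by exists x.
  suff /(ub_le_sup As.2) : A (l + e / 2) by rewrite -/l; lra.
  move=> m ml; have [lm|/Ylt//] := leP l m.
  by apply: cont; rewrite lm; lra.
exists l => x; have [xl|lx|->] := ltgtP x l.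
- by apply/eqP; rewrite eq_sym -subr_eq0 -/(Y l x) Y0.
- apply/eqP; rewrite -subr_eq0.
  have := Y0 (2 * l - x); rewrite /Y; have -> : 2 * l - (2 * l - x) = x by ring.
  by move=> ->//; lra.
- by congr phi; ring.
Qed.

End MovingPlanes.

(** * Integrals on the line *)

Section Integrals.
Variable R : realType.
Notation mu := (@lebesgue_measure R).
Implicit Types (w u g G : R -> R).

Definition integ w := mu.-integrable setT (EFin \o w).
Definition II w : R := Rintegral mu setT w.

Lemma eq_II w u : w =1 u -> II w = II u.
Proof. by move=> /funext->. Qed.

Lemma integ_ext w u : w =1 u -> integ w -> integ u.
Proof. by move=> /funext->. Qed.

Lemma integD w u : integ w -> integ u -> integ (fun x => w x + u x).
Proof. by move=> iw iu; have := integrableD measurableT iw iu. Qed.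

Lemma integZ (c : R) w : integ w -> integ (fun x => c * w x).
Proof. by move=> iw; have := integrableZl measurableT c iw. Qed.

Lemma integN w : integ w -> integ (fun x => - w x).
Proof. by move=> /(integZ (-1)); apply: integ_ext => x; rewrite mulN1r. Qed.

Lemma integB w u : integ w -> integ u -> integ (fun x => w x - u x).
Proof. by move=> iw iu; apply: integD => //; exact: integN. Qed.

Lemma integ_norm w : integ w -> integ (fun x => `|w x|).
Proof. by move=> iw; have := integrable_norm iw. Qed.

Lemma integ_le w u : measurable_fun setT w -> (forall x, `|w x| <= u x) -> integ u -> integ w.
Proof.
move=> mw wu; apply: le_integrable => //; first exact/measurable_EFinP.
by move=> x _ /=; rewrite lee_fin (le_trans (wu x))// ler_norm.
Qed.

Lemma IID w u : integ w -> integ u -> II (fun x => w x + u x) = II w + II u.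
Proof. by move=> iw iu; rewrite /II RintegralD. Qed.

Lemma IIB w u : integ w -> integ u -> II (fun x => w x - u x) = II w - II u.
Proof. by move=> iw iu; rewrite /II RintegralB. Qed.

Lemma IIZ (c : R) w : integ w -> II (fun x => c * w x) = c * II w.
Proof. by move=> iw; rewrite /II RintegralZl. Qed.

Lemma II_ge0 w : (forall x, 0 <= w x) -> 0 <= II w.
Proof. by move=> w0; apply: Rintegral_ge0. Qed.

Lemma II_le w u : integ w -> integ u -> (forall x, w x <= u x) -> II w <= II u.
Proof. by move=> iw iu wu; apply: le_Rintegral. Qed.

Lemma integ_lty w : measurable_fun setT w -> (forall x, 0 <= w x) ->
  (\int[mu]_x (w x)%:E < +oo)%E -> integ w.
Proof.
move=> mw w0 wlt; apply/integrableP; split; first exact/measurable_EFinP.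
apply: le_lt_trans wlt; rewrite le_eqVlt; apply/predU1P; left.
by apply: eq_integral => x _ /=; rewrite ger0_norm.
Qed.

Lemma EFin_II w : integ w -> (II w)%:E = (\int[mu]_x (w x)%:E)%E.
Proof. by move=> iw; rewrite /II /Rintegral fineK//; exact: integrable_fin_num. Qed.

Lemma dominated_II (g_ : nat -> R -> R) g h : (forall n, measurable_fun setT (g_ n)) ->
  (forall x, g_ ^~ x @ \oo --> g x) -> (forall n x, `|g_ n x| <= h x) -> integ h ->
  integ g /\ II (g_ n) @[n --> \oo] --> II g.
Proof.
move=> mg cvg dom ih.
have mgl : measurable_fun setT g.
  by apply: (@measurable_fun_cvg _ _ _ setT g_ g mg) => x _; exact: cvg.
have [||||| ig _ cI] := @dominated_convergence _ _ _ mu setT measurableT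
  (fun n => EFin \o g_ n) (EFin \o g) (EFin \o h) => //.
- by move=> n; apply/measurable_EFinP; exact: mg.
- exact/measurable_EFinP.
- by apply: aeW => x _; apply: cvg_EFin; [apply: nearW => n|exact: cvg].
- by apply: aeW => x n _ /=; rewrite lee_fin; exact: dom.
split => //.
suff hc : (\int[mu]_x (g_ n x)%:E)%E @[n --> \oo] --> (II g)%:E by exact: (fine_cvg hc).
by rewrite EFin_II.
Qed.

Lemma fatou_II (g_ : nat -> R -> R) g (C : R) : (forall n, integ (g_ n)) ->
  (forall n x, 0 <= g_ n x) -> (forall x, g_ ^~ x @ \oo --> g x) ->
  (forall n, II (g_ n) <= C) -> integ g /\ II g <= C.
Proof.
move=> ig g0 cvg gC.
have mg n : measurable_fun setT (g_ n).
  by apply/measurable_EFinP; exact: (measurable_int _ (ig n)).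
have mgl : measurable_fun setT g.
  by apply: (@measurable_fun_cvg _ _ _ setT g_ g mg) => x _; exact: cvg.
have gl0 x : 0 <= g x.
  by apply: (cvgr_to_ge (cvg x)); apply: nearW => n; exact: g0.
have le : (\int[mu]_x (g x)%:E <= C%:E)%E.
  have := @fatou _ _ _ mu setT measurableT (fun n => EFin \o g_ n).
  have -> : (fun x => limn_einf (fun n => (EFin \o g_ n) x)) = EFin \o g.
    apply/funext => x; rewrite is_cvg_limn_einfE.
      apply/cvg_lim => //; apply: cvg_EFin; [by apply: nearW|exact: cvg].
    apply/cvg_ex; exists (g x)%:E; apply: cvg_EFin; [by apply: nearW|exact: cvg].
  move=> /(_ _ _)/le_trans; apply.
  - by move=> n; apply/measurable_EFinP; exact: mg.
  - by move=> n x _; rewrite lee_fin; exact: g0.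
  - rewrite limn_einf_lim; apply: lime_le; first exact: is_cvg_einfs.
    apply: nearW => n; apply: ge_ereal_inf; eexists; first by exists n => /=.
    by rewrite -EFin_II// lee_fin.
have ig' : integ g by apply: integ_lty => //; apply: le_lt_trans le _; rewrite ltry.
by split => //; rewrite -lee_fin EFin_II.
Qed.

Lemma FTC2_Der G g (a b : R) : a <= b -> continuous g -> Der G g ->
  (\int[mu]_(x in `[a, b]) (g x)%:E = (G b - G a)%:E)%E.
Proof.
rewrite le_eqVlt => /predU1P[->|ab] cg DG.
  by rewrite set_itv1 integral_set1 subrr.
rewrite (continuous_FTC2 ab (F := G)) ?EFinB//.
- exact: continuous_subspaceT.
- split.
  + by move=> x _; exact: Der_derivable DG.
  + by apply: cvg_at_right_filter; exact: (Der_cont DG).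
  + by apply: cvg_at_left_filter; exact: (Der_cont DG).
- by move=> x _; rewrite (Der_derive1 DG).
Qed.

Lemma integ_primitive_le W w (a b : R) : a <= b -> continuous w -> (forall x, 0 <= w x) ->
  integ w -> Der W w -> W b - W a <= II w.
Proof.
move=> ab cw w0 iw DW; rewrite -lee_fin -(FTC2_Der ab cw DW) EFin_II//.
apply: ge0_subset_integral => //; first by apply/measurable_EFinP; exact: continuous_measurable_fun.
by move=> x _; rewrite lee_fin.
Qed.

Lemma integ_of_primitive W w (C : R) : continuous w -> (forall x, 0 <= w x) ->
  Der W w -> (forall n : nat, W n%:R - W (- n%:R) <= C) -> integ w.
Proof.
move=> cw w0 DW WC; have mw := continuous_measurable_fun cw.
apply: integ_lty => //.
pose F (n : nat) : set R := `[- n%:R, n%:R]%classic.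
have ndF : nondecreasing_seq F.
  move=> m n mn; rewrite subsetEset; apply: subset_itv; rewrite bnd_simp ?lerN2 ler_nat//.
have bigF : \bigcup_i F i = setT.
  rewrite -subTset => x _; exists (Num.bound `|x|) => //=.
  by rewrite /F/= in_itv/= -ler_norml ltW// archi_boundP.
have cvgF : (\int[mu]_(x in F i) (w x)%:E)%E @[i --> \oo] --> (\int[mu]_x (w x)%:E)%E.
  rewrite -bigF; apply: ge0_nondecreasing_set_cvg_integral => //.
  - by move=> i; exact: measurable_itv.
  - by move=> i; apply/measurable_EFinP; exact: measurable_funS mw.
  - by move=> i x _; rewrite lee_fin.
apply: (@le_lt_trans _ _ C%:E); last exact: ltry.
apply: (cvge_to_le cvgF); apply: nearW => n.
by rewrite (FTC2_Der _ cw DW) ?lee_fin// (@le_trans _ _ 0)// oppr_le0.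
Qed.

End Integrals.

(** * Symmetry and coercivity of the resolvents *)

(** Boundedness together with integrability makes the class stable under products, so that all the
    quadratic integrals below exist. *)
Definition G1 (R : realType) (w : R -> R) := BC w /\ integ w.

Section IntegrableFunctions.
Variable R : realType.
Notation mu := (@lebesgue_measure R).
Implicit Types (w u y d g G V v : R -> R).

Lemma integ_cont_le w u : continuous w -> (forall x, `|w x| <= u x) -> integ u -> integ w.
Proof. by move=> cw; apply: integ_le; exact: continuous_measurable_fun. Qed.

Lemma G1D w u : G1 w -> G1 u -> G1 (fun x => w x + u x).
Proof. by move=> [bw iw] [bu iu]; split; [exact: BCD|exact: integD]. Qed.

Lemma G1Z (c : R) w : G1 w -> G1 (fun x => c * w x).
Proof. by move=> [bw iw]; split; [exact: BCZ|exact: integZ]. Qed.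

Lemma G1B w u : G1 w -> G1 u -> G1 (fun x => w x - u x).
Proof. by move=> [bw iw] [bu iu]; split; [exact: BCB|exact: integB]. Qed.

Lemma G1_norm w : G1 w -> G1 (fun x => `|w x|).
Proof. by move=> [bw iw]; split; [exact: BC_norm|exact: integ_norm]. Qed.

Lemma G1M w u : BC w -> G1 u -> G1 (fun x => w x * u x).
Proof.
move=> bw [bu iu]; have bwu := BCM bw bu; split => //.
have [M wM] := bw.2.
apply: (@integ_cont_le _ (fun x => M * `|u x|) bwu.1).
  by move=> x; rewrite normrM ler_wpM2r.
by apply: integZ; exact: integ_norm.
Qed.

Lemma G1_le w u : continuous w -> (forall x, `|w x| <= u x) -> G1 u -> G1 w.
Proof.
move=> cw wu [[_ [M uM]] iu]; split; last exact: integ_cont_le iu.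
split=> //; exists M => x; apply: le_trans (wu x) _.
by apply: le_trans (uM x); exact: ler_norm.
Qed.

(** [V] is monotone with total increase at most [II v]; far to the right it is within e of its
    supremum, far to the left within e of its infimum. *)
Lemma integ_tail v V (e : R) : continuous v -> (forall x, 0 <= v x) -> integ v ->
  Der V v -> 0 < e -> exists N, forall x, N < `|x| -> V (x + 1) - V x < e.
Proof.
move=> cv v0 iv DV e0.
have V_ndecr x z : x <= z -> V x <= V z.
  by move=> xy; apply: (ndecr_on xy) => [t _|t _]; [exact: DV|exact: v0].
have VI x z : x <= z -> V z - V x <= II v by move=> xz; exact: integ_primitive_le DV.
have [x1 Vx1] : exists x1, forall x, V x - V x1 < e.
  have S : has_sup (range V).
    split; first by exists (V 0), 0.
    exists (V 0 + II v) => _ [x _ <-]; have [x0|/ltW x0] := leP 0 x.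
      by have := VI _ _ x0; lra.
    by apply: le_trans (V_ndecr _ _ x0) _; rewrite lerDl II_ge0.
  have [_ [x1 _ <-] Sx1] := sup_adherent e0 S; exists x1 => x.
  have : V x <= sup (range V) by apply: ub_le_sup; [exact: S.2|exists x].
  lra.
have [x2 Vx2] : exists x2, forall x, V x2 - V x < e.
  have S : has_inf (range V).
    split; first by exists (V 0), 0.
    exists (V 0 - II v) => _ [x _ <-]; have [x0|/ltW x0] := leP x 0.
      by have := VI _ _ x0; lra.
    by apply: le_trans _ (V_ndecr _ _ x0); rewrite gerBl II_ge0.
  have [_ [x2 _ <-] Sx2] := inf_adherent e0 S; exists x2 => x.
  have : inf (range V) <= V x by apply: ge_inf; [exact: S.2|exists x].
  lra.
exists (`|x1| + `|x2| + 1) => x; have [x0|x0] := leP 0 x.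
- rewrite (ger0_norm x0) => Nx; have : V x1 <= V x.
    by apply: V_ndecr; have := ler_norm x1; have := normr_ge0 x2; lra.
  have := Vx1 (x + 1); lra.
- rewrite (ltr0_norm x0) => Nx; have : V (x + 1) <= V x2.
    apply: V_ndecr; have := ler_norm (- x2); have := normr_ge0 x1.
    rewrite normrN; lra.
  have := Vx2 x; lra.
Qed.

(* By the mean value theorem |G| is, at some point of each unit interval, its mean there,
   so G tends to 0 along a sequence in both directions. *)
Lemma II_derivative G g : Der G g -> continuous g -> integ G -> integ g -> II g = 0.
Proof.
move=> DG cg iG ig.
have cV : continuous (fun x => `|G x|) by move=> x; apply: cvg_norm; exact: Der_cont DG _.
have [V DV] := continuous_primitive cV.
have VE x : exists2 c, x < c < x + 1 & `|G c| = V (x + 1) - V x.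
  have x1 : x < x + 1 by lra.
  have [c cx ->] := MVT_on x1 (fun t _ => DV t); exists c => //; ring.
pose b (n : nat) := projT1 (cid2 (VE n%:R)).
(* The left point lies in (-n-1, -n) and the right one in (n, n+1), so the intervals exhaust the
   line. *)
pose a (n : nat) := projT1 (cid2 (VE (- n%:R - 1))).
have bP n : n%:R < b n < n%:R + 1 /\ `|G (b n)| = V (n%:R + 1) - V n%:R.
  by rewrite /b; case: cid2.
have aP n : - n%:R - 1 < a n < - n%:R - 1 + 1 /\
    `|G (a n)| = V (- n%:R - 1 + 1) - V (- n%:R - 1).
  by rewrite /a; case: cid2.
have abn n : a n <= b n.
  have [/andP[_ h1] _] := aP n; have [/andP[h2 _] _] := bP n.
  by have := ler0n R n; lra.
have mg := continuous_measurable_fun cg.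
pose h n := g \_ `[a n, b n].
have IE n : II (h n) = G (b n) - G (a n).
  rewrite /II /h -Rintegral_mkcond /Rintegral.
  by rewrite (FTC2_Der (abn n) cg DG).
have [||||_ cI] := @dominated_II R h g (fun x => `|g x|).
- move=> n; apply: (proj1 (measurable_restrictT g (measurable_itv _))).
  exact: measurable_funS mg.
- move=> x; apply: cvg_near_cst; near=> n.
  have xn : `|x| < n%:R.
    apply: lt_le_trans (archi_boundP (normr_ge0 x)) _; rewrite ler_nat.
    by near: n; exact: nbhs_infty_ge.
  rewrite /h patchE mem_set//= in_itv/=.
  have [/andP[_ h1] _] := aP n; have [/andP[h2 _] _] := bP n.
  by move: xn; rewrite ltr_norml => /andP[*]; apply/andP; split; lra.
- by move=> n x; rewrite /h patchE; case: ifPn => //; rewrite normr0.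
- exact: integ_norm.
suff c0 : II (h n) @[n --> \oo] --> 0 by exact: (cvg_unique _ cI c0).
apply/cvgrPdist_lt => e e0.
have [N VN] := integ_tail cV (fun x => normr_ge0 _) (integ_norm iG) DV (divr_gt0 e0 (ltr0n _ 2)).
near=> n; rewrite sub0r normrN IE.
have Nn : `|N| < n%:R.
  apply: lt_le_trans (archi_boundP (normr_ge0 N)) _; rewrite ler_nat.
  by near: n; exact: nbhs_infty_ge.
apply: le_lt_trans (ler_normB _ _) _; rewrite [e](splitr e).
rewrite (bP n).2 (aP n).2; apply: ltrD; apply: VN.
  by rewrite ger0_norm//; apply: le_lt_trans Nn; exact: ler_norm.
rewrite -opprD normrN ger0_norm ?addr_ge0//; apply: le_lt_trans (ler_norm _) _; lra.
Unshelve. all: by end_near. Qed.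

(** For u >= 0 the equation a^2 K u = (K u)'' + u gives the primitive ((K u)' + U)/a^2, whose
    increments are bounded. A signed w is dominated through K |w|. *)
Lemma resolvent_G1 (a : R) w : 0 < a -> G1 w -> G1 (resolvent a w).
Proof.
move=> a0; have pos u : G1 u -> (forall x, 0 <= u x) -> G1 (resolvent a u).
  move=> [bu iu] u0; have bK := resolvent_BC a0 bu; split => //.
  have K0 := resolvent_ge0 a0 bu u0.
  have [d [Kd dd [cd [M dM]] _]] := resolvent_derive a0 bu.
  have [U DU] := continuous_primitive bu.1.
  have DW : Der (fun x => (a ^+ 2)^-1 * (d x + U x)) (resolvent a u).
    by have := DerZ (a ^+ 2)^-1 (DerD dd DU); apply: Der_eq => x; field; rewrite gt_eqF.
  apply: (@integ_of_primitive _ _ _ ((a ^+ 2)^-1 * (M + M + II u)) bK.1 K0 DW) => n.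
  rewrite -mulrBr ler_wpM2l ?invr_ge0 ?sqr_ge0//.
  have nn : - n%:R <= n%:R :> R by rewrite (@le_trans _ _ 0)// oppr_le0.
  have := integ_primitive_le nn bu.1 u0 iu DU.
  have := ler_norm (d n%:R); have := dM n%:R.
  have := ler_norm (- d (- n%:R)); have := dM (- n%:R); rewrite normrN; lra.
move=> gw; apply: G1_le (pos _ (G1_norm gw) (fun x => normr_ge0 _)).
  exact: (resolvent_BC a0 gw.1).1.
exact: resolvent_norm gw.1.
Qed.

(** The derivative is dominated by a K |w|: the bound for nonnegative data is applied to |w| + w and
    to |w| - w, and the two inequalities are combined. *)
Lemma resolvent_derive_G1 (a : R) w : 0 < a -> G1 w -> exists d, [/\ Der (resolvent a w) d,
  Der d (fun x => a ^+ 2 * resolvent a w x - w x) & G1 d].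
Proof.
move=> a0 gw; have [bw iw] := gw.
have [d [Kd dd [cd _] _]] := resolvent_derive a0 bw.
have gn := G1_norm gw; have bn := gn.1.
have [e [Ke ee _ _]] := resolvent_derive a0 bn.
exists d; split => //; apply: G1_le (G1Z a (resolvent_G1 a0 gn)) => // x.
have h1 : `|e x + d x| <= a * (resolvent a (fun x => `|w x|) x + resolvent a w x).
  have [e' [Ke' _ _ p]] := resolvent_derive a0 (BCD bn bw).
  move: Ke' p; rewrite resolventD// => Ke' p.
  rewrite -(congr1 (@^~ x) (Der_derive1 (DerD Ke Kd))) (Der_derive1 Ke').
  by apply: p => t; have := ler_norm (- w t); rewrite normrN; lra.
have h2 : `|e x - d x| <= a * (resolvent a (fun x => `|w x|) x - resolvent a w x).
  have [e' [Ke' _ _ p]] := resolvent_derive a0 (BCB bn bw).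
  move: Ke' p; rewrite resolventB// => Ke' p.
  rewrite -(congr1 (@^~ x) (Der_derive1 (DerB Ke Kd))) (Der_derive1 Ke').
  by apply: p => t; rewrite subr_ge0 ler_norm.
move: h1 h2; rewrite !ler_norml => /andP[h1 h2] /andP[h3 h4].
by apply/andP; split; lra.
Qed.

(** The difference of the integrands is the derivative of the Wronskian of K w and K u. *)
Lemma resolvent_sym (a : R) w u : 0 < a -> G1 w -> G1 u ->
  II (fun x => w x * resolvent a u x) = II (fun x => resolvent a w x * u x).
Proof.
move=> a0 gw gu; have gKw := resolvent_G1 a0 gw; have gKu := resolvent_G1 a0 gu.
have [d [Kd dd gd]] := resolvent_derive_G1 a0 gw.
have [e [Ke ee ge]] := resolvent_derive_G1 a0 gu.
pose K := resolvent a.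
have i1 := G1M gw.1 gKu; have i2 := G1M gKw.1 gu.
have DG : Der (fun x => K w x * e x - d x * K u x) (fun x => w x * K u x - K w x * u x).
  by have := DerB (DerM Kd ee) (DerM dd Ke); apply: Der_eq => x; rewrite /K; ring.
have := II_derivative DG (G1B i1 i2).1.1 (G1B (G1M gKw.1 ge) (G1M gd.1 gKu)).2 (G1B i1 i2).2.
by rewrite (IIB i1.2 i2.2) => /eqP; rewrite subr_eq0 => /eqP.
Qed.

Notation allpos s := (all (fun a : R => 0 < a) s).

Lemma Kop_G1 s w : allpos s -> G1 w -> G1 (Kop s w).
Proof.
elim: s w => //= a s IH w /andP[a0 s0] gw; apply: IH => //.
exact: resolvent_G1.
Qed.

Lemma Kop_sym s w u : allpos s -> G1 w -> G1 u ->
  II (fun x => w x * Kop s u x) = II (fun x => Kop s w x * u x).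
Proof.
elim: s w u => //= a s IH w u /andP[a0 s0] gw gu.
rewrite IH//; last exact: resolvent_G1.
by rewrite resolvent_sym//; [rewrite (resolvent_Kop a0 s0 gw.1)|exact: Kop_G1].
Qed.

(** Write u for the first resolvent of w, d = u', y = K u and z = K d = y'. Integrating (d y)'
    yields int w y = a^2 int u y + int d z. The induction hypothesis bounds the first integral below
    and, applied to d, shows that the second is nonnegative. *)
Lemma Kop_coercive s w : allpos s -> G1 w ->
  \prod_(a <- s) a ^+ 2 * II (fun x => Kop s w x ^+ 2) <= II (fun x => w x * Kop s w x).
Proof.
elim: s w => [|a s IH] w /=.
  by move=> _ gw; rewrite big_nil mul1r.
move=> /andP[a0 s0] gw; have gu := resolvent_G1 a0 gw.
have [d [ud dd gd]] := resolvent_derive_G1 a0 gw.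
set u := resolvent a w in gu ud dd *.
have yD := Kop_Der s0 gu.1 gd.1 ud.
have gy := Kop_G1 s0 gu; have gz := Kop_G1 s0 gd.
set y := Kop s u in yD gy *; set z := Kop s d in yD gz.
have iuy := (G1M gu.1 gy); have idz := (G1M gd.1 gz); have iwy := (G1M gw.1 gy).
have DG : Der (fun x => d x * y x) (fun x => a ^+ 2 * (u x * y x) + d x * z x - w x * y x).
  by have := DerM dd yD; apply: Der_eq => x; ring.
have gg := G1B (G1D (G1Z (a ^+ 2) iuy) idz) iwy.
have := II_derivative DG gg.1.1 (G1M gd.1 gy).2 gg.2.
rewrite IIB//; [|exact: (G1D (G1Z _ iuy) idz).2|exact: iwy.2].
rewrite IID//; [|exact: (G1Z _ iuy).2|exact: idz.2].
rewrite IIZ//; last exact: iuy.2.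
have := IH u s0 gu; have := IH d s0 gd; rewrite -/y -/z.
rewrite big_cons; set P := \prod_(j <- s) _ => h1 h2 h3.
have P0 : 0 <= P by rewrite /P; apply: prodr_ge0 => j _; exact: sqr_ge0.
have z0 : 0 <= P * II (fun x => z x ^+ 2).
  by rewrite mulr_ge0// II_ge0// => x; exact: sqr_ge0.
have : a ^+ 2 * (P * II (fun x => y x ^+ 2)) <= a ^+ 2 * II (fun x => u x * y x).
  by rewrite ler_wpM2l ?sqr_ge0.
rewrite mulrA; lra.
Qed.

End IntegrableFunctions.

(** * Smooth functions and bumps *)

Section Smooth.
Variable R : realType.
Implicit Types (g h d : R -> R).

Definition smooth g := forall k x, derivable (dern k g) x 1.

(** Differentiability peeled off from the inside, so that products follow by induction from the
    product rule, without the Leibniz formula. *)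
Fixpoint diffk (k : nat) g : Prop :=
  if k is k'.+1 then (forall x, derivable g x 1) /\ diffk k' (derive1 g) else True.

Lemma dernS k g : dern k.+1 g = dern k (derive1 g).
Proof. by rewrite /dern iterSr. Qed.

Lemma dern_add j k g : dern j (dern k g) = dern (j + k) g.
Proof. by rewrite /dern iterD. Qed.

Lemma smoothP g : smooth g <-> forall k, diffk k g.
Proof.
split.
- move=> sg k; elim: k g sg => //= k IH g sg; split; first exact: (sg 0%N).
  by apply: IH => j x; rewrite -dernS; exact: sg.
- move=> dg k; elim: k g dg => [|k IH] g dg x; first by case: (dg 1%N) => /(_ x).
  by rewrite dernS; apply: IH => j; case: (dg j.+1).
Qed.

Lemma diffkW k g : diffk k.+1 g -> diffk k g.
Proof. by elim: k g => //= k IH g [dg] /IH. Qed.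

Lemma diffkD k g h : diffk k g -> diffk k h -> diffk k (fun x => g x + h x).
Proof.
elim: k g h => //= k IH g h [dg kg] [dh kh]; split.
  by move=> x; apply: derivableD.
rewrite (Der_derive1 (DerD (derivable_Der dg) (derivable_Der dh))).
exact: IH.
Qed.

Lemma diffkM k g h : diffk k g -> diffk k h -> diffk k (fun x => g x * h x).
Proof.
elim: k g h => // k IH g h kg kh; have kg' := diffkW kg; have kh' := diffkW kh.
case: kg kh => [dg kg] [dh kh]; split; first by move=> x; apply: derivableM.
rewrite (Der_derive1 (DerM (derivable_Der dg) (derivable_Der dh))).
by apply: diffkD; exact: IH.
Qed.

Lemma diffk_cst k (c : R) : diffk k (fun=> c).
Proof.
elim: k c => //= k IH c; split; first by move=> x; exact: derivable_cst.
by rewrite (Der_derive1 (Der_cst c)); exact: IH.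
Qed.

Lemma smoothD g h : smooth g -> smooth h -> smooth (fun x => g x + h x).
Proof. by move=> /smoothP sg /smoothP sh; apply/smoothP => k; exact: diffkD. Qed.

Lemma smoothM g h : smooth g -> smooth h -> smooth (fun x => g x * h x).
Proof. by move=> /smoothP sg /smoothP sh; apply/smoothP => k; exact: diffkM. Qed.

Lemma smooth_cst (c : R) : smooth (fun=> c).
Proof. by apply/smoothP => k; exact: diffk_cst. Qed.

Lemma smoothZ (c : R) g : smooth g -> smooth (fun x => c * g x).
Proof. by apply: smoothM; exact: smooth_cst. Qed.
Arguments smoothZ c {g} _.

Lemma smoothB g h : smooth g -> smooth h -> smooth (fun x => g x - h x).
Proof.
move=> sg /(smoothZ (-1)) sh.
have -> : (fun x => g x - h x) = (fun x => g x + -1 * h x).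
  by apply/funext => x; rewrite mulN1r.
exact: smoothD.
Qed.

Lemma smooth_dern k g : smooth g -> smooth (dern k g).
Proof. by move=> sg j x; rewrite dern_add; exact: sg. Qed.
Arguments smooth_dern k {g} _.

Lemma smooth_derive1 g : smooth g -> smooth (derive1 g).
Proof. exact: (smooth_dern 1). Qed.

Lemma smooth_Der k g : smooth g -> Der (dern k g) (dern k.+1 g).
Proof. by move=> sg; apply: derivable_Der => x; exact: sg. Qed.
Arguments smooth_Der k {g} _.

Lemma smooth_Der1 g : smooth g -> Der g (derive1 g).
Proof. exact: (smooth_Der 0). Qed.

Lemma smooth_cont k g : smooth g -> continuous (dern k g).
Proof. by move=> /(smooth_Der k) /Der_cont. Qed.
Arguments smooth_cont k {g} _.

Lemma smooth_class (P : (R -> R) -> Prop) : (forall g, P g -> exists2 d, Der g d & P d) ->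
  forall g, P g -> smooth g.
Proof.
move=> PD g Pg; apply/smoothP => k; elim: k g Pg => //= k IH g Pg.
have [d gd Pd] := PD g Pg; split; first by move=> x; exact: Der_derivable gd.
by rewrite (Der_derive1 gd); exact: IH.
Qed.

Lemma dernD k g h : smooth g -> smooth h ->
  dern k (fun x => g x + h x) = fun x => dern k g x + dern k h x.
Proof.
elim: k g h => // k IH g h sg sh; rewrite dernS.
rewrite (Der_derive1 (DerD (smooth_Der1 sg) (smooth_Der1 sh))).
by rewrite (IH _ _ (smooth_derive1 sg) (smooth_derive1 sh)) !dernS.
Qed.

Lemma dernZ k (c : R) g : smooth g -> dern k (fun x => c * g x) = fun x => c * dern k g x.
Proof.
elim: k g => // k IH g sg; rewrite dernS (Der_derive1 (DerZ c (smooth_Der1 sg))).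
by rewrite (IH _ (smooth_derive1 sg)) dernS.
Qed.

Lemma dernB k g h : smooth g -> smooth h ->
  dern k (fun x => g x - h x) = fun x => dern k g x - dern k h x.
Proof.
move=> sg sh; have -> : (fun x => g x - h x) = (fun x => g x + -1 * h x).
  by apply/funext => x; rewrite mulN1r.
rewrite (dernD k sg (smoothZ (-1) sh)) (dernZ k (-1) sh).
by apply/funext => x; rewrite mulN1r.
Qed.

Lemma smooth_affine (c e : R) g : smooth g -> smooth (fun x => g (c * x + e)) /\
  forall k, dern k (fun x => g (c * x + e)) = fun x => c ^+ k * dern k g (c * x + e).
Proof.
move=> sg; have D h : smooth h ->
    Der (fun x => h (c * x + e)) (fun x => c * derive1 h (c * x + e)).
  move=> sh; have := Der_comp (smooth_Der1 sh) (DerD (DerZ c (@Der_id R)) (Der_cst e)).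
  by apply: Der_eq => x; rewrite /cst/=; ring.
have E k : dern k (fun x => g (c * x + e)) = fun x => c ^+ k * dern k g (c * x + e).
  elim: k => [|k IH]; first by apply/funext => x; rewrite expr0 mul1r.
  rewrite -[LHS]/(derive1 (dern k _)) IH.
  rewrite (Der_derive1 (DerZ (c ^+ k) (D _ (smooth_dern k sg)))).
  by apply/funext => x; rewrite exprSr mulrA.
split; last exact: E.
move=> k x; rewrite E.
by apply: Der_derivable; exact: (DerZ (c ^+ k) (D _ (smooth_dern k sg))).
Qed.

End Smooth.
Arguments smoothZ {R} c {g} _.
Arguments smoothM {R g h} _ _.
Arguments smoothD {R g h} _ _.
Arguments smoothB {R g h} _ _.
Arguments smooth_dern {R} k {g} _.
Arguments smooth_Der {R} k {g} _.
Arguments smooth_cont {R} k {g} _.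


Section Bump.
Variable R : realType.
Implicit Types (p : {poly R}).

(** Each further factor y is absorbed by half of the exponent, as y e^(-ay/2) <= 2/a; hence the
    induction is uniform in [a]. *)
Lemma poly_expR_bounded p (a : R) : 0 < a ->
  exists2 C, 0 <= C & forall y, 0 <= y -> `|p.[y]| * expR (- a * y) <= C.
Proof.
elim/poly_ind: p a => [|p c IH] a a0.
  by exists 0 => // y _; rewrite horner0 normr0 mul0r.
have a2 : 0 < a / 2 by rewrite divr_gt0.
have [C C0 pC] := IH _ a2.
exists (C * (2 / a) + `|c|); first by rewrite addr_ge0 ?mulr_ge0// invr_ge0 ltW.
move=> y y0; rewrite hornerMXaddC; apply: (@le_trans _ _ ((`|p.[y]| * y + `|c|) * expR (- a * y))).
  rewrite ler_pM2r ?expR_gt0//; apply: le_trans (ler_normD _ _) _.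
  by rewrite normrM (ger0_norm y0).
rewrite mulrDl; apply: lerD; last first.
  by rewrite ler_piMr// -expR0 ler_expR mulNr oppr_le0 mulr_ge0// ltW.
have -> : expR (- a * y) = expR (- (a / 2) * y) * expR (- (a / 2) * y).
  by rewrite -expRD; congr expR; field.
rewrite mulrACA; apply: ler_pM.
- by rewrite mulr_ge0// expR_ge0.
- by rewrite mulr_ge0// expR_ge0.
- exact: pC.
- rewrite mulNr expRN ler_pdivrMr ?expR_gt0//.
  have := expR_ge1Dx (a / 2 * y) => h.
  have {1}-> : y = 2 / a * (a / 2 * y) by field; rewrite gt_eqF.
  by rewrite ler_pM2l ?divr_gt0//; lra.
Qed.

(** These extensions by 0 of p(1/x) e^(-1/x) form a class closed under differentiation: p becomes
    X^2 (p - p'). *)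
Definition flat p (x : R) : R := if 0 < x then p.[x^-1] * expR (- x^-1) else 0.

Lemma flat_derive0 p : is_derive (0 : R) 1 (flat p) 0.
Proof.
apply/is_derive1_caratheodory; exists (fun z => flat p z / z).
have f0 : flat p 0 = 0 by rewrite /flat ltxx.
split; last by rewrite f0 mul0r.
- move=> z; rewrite f0 !subr0; have [->|z0] := eqVneq z 0; first by rewrite f0 mul0r mul0r.
  by rewrite divfK.
(* Two extra powers of 1/z: one for the difference quotient, one to leave the factor |z| that tends
   to 0. *)
- have [C C0 pC] := poly_expR_bounded ('X * 'X * p) (@ltr01 R).
  have fC z : `|flat p z / z| <= C * `|z|.
    rewrite /flat; case: ifPn => z0; last by rewrite mul0r normr0 mulr_ge0.
    have zi : 0 <= z^-1 by rewrite invr_ge0 ltW.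
    have := pC _ zi; rewrite !hornerE mulN1r => h.
    rewrite (gtr0_norm z0) -ler_pdivrMr// !normrM (ger0_norm (expR_ge0 _)) (ger0_norm zi).
    apply: le_trans h; rewrite !normrM (ger0_norm zi).
    by rewrite le_eqVlt; apply/predU1P; left; ring.
  apply/cvgrPdist_lt => e e0; rewrite f0 mul0r.
  near=> z; rewrite sub0r normrN; apply: le_lt_trans (fC z) _.
  apply: (@le_lt_trans _ _ ((C + 1) * `|z|)); first by rewrite ler_wpM2r// lerDl.
  rewrite mulrC -ltr_pdivlMr ?ltr_wpDl//.
  near: z; apply: (@nbhs0_lt _ R^o).
  by rewrite divr_gt0// ltr_wpDl.
Unshelve. all: by end_near. Qed.

Lemma flat_Der p : Der (flat p) (flat ('X * 'X * (p - p^`()))).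
Proof.
move=> x; have [x0|x0|->] := ltgtP x 0.
- have nx : \forall t \near x, cst 0 t = flat p t.
    have : \forall t \near x, t < 0 by exact: lt_nbhsl.
    by apply: filterS => t t0; rewrite /flat ltNge (ltW t0).
  apply: near_eq_is_derive nx _; rewrite /flat ltNge (ltW x0)/=.
  exact: is_derive_cst.
- have nx : \forall t \near x, p.[t^-1] * expR (- t^-1) = flat p t.
    have : \forall t \near x, 0 < t by exact: lt_nbhsr.
    by apply: filterS => t t0; rewrite /flat t0.
  apply: near_eq_is_derive nx _; rewrite /flat x0.
  have xn : x != 0 by rewrite gt_eqF.
  have Di : is_derive x 1 (fun t : R => t^-1) (- x ^- 2).
    by apply: is_derive_eq (is_deriveV xn (is_derive_id x 1)) _; rewrite /GRing.scale/= mulr1.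
  have Dp : is_derive x 1 (fun t : R => p.[t^-1]) (p^`().[x^-1] * - x ^- 2).
    exact: (is_derive1_comp (is_derive_poly p x^-1) Di).
  have De : is_derive x 1 (fun t : R => expR (- t^-1)) (expR (- x^-1) * - (- x ^- 2)).
    have Dn : is_derive x 1 (fun t : R => - t^-1) (- - x ^- 2) by exact: (is_deriveN Di).
    exact: (@is_derive1_comp _ (@expR R) (fun t => - t^-1) x _ _ (is_derive_expR (- x^-1)) Dn).
  apply: is_derive_eq (is_deriveM Dp De) _.
  by rewrite /GRing.scale/= !hornerM !hornerX hornerD hornerN; field.
- by have := flat_derive0 p; rewrite [in X in _ -> is_derive _ _ _ X]/flat ltxx.
Qed.

Lemma flat_smooth p : smooth (flat p).
Proof.
apply: (smooth_class (P := fun g => exists p, g = flat p)); last by exists p.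
move=> _ [q ->]; exists (flat ('X * 'X * (q - q^`()))); first exact: flat_Der.
by eexists.
Qed.

Lemma bump_exists : exists b : R -> R, [/\ smooth b, forall x, 0 <= b x, b 0 = 1,
  forall x, `|x| < 1 -> 0 < b x & forall x, 1 <= `|x| -> b x = 0].
Proof.
pose h := flat 1.
have hE x : h x = if 0 < x then expR (- x^-1) else 0 by rewrite /h /flat hornerE mul1r.
have h_ge0 x : 0 <= h x by rewrite hE; case: ifP => // _; exact: expR_ge0.
have h_gt0 x : 0 < x -> 0 < h x by move=> x0; rewrite hE x0 expR_gt0.
have h_0 x : x <= 0 -> h x = 0 by rewrite hE leNgt => /negbTE->.
pose c := (h 1 * h 1)^-1.
have c0 : 0 < c by rewrite invr_gt0 mulr_gt0 ?h_gt0.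
(* The product h(1 + x) h(1 - x), normalized at 0 and spelled so that [smooth_affine] applies. *)
exists (fun x => c * (h (1 * x + 1) * h ((-1) * x + 1))); split.
- have [s1 _] := smooth_affine 1 1 (@flat_smooth 1).
  have [s2 _] := smooth_affine (-1) 1 (@flat_smooth 1).
  exact (smoothZ c (smoothM s1 s2)).
- by move=> x; rewrite mulr_ge0 ?mulr_ge0// ltW.
- by rewrite !mulr0 add0r /c mulVf// gt_eqF// mulr_gt0 ?h_gt0.
- move=> x; rewrite ltr_norml => /andP[x1 x2].
  by rewrite mulr_gt0// mulr_gt0// h_gt0//; lra.
- move=> x; rewrite ler_normr => /orP[x1|x1].
    by rewrite (h_0 (-1 * x + 1)) ?mulr0//; lra.
  by rewrite (h_0 (1 * x + 1)) ?mul0r ?mulr0//; lra.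
Qed.

End Bump.

Section TestFunctions.
Variable R : realType.
Notation mu := (@lebesgue_measure R).
Implicit Types (g h psi eta u : R -> R).

Lemma compact_support_G1 g (M : R) : continuous g ->
  (forall x, M < `|x| -> g x = 0) -> G1 g.
Proof.
move=> cg gM; have M0 : - `|M| <= `|M| by rewrite ge0_cp.
have cn : continuous (fun x => `|g x|) by move=> x; apply: cvg_norm; exact: cg.
have [c _ cmax] := EVT_max M0 (continuous_subspaceT cn).
have gC x : `|g x| <= `|g c|.
  have [xM|xM] := leP `|x| `|M|; first by apply: cmax; rewrite in_itv/= -ler_norml.
  by rewrite gM ?normr0//; apply: le_lt_trans xM; exact: ler_norm.
split; first by split=> //; exists `|g c|.
apply: (@integ_cont_le _ _ (fun x => `|g c| * \1_`[- `|M|, `|M|] x)) => //.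
- move=> x; rewrite indicE; case: (boolP (x \in _)) => xM; first by rewrite mulr1.
  rewrite mulr0 gM ?normr0// ltNge; apply: contra xM => xM.
  rewrite inE/= in_itv/= -ler_norml; apply: le_trans xM _; exact: ler_norm.
- by apply: integZ; exact: integrable_indic_itv.
Qed.

Lemma test_smooth psi : test_fun psi -> smooth psi. Proof. by case. Qed.

Lemma test_derive1 psi : test_fun psi -> test_fun (derive1 psi).
Proof.
move=> [sp [M pM]]; split; first exact: smooth_derive1.
exists M => x Mx; have h : \forall t \near x, psi t = cst 0 t.
  have : \forall t \near x, M < `|t|.
    exact: (cvgr_gt _ (@norm_continuous _ R^o x) _ Mx).
  by apply: filterS => t; exact: pM.
by rewrite derive1E (near_eq_derive _ h) derive_val.
Qed.

Lemma test_dern k psi : test_fun psi -> test_fun (dern k psi).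
Proof.
elim: k psi => // k IH psi tp; rewrite dernS; apply: IH; exact: test_derive1.
Qed.

Lemma test_G1 psi : test_fun psi -> G1 psi.
Proof.
move=> [sp [M pM]]; apply: compact_support_G1 pM; exact: (smooth_cont 0 sp).
Qed.

Lemma testM psi g : test_fun psi -> smooth g -> test_fun (fun x => psi x * g x).
Proof.
move=> [sp [M pM]] sg; split; first exact: (smoothM sp sg).
by exists M => x /pM ->; rewrite mul0r.
Qed.

Lemma test_affine (c e : R) psi : c != 0 -> test_fun psi -> test_fun (fun x => psi (c * x + e)).
Proof.
move=> c0 [sp [M pM]]; split; first exact: (smooth_affine c e sp).1.
exists ((`|M| + `|e|) / `|c|) => x; rewrite ltr_pdivrMr ?normr_gt0// => Mx; apply: pM.
have : `|x| * `|c| <= `|c * x + e| + `|e|.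
  by rewrite mulrC -normrM; have := ler_normB (c * x + e) e; rewrite addrK.
have := ler_norm M; lra.
Qed.

Lemma bump_at (x r : R) : 0 < r -> exists eta, [/\ test_fun eta, forall y, 0 <= eta y,
  0 < eta x & forall y, r <= `|y - x| -> eta y = 0].
Proof.
move=> r0; have [b [sb b0 b1 _ bz]] := bump_exists R.
have tb : test_fun b by split=> //; exists 1 => y /ltW; exact: bz.
exists (fun y => b (r^-1 * y + - (r^-1 * x))); split.
- by apply: test_affine tb; rewrite invr_eq0 gt_eqF.
- by move=> y; exact: b0.
- by rewrite subrr b1.
- move=> y ry; apply: bz; rewrite -mulrBr normrM ger0_norm ?invr_ge0 ?(ltW r0)//.
  by rewrite ler_pdivlMl// mulr1.
Qed.

Lemma II_gt0 u : continuous u -> (forall x, 0 <= u x) -> integ u -> (exists x, 0 < u x) -> 0 < II u.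
Proof.
move=> cu u0 iu [x ux]; have [U DU] := continuous_primitive cu.
have : \forall t \near x, u x / 2 < u t.
  have u2 : u x / 2 < u x by lra.
  exact: (cvgr_gt (u x) (cu x) _ u2).
move=> /nbhs_ballP[r /= r0 ur].
have r2 : x < x + r / 2 by rewrite ltrDl divr_gt0.
have [c /andP[xc cr] E] := MVT_on r2 (fun t _ => DU t).
apply: lt_le_trans (integ_primitive_le (ltW r2) cu u0 iu DU); rewrite E.
rewrite mulr_gt0 ?subr_gt0//; apply: lt_trans (ur c _); first lra.
by rewrite /ball/= ltr_norml; apply/andP; split; lra.
Qed.

Lemma test_le0 u : continuous u ->
  (forall eta, test_fun eta -> (forall x, 0 <= eta x) -> II (fun x => u x * eta x) <= 0) ->
  forall x, u x <= 0.
Proof.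
move=> cu H x; rewrite leNgt; apply/negP => ux.
have : \forall t \near x, 0 < u t by exact: (cvgr_gt (u x) (cu x) _ ux).
move=> /nbhs_ballP[r /= r0 ur].
have [eta [te e0 ex ez]] := bump_at x r0.
have := H eta te e0; rewrite leNgt => /negP; apply.
have ce : continuous (fun x => u x * eta x).
  by move=> t; apply: cvgM; [exact: cu|exact: (smooth_cont 0 (test_smooth te))].
apply: II_gt0 => //.
- move=> t; have [tr|tr] := ltP `|t - x| r; last by rewrite ez ?mulr0.
  by rewrite mulr_ge0// ltW// ur// /ball/= distrC.
- case: (te) => _ [M eM]; apply: (compact_support_G1 ce (M := M) _).2.
  by move=> t /eM ->; rewrite mulr0.
- by exists x; rewrite mulr_gt0.
Qed.

Lemma II_shift u (h : R) : continuous u -> (forall x, 0 <= u x) ->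
  II (fun x => u (x + h)) = II u.
Proof.
move=> cu u0; rewrite /II /Rintegral; congr fine; apply/esym.
have DF := Der_derive1 (DerD (@Der_id R) (Der_cst h)).
have dE : derive1 (fun x : R => x + h) = cst 1 by rewrite DF; apply/funext => x; rewrite addr0.
rewrite (@increasing_ge0_integration_by_substitutionT R (fun x => x + h) u) //.
- by apply: eq_integral => x _ /=; rewrite dE /GRing.mul/= mulr1.
- by move=> x y; rewrite ltrD2r.
- by rewrite dE => x; exact: cvg_cst.
- by rewrite dE; exact: is_cvg_cst.
- by rewrite dE; exact: is_cvg_cst.
- exact: cvg_addrr_Ny.
- exact: cvg_addrr.
Qed.

End TestFunctions.

(** * The differential operator and its inverse *)

Section SmoothIntegrable.
Variable R : realType.
Implicit Types (g h psi eta phi : R -> R) (a : seq R).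
Notation allpos s := (all (fun a : R => 0 < a) s).

(** A substitute for test functions that the resolvents preserve; compact support is lost under
    them. *)
Definition SG g := smooth g /\ forall k, G1 (dern k g).

Lemma SG_G1 g : SG g -> G1 g. Proof. by case=> _ /(_ 0%N). Qed.

Lemma test_SG psi : test_fun psi -> SG psi.
Proof.
by move=> tp; split=> [|k]; [exact: test_smooth|apply: test_G1; exact: test_dern].
Qed.

Lemma SG_dern k g : SG g -> SG (dern k g).
Proof. by move=> [sg gg]; split=> [|j]; [exact: smooth_dern|rewrite dern_add]. Qed.

Lemma SGZ (c : R) g : SG g -> SG (fun x => c * g x).
Proof. by move=> [sg gg]; split=> [|j]; [exact: smoothZ|rewrite dernZ//; exact: G1Z]. Qed.

Lemma SGB g h : SG g -> SG h -> SG (fun x => g x - h x).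
Proof.
move=> [sg gg] [sh gh]; split=> [|j]; first exact: smoothB.
by rewrite dernB//; exact: G1B.
Qed.

Lemma SG_resolvent (b : R) g : 0 < b -> SG g -> SG (resolvent b g).
Proof.
move=> b0 sg.
have D : forall u, SG u -> Der (resolvent b u) (resolvent b (derive1 u)).
  move=> u [su gu]; apply: resolvent_Der => //; [exact: (gu 0%N).1|exact: (gu 1%N).1|].
  exact: smooth_Der1.
have E k : dern k (resolvent b g) = resolvent b (dern k g).
  elim: k g sg => // k IH g sg; rewrite !dernS (Der_derive1 (D _ sg)).
  by apply: IH; exact: (SG_dern 1 sg).
split=> [k x|k]; rewrite E; last by apply: resolvent_G1 => //; exact: sg.2.
by apply: Der_derivable; exact: (D _ (SG_dern k sg)).
Qed.

Lemma SG_Lop a g : SG g -> SG (Lop a g).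
Proof.
move=> sg; elim: a => //= c a IH; apply: SGB; first exact: SGZ.
exact: (SG_dern 2 IH).
Qed.

Lemma test_Lop a g : test_fun g -> test_fun (Lop a g).
Proof.
move=> tg; elim: a => //= c a [sL [M LM]]; split.
  exact (smoothB (smoothZ (c ^+ 2) sL) (smooth_dern 2 sL)).
have [_ [N LN]] := test_dern 2 (conj sL (ex_intro _ M LM)).
exists (Num.max M N) => x; rewrite gt_max => /andP[/LM LMx /LN LNx].
by rewrite -[LHS]/(c ^+ 2 * Lop a g x - dern 2 (Lop a g) x) LMx LNx mulr0 subrr.
Qed.

Notation norms a := [seq `|c| | c <- a].

Lemma norms_pos a : all (fun c => c != 0) a -> allpos (norms a).
Proof. by elim: a => //= c a IH /andP[c0 /IH->]; rewrite normr_gt0 c0. Qed.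

Lemma Lop_resolvent (b : R) g : 0 < b -> BC g ->
  (fun x => b ^+ 2 * resolvent b g x - dern 2 (resolvent b g) x) = g.
Proof.
move=> b0 bg; have [d [Kd dd _ _]] := resolvent_derive b0 bg.
apply/funext => x; rewrite /dern/= (Der_derive1 Kd) (Der_derive1 dd).
by rewrite opprB addrC subrK.
Qed.

Lemma Lop_Kop a g : all (fun c => c != 0) a -> SG g -> Lop a (Kop (norms a) g) = g.
Proof.
elim: a g => //= c a IH g /andP[c0 a0] sg.
have n0 : 0 < `|c| by rewrite normr_gt0.
rewrite IH//; last exact: SG_resolvent.
have -> : c ^+ 2 = `|c| ^+ 2 by rewrite real_normK ?num_real.
exact: (Lop_resolvent n0 (SG_G1 sg).1).
Qed.

Lemma Kop_Lop a g : all (fun c => c != 0) a -> SG g -> Kop (norms a) (Lop a g) = g.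
Proof.
elim: a g => //= c a IH g /andP[c0 a0] sg.
have n0 : 0 < `|c| by rewrite normr_gt0.
rewrite -[RHS](IH g a0 sg); congr (Kop _ _).
have sL := SG_Lop a sg; apply: resolvent_unique => //; split; first exact: (sL.2 0%N).1.2.
exists (derive1 (Lop a g)); first exact: (smooth_Der1 sL.1).
have := smooth_Der 1 sL.1; apply: Der_eq => x.
by rewrite real_normK ?num_real// subKr.
Qed.

End SmoothIntegrable.

(** * From weak solutions to the fixed point equation *)

Lemma cvg_eqfun (R : realType) (u v : nat -> R) (l : R) : u =1 v -> v @ \oo --> l -> u @ \oo --> l.
Proof. by move=> /funext->. Qed.

Section Cutoff.
Variable R : realType.
Implicit Types (g h psi eta phi w : R -> R) (a : seq R) (X hs : nat -> R -> R).
Notation allpos s := (all (fun a : R => 0 < a) s).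
Notation norms a := [seq `|c| | c <- a].

(** The limit [c] is a parameter for the sake of induction: the derivatives of a sequence tending to
    c form a sequence of the same kind tending to 0, so the product rule can be iterated. *)
Definition cutoff_seq (c : R) X := [/\ forall n, smooth (X n),
  forall k, exists C, forall n x, `|dern k (X n) x| <= C &
  forall k x, dern k (X n) x @[n --> \oo] --> (if k is 0 then c else 0)].

(** The majorants are taken in [G1] so that their squares are integrable too, as needed against phi
    in L^2. *)
Definition smooth_dominated hs h := [/\ forall n, smooth (hs n), smooth h &
  forall k, exists D, [/\ G1 D, forall n x, `|dern k (hs n) x| <= D x &
    forall x, dern k (hs n) x @[n --> \oo] --> dern k h x]].

Lemma cutoff_derive c X : cutoff_seq c X -> cutoff_seq 0 (fun n => derive1 (X n)).
Proof.
move=> [sX bX lX]; split=> [n|k|k x]; first exact: smooth_derive1.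
- by have [C XC] := bX k.+1; exists C => n x; rewrite -dernS.
- have -> : (if k is 0 then 0 else 0) = 0 :> R by case: k.
  by apply: cvg_eqfun (lX k.+1 x) => n; rewrite dernS.
Qed.

Lemma cutoff_mul c X psi : cutoff_seq c X -> SG psi -> forall k, exists D,
  [/\ G1 D, forall n x, `|dern k (fun x => X n x * psi x) x| <= D x &
    forall x, dern k (fun x => X n x * psi x) x @[n --> \oo] --> c * dern k psi x].
Proof.
move=> + + k; elim: k c X psi => [|k IH] c X psi cX sp.
- have [sX bX lX] := cX; have [C XC] := bX 0%N.
  exists (fun x => C * `|psi x|); split=> [|n x|x].
  + by apply: G1Z; apply: G1_norm; exact: SG_G1.
  + by rewrite normrM ler_wpM2r//; exact: XC.
  + by apply: cvgMl; exact: (lX 0%N x).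
- have [sX _ _] := cX.
  have [D1 [gD1 b1 l1]] := IH _ _ _ (cutoff_derive cX) sp.
  have [D2 [gD2 b2 l2]] := IH _ _ _ cX (SG_dern 1 sp).
  have E n : dern k.+1 (fun x => X n x * psi x) =
      fun x => dern k (fun x => derive1 (X n) x * psi x) x +
               dern k (fun x => X n x * dern 1 psi x) x.
    rewrite dernS (Der_derive1 (DerM (smooth_Der1 (sX n)) (smooth_Der1 sp.1))).
    exact: (dernD k (smoothM (smooth_derive1 (sX n)) sp.1) (smoothM (sX n) (smooth_dern 1 sp.1))).
  exists (fun x => D1 x + D2 x); split=> [|n x|x]; first exact: G1D.
  + by rewrite E; apply: le_trans (ler_normD _ _) _; rewrite lerD.
  + have -> : c * dern k.+1 psi x = 0 * dern k psi x + c * dern k (dern 1 psi) x.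
      by rewrite mul0r add0r dernS.
    by apply: cvg_eqfun (cvgD (l1 x) (l2 x)) => n; rewrite E.
Qed.

Lemma smooth_dominated_Lop a hs h : smooth_dominated hs h ->
  smooth_dominated (fun n => Lop a (hs n)) (Lop a h).
Proof.
move=> hh; elim: a => //= c a [sL_ sL IH]; split.
- move=> n; exact (smoothB (smoothZ (c ^+ 2) (sL_ n)) (smooth_dern 2 (sL_ n))).
- exact (smoothB (smoothZ (c ^+ 2) sL) (smooth_dern 2 sL)).
move=> k; have [D1 [g1 b1 l1]] := IH k; have [D2 [g2 b2 l2]] := IH (k + 2)%N.
have E u : smooth u -> dern k (fun x => c ^+ 2 * u x - dern 2 u x) =
    fun x => c ^+ 2 * dern k u x - dern (k + 2) u x.
  move=> su; rewrite (dernB k (smoothZ (c ^+ 2) su) (smooth_dern 2 su)).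
  by rewrite (dernZ k (c ^+ 2) su) dern_add.
exists (fun x => c ^+ 2 * D1 x + D2 x); split=> [|n x|x].
- by apply: G1D => //; exact: G1Z.
- rewrite (E _ (sL_ n)); apply: le_trans (ler_normB _ _) _; apply: lerD => //.
  by rewrite normrM ger0_norm ?sqr_ge0// ler_wpM2l ?sqr_ge0.
- pose r x := c ^+ 2 * Lop a h x - dern 2 (Lop a h) x.
  have Ex : dern k r x = c ^+ 2 * dern k (Lop a h) x - dern (k + 2) (Lop a h) x.
    by rewrite /r (E _ sL).
  rewrite -[X in _ --> X]/(dern k r x) [X in _ --> X]Ex.
  by apply: cvg_eqfun (cvgB (cvgMr (l1 x)) (l2 x)) => n; rewrite (E _ (sL_ n)).
Qed.

Lemma cutoff_exists : exists X, cutoff_seq 1 X /\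
  forall n, test_fun (X n) /\ forall x, 0 <= X n x.
Proof.
have [b [sb b0 b1 _ bz]] := bump_exists R.
have tb : test_fun b by split=> //; exists 1 => y /ltW; exact: bz.
(* The k-th derivative of the dilate carries (n+1)^(-k), which gives both the uniform bounds and the
   limit 0. *)
exists (fun n x => b (n.+1%:R^-1 * x + 0)); split; last first.
  move=> n; split; last by move=> x; exact: b0.
  by apply: (test_affine _ _ tb); rewrite invr_eq0 pnatr_eq0.
have E n k := (smooth_affine n.+1%:R^-1 0 sb).2 k.
have bC k : exists C, forall x, `|dern k b x| <= C := (test_G1 (test_dern k tb)).1.2.
have c0 n : 0 <= n.+1%:R^-1 :> R by rewrite invr_ge0.
have c1 n : n.+1%:R^-1 <= 1 :> R by rewrite invf_le1// ler1n.
split=> [n|k|k x].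
- exact: (smooth_affine n.+1%:R^-1 0 sb).1.
- have [C kC] := bC k; exists C => n x; rewrite E normrM; apply: le_trans (kC (n.+1%:R^-1 * x + 0)).
  by rewrite ler_piMl// normrX ger0_norm// exprn_ile1.
- case: k => [|k].
    have h : n.+1%:R^-1 * x + 0 @[n --> \oo] --> (0 : R).
      rewrite -[X in _ --> X]addr0; apply: cvgD; last exact: cvg_cst.
      by rewrite -[X in _ --> X](mul0r x); apply: cvgMl; exact: cvg_harmonic.
    have := continuous_cvg _ (smooth_cont 0 sb 0) h; rewrite [dern 0 b 0]b1.
    exact.
  have [C kC] := bC k.+1; apply: (@squeeze_cvgr _ _ _ _ (fun n => - (n.+1%:R^-1 * C)) (fun n => n.+1%:R^-1 * C)).
  + apply: nearW => n; rewrite E -ler_norml normrM; apply: ler_pM => //.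
    by rewrite exprS normrM !ger0_norm ?exprn_ge0// ler_piMr// exprn_ile1.
  + by rewrite -oppr0; apply: cvgN; rewrite -[X in _ --> X](mul0r C); apply: cvgMl; exact: cvg_harmonic.
  + by rewrite -[X in _ --> X](mul0r C); apply: cvgMl; exact: cvg_harmonic.
Qed.

(** Since K eta lacks compact support, the equation is tested with X_n K eta. The left side
    converges by domination. On the right the integrability of w K eta is not known beforehand:
    Fatou's lemma extracts it from the convergence of the left sides, and then a multiple of w K eta
    is itself the majorant. *)
Lemma weak_solution_Kop a phi w : all (fun c => c != 0) a -> continuous phi ->
  integ (fun x => phi x ^+ 2) -> continuous w -> (forall x, 0 <= w x) ->
  (forall psi, test_fun psi -> II (fun x => phi x * Lop a psi x) = II (fun x => w x * psi x)) ->
  forall eta, test_fun eta -> (forall x, 0 <= eta x) ->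
  integ (fun x => w x * Kop (norms a) eta x) /\
  II (fun x => phi x * eta x) = II (fun x => w x * Kop (norms a) eta x).
Proof.
move=> a0 cphi iphi cw w0 weak eta te e0.
have np := norms_pos a0.
set psi := Kop (norms a) eta.
have sp : SG psi.
  have := test_SG te; rewrite /psi; elim: (norms a) np (eta) => //= c s IH /andP[c0 s0] u su.
  by apply: IH => //; exact: SG_resolvent.
have psi0 x : 0 <= psi x by apply: Kop_ge0 => //; exact: (test_G1 te).1.
have [X [cX XP]] := cutoff_exists.
have tX n : test_fun (fun x => X n x * psi x) by apply: testM sp.1; case: (XP n).
have dom : smooth_dominated (fun n x => X n x * psi x) psi.
  split=> [n||k]; [exact: test_smooth|exact: sp.1|].
  have [D [gD bD lD]] := cutoff_mul cX sp k; exists D; split => // x.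
  by have := lD x; rewrite mul1r.
have [_ _ /(_ 0%N)[D [gD bD lD]]] := smooth_dominated_Lop a dom.
have iD : integ (fun x => phi x ^+ 2 + D x * D x).
  by apply: integD => //; exact: (G1M gD.1 gD).2.
have young s t : `|s * t| <= s ^+ 2 + t * t :> R.
  rewrite normrM -(normr_id t) -[s ^+ 2]real_normK ?num_real//.
  rewrite -[t * t]expr2 -[t ^+ 2]real_normK ?num_real// normr_id.
  have := sqr_ge0 (`|s| - `|t|); have := sqr_ge0 `|s|; have := sqr_ge0 `|t|; nra.
have [||||_ l1] := @dominated_II R (fun n x => phi x * Lop a (fun x => X n x * psi x) x)
    (fun x => phi x * Lop a psi x) (fun x => phi x ^+ 2 + D x * D x).
- move=> n; apply: continuous_measurable_fun => x; apply: cvgM; first exact: cphi.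
  exact: (smooth_cont 0 (test_smooth (test_Lop a (tX n)))).
- by move=> x; apply: cvgMr; exact: lD.
- move=> n x; rewrite normrM; apply: (@le_trans _ _ (`|phi x * D x|)); last exact: young.
  by rewrite normrM ler_wpM2l//; apply: le_trans (bD n x) _; exact: ler_norm.
- exact: iD.
move: l1; rewrite Lop_Kop//; last exact: test_SG.
under eq_fun do rewrite weak//.
move=> l1.
have cwX n : continuous (fun x => w x * (X n x * psi x)).
  move=> x; apply: cvgM; first exact: cw.
  exact: (smooth_cont 0 (test_smooth (tX n))).
have iwX n : integ (fun x => w x * (X n x * psi x)).
  have [_ [M tM]] := tX n; apply: (compact_support_G1 (cwX n) (M := M) _).2.
  by move=> x /tM ->; rewrite mulr0.
have [B IB] : exists B, forall n, II (fun x => w x * (X n x * psi x)) <= B.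
  have /cvg_seq_bounded[B [_ bB]] : cvgn (fun n => II (fun x => w x * (X n x * psi x))).
    by apply/cvg_ex; eexists; exact: l1.
  exists (B + 1) => n; apply: le_trans (ler_norm _) _.
  by apply: (bB (B + 1)) => //; rewrite ltrDl.
have lw x : w x * (X n x * psi x) @[n --> \oo] --> w x * psi x.
  apply: cvgMr; rewrite -[X in _ --> X]mul1r; apply: cvgMl.
  by have [_ _ /(_ 0%N x)] := cX.
have [iwp _] := fatou_II iwX (fun n x => mulr_ge0 (w0 x) (mulr_ge0 ((XP n).2 x) (psi0 x))) lw IB.
split => //.
have [C XC] : exists C, forall n x, `|X n x| <= C by have [_ /(_ 0%N)] := cX.
have [||||_ l2] := @dominated_II R (fun n x => w x * (X n x * psi x))
    (fun x => w x * psi x) (fun x => C * (w x * psi x)).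
- by move=> n; apply: continuous_measurable_fun; exact: cwX.
- exact: lw.
- move=> n x; rewrite mulrCA normrM [X in _ * X]ger0_norm; last by rewrite mulr_ge0.
  by rewrite ler_wpM2r// mulr_ge0.
- exact: integZ.
exact: (cvg_unique _ l1 l2).
Qed.

End Cutoff.

(** * Boundedness, decay and symmetry of a weak solution *)

Section Symmetry.
Variables (R : realType) (a : seq R) (p : R) (f f' phi : R -> R).
Hypotheses (nl : nonlinearity p f f') (a_gt0 : (0 < size a)%N).
Hypotheses (a_neq0 : all (fun c => c != 0) a) (sol : pos_solution a f phi).

Let s := [seq `|c| | c <- a].

Let s_pos : all (fun c : R => 0 < c) s. Proof. exact: norms_pos. Qed.

Let s_gt0 : (0 < size s)%N. Proof. by rewrite size_map. Qed.

Let phi_cont : continuous phi. Proof. by case: sol => _ []. Qed.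

Let phi_gt0 x : 0 < phi x. Proof. by case: sol => _ [_ []]. Qed.

Let phi2_cont : continuous (fun x => phi x ^+ 2).
Proof. move=> x; exact: cvgM (@phi_cont x) (@phi_cont x). Qed.

Let phi2_integ : integ (fun x => phi x ^+ 2).
Proof.
case: sol => -[[mphi i2] _] _; apply: integ_lty.
- exact: continuous_measurable_fun.
- by move=> x; exact: sqr_ge0.
- by under eq_integral do rewrite -[phi _ ^+ 2]ger0_norm ?sqr_ge0// normrX.
Qed.

Let w x := f (phi x).

Let w_cont : continuous w.
Proof. by move=> x; apply: continuous_comp; [exact: phi_cont|exact: (nl_cont nl)]. Qed.

Let w_ge0 x : 0 <= w x. Proof. by apply: (nl_ge0 nl); exact: ltW. Qed.

Let testK eta : test_fun eta -> (forall x, 0 <= eta x) ->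
  integ (fun x => w x * Kop s eta x) /\
  II (fun x => phi x * eta x) = II (fun x => w x * Kop s eta x).
Proof.
apply: weak_solution_Kop => // psi tpsi.
by case: sol => _ [_ [_ h]]; exact: h.
Qed.

Let integ_test (g eta : R -> R) : continuous g -> test_fun eta -> integ (fun x => g x * eta x).
Proof.
move=> cg te; case: (te) => _ [M eM]; apply: (compact_support_G1 (M := M) _ _).2.
  by move=> x; apply: cvgM; [exact: cg|exact: (smooth_cont 0 (test_smooth te))].
by move=> x /eM ->; rewrite mulr0.
Qed.

(** The inequality is transferred by duality, before phi is known to be bounded: translating phi
    amounts to translating eta the other way, and K eta satisfies the Harnack inequality. *)
Let phi_harnack : exists2 b : R, 0 < b &
  forall x h, expR (- b * `|h|) * phi x <= phi (x + h).
Proof.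
have [b b0 bP] := Kop_derive s_gt0 s_pos; exists b => // x h.
pose E := expR (- b * `|h|).
have csh : continuous (fun x => phi (x + h)).
  by move=> t; apply: continuous_comp; [exact: cont_shift|exact: phi_cont].
rewrite -subr_le0; move: x; apply: test_le0.
  by move=> x; apply: cvgB; [apply: cvgMr; exact: phi_cont|exact: csh].
move=> eta te e0.
have -> : (fun x => (expR (- b * `|h|) * phi x - phi (x + h)) * eta x) =
    (fun x => E * (phi x * eta x) - phi (x + h) * eta x).
  by apply/funext => x; rewrite /E; ring.
have i1 := integ_test phi_cont te; have i2 := integ_test csh te.
rewrite IIB//; last exact: integZ.
rewrite IIZ// subr_le0.
have te' : test_fun (fun x => eta (1 * x + - h)) by apply: test_affine te; exact: oner_neq0.
have eE : (fun x => eta (1 * x + - h)) = (fun x => eta (x + - h)).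
  by apply/funext => x; rewrite mul1r.
rewrite eE in te'.
have -> : II (fun x => phi (x + h) * eta x) = II (fun x => phi x * eta (x + - h)).
  rewrite -[RHS](II_shift h).
  - by apply: eq_II => x; rewrite addrK.
  - by move=> x; apply: cvgM; [exact: phi_cont|exact: (smooth_cont 0 (test_smooth te'))].
  - by move=> x; rewrite mulr_ge0// ltW.
have [iw ->] := testK te e0.
have [iw' ->] := testK te' (fun x => e0 _).
have be := (test_G1 te).1; rewrite -IIZ//; apply: II_le => //; first exact: integZ.
move=> x; rewrite Kop_shift// mulrCA ler_wpM2l//.
have [d [Kd _ /(_ e0) dK]] := bP _ be.
by have := harnack Kd dK x (- h); rewrite normrN.
Qed.

(** The mean of phi^2 over [x, x + 1] is attained at some point, where phi is comparable to phi(x).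
    The local L^2 mass thus controls phi pointwise, giving both boundedness and decay. *)
Let phi_decay_aux : exists2 k : R, 0 < k & exists2 V, Der V (fun x => phi x ^+ 2) &
  forall x, (k * phi x) ^+ 2 <= V (x + 1) - V x.
Proof.
have [b b0 bP] := phi_harnack; exists (expR (- b)); first exact: expR_gt0.
have [V DV] := continuous_primitive phi2_cont; exists V => // x.
have x1 : x < x + 1 by lra.
have [c /andP[xc cx] ->] := MVT_on x1 (fun t _ => DV t).
have -> : x + 1 - x = 1 by ring.
rewrite mulr1 ler_sqr ?nnegrE ?mulr_ge0 ?expR_ge0 ?(ltW (phi_gt0 _))//.
have := bP x (c - x); rewrite subrKC; apply: le_trans.
rewrite ler_pM2r// ler_expR mulNr lerN2 ler_piMr ?(ltW b0)// ger0_norm; lra.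
Qed.

Let phi_BC : BC phi.
Proof.
split=> //; have [k k0 [V DV kV]] := phi_decay_aux.
exists (1 + II (fun x => phi x ^+ 2) / k ^+ 2) => x; rewrite gtr0_norm//.
have x1 : x <= x + 1 by lra.
have h : phi x ^+ 2 <= II (fun x => phi x ^+ 2) / k ^+ 2.
  rewrite ler_pdivlMr ?exprn_gt0// mulrC -exprMn; apply: le_trans (kV x) _.
  by apply: integ_primitive_le => // t; exact: sqr_ge0.
have := sqr_ge0 (phi x - 1); nra.
Qed.

Let phi_decay (e : R) : 0 < e -> exists N, forall x, N < `|x| -> phi x < e.
Proof.
move=> e0; have [k k0 [V DV kV]] := phi_decay_aux.
have ke : 0 < (k * e) ^+ 2 by rewrite exprn_gt0// mulr_gt0.
have [N VN] := integ_tail phi2_cont (fun x => sqr_ge0 _) phi2_integ DV ke.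
exists N => x /VN; move=> /(le_lt_trans (kV x)).
by rewrite ltr_sqr ?nnegrE ?mulr_ge0// ?ltW// ltr_pM2l.
Qed.

Let w_G1 : G1 w.
Proof.
have bw : BC w by apply: (nl_BC nl phi_BC) => x; exact: ltW.
split => //; have [M phiM] := phi_BC.2; have [C C0 fC] := nl_small nl M.
apply: integ_cont_le (integZ C phi2_integ) => // x; rewrite ger0_norm//.
apply: (nl_quadratic nl C0 fC); rewrite ltW//=.
by apply: le_trans (ler_norm _) (phiM x).
Qed.

Lemma solution_Kop : phi = Kop s w.
Proof.
have gK := Kop_G1 s_pos w_G1.
have E eta : test_fun eta -> (forall x, 0 <= eta x) ->
    II (fun x => phi x * eta x) = II (fun x => Kop s w x * eta x).
  by move=> te e0; rewrite (testK te e0).2 Kop_sym//; exact: test_G1.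
have i1 eta (te : test_fun eta) := integ_test phi_cont te.
have i2 eta (te : test_fun eta) := integ_test gK.1.1 te.
have h1 : forall x, phi x - Kop s w x <= 0.
  apply: test_le0; first by move=> x; apply: cvgB; [exact: phi_cont|exact: gK.1.1].
  move=> eta te e0.
  have -> : (fun x => (phi x - Kop s w x) * eta x) =
    (fun x => phi x * eta x - Kop s w x * eta x) by apply/funext => x; rewrite mulrBl.
  by rewrite IIB ?E ?subrr//; [exact: i1|exact: i2].
have h2 : forall x, Kop s w x - phi x <= 0.
  apply: test_le0; first by move=> x; apply: cvgB; [exact: gK.1.1|exact: phi_cont].
  move=> eta te e0.
  have -> : (fun x => (Kop s w x - phi x) * eta x) =
    (fun x => Kop s w x * eta x - phi x * eta x) by apply/funext => x; rewrite mulrBl.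
  by rewrite IIB ?E ?subrr//; [exact: i2|exact: i1].
by apply/funext => x; have := h1 x; have := h2 x; lra.
Qed.

Theorem solution_symmetric : exists l, forall x, phi (2 * l - x) = phi x.
Proof.
exact: (moving_planes nl s_gt0 s_pos phi_BC phi_gt0 phi_decay solution_Kop).
Qed.

End Symmetry.

(** * The potential, power decay and compactness *)

Section Potential.
Variables (R : realType) (p : R) (f f' F : R -> R).
Hypothesis nl : nonlinearity p f f'.
Hypotheses (FD : Der F f) (F0 : F 0 = 0).

(** This is (F2) integrated: f(r)/r^p is nondecreasing. The dilation is written as e^t, which turns
    the real power into [expR (p * t)]. *)
Lemma nl_scale (r t : R) : 0 <= r -> 0 <= t -> expR (p * t) * f r <= f (r * expR t).
Proof.
rewrite le_eqVlt => /predU1P[<-|r0] t0; first by rewrite mul0r (nl_0 nl) mulr0.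
pose k t := f (r * expR t) * expR (- p * t).
have Dk : Der k (fun t => (r * expR t * f' (r * expR t) - p * f (r * expR t)) * expR (- p * t)).
  have De : Der (fun t : R => r * expR t) (fun t => r * expR t).
    by apply: DerZ => x; exact: is_derive_expR.
  have := DerM (Der_comp (nl_der nl) De) (Der_expM (- p)).
  by apply: Der_eq => x; ring.
have : k 0 <= k t.
  apply: (ndecr_on t0) => [x _|x _]; first exact: Dk.
  by rewrite mulr_ge0 ?expR_ge0// subr_ge0 (nl_super nl)// mulr_gt0 ?expR_gt0.
rewrite /k mulr0 expR0 !mulr1 mulNr expRN ler_pdivlMr ?expR_gt0//.
by rewrite mulrC.
Qed.

(** Cross-multiplied monotonicity of f(r)/r, a consequence of that of f(r)/r^p because p > 1. *)
Lemma nl_ratio (v r : R) : 0 < v -> v <= r -> f v * r <= f r * v.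
Proof.
move=> v0 vr; have r0 := lt_le_trans v0 vr.
have rv : 0 < r / v by rewrite divr_gt0.
have t0 : 0 <= ln (r / v) by rewrite ln_ge0// ler_pdivlMr// mul1r.
have := nl_scale (ltW v0) t0; rewrite lnK// mulrCA divff ?gt_eqF// mulr1.
have : r / v <= expR (p * ln (r / v)).
  by rewrite -{1}[r / v]lnK// ler_expR ler_peMl// ltW// (nl_p nl).
move=> h1 h2; have fv : 0 <= f v := nl_ge0 nl (ltW v0).
have := le_trans (ler_wpM2r fv h1) h2.
by rewrite mulrAC ler_pdivrMr// mulrC.
Qed.

(** The derivative of r f - (p + 1) F is r f' - p f >= 0. *)
Lemma potential_le (r : R) : 0 <= r -> (p + 1) * F r <= r * f r.
Proof.
move=> r0; have D := DerB (DerM (@Der_id R) (nl_der nl)) (DerZ (p + 1) FD).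
have := ndecr_on r0 (fun x _ => D x); rewrite F0 mul0r mulr0 subr0 subr_ge0; apply.
move=> x /andP[x0 _]; rewrite /cst; have := nl_super nl x0; lra.
Qed.

Lemma potential_ge0 (r : R) : 0 <= r -> 0 <= F r.
Proof.
move=> r0; rewrite -F0; apply: (ndecr_on r0) => [x _|x /andP[x0 _]]; first exact: FD.
by apply: (nl_ge0 nl); exact: ltW.
Qed.

Lemma potential_le_prod (r : R) : 0 <= r -> F r <= r * f r.
Proof.
move=> r0; apply: le_trans (potential_le r0); have := potential_ge0 r0.
have := nl_p nl; nra.
Qed.

(* F is a convex function of r^2, because F'(r)/r = f(r)/r is nondecreasing. *)
Lemma potential_convex (v r : R) : 0 < v -> 0 <= r ->
  f v / v / 2 * (r ^+ 2 - v ^+ 2) <= F r - F v.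
Proof.
move=> v0 r0; pose c := f v / v.
have D := DerB FD (DerZ (c / 2) (DerX2 (@Der_id R))).
suff : F v - c / 2 * v ^+ 2 <= F r - c / 2 * r ^+ 2 by rewrite /c; lra.
have [vr|/ltW rv] := leP v r.
- have /= := ndecr_on vr (fun x _ => D x); apply => x /andP[vx _].
  rewrite /cst mulr1; have -> : c / 2 * (2 * x) = c * x by field.
  by rewrite subr_ge0 /c mulrAC ler_pdivrMr// nl_ratio// ltW.
- have /= := nincr_on rv (fun x _ => D x); apply => x /andP[rx xv].
  rewrite /cst mulr1; have -> : c / 2 * (2 * x) = c * x by field.
  by rewrite subr_le0 /c mulrAC ler_pdivlMr// nl_ratio ?(le_lt_trans r0)// ltW.
Qed.

End Potential.

Section PowerDecay.
Variable R : realType.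

Let sqrt_Der (x : R) : 0 <= x ->
  is_derive x 1 (fun t : R => (Num.sqrt (1 + t))^-1) (- ((2 * (1 + x) * Num.sqrt (1 + x))^-1)).
Proof.
move=> x0; have x1 : 0 < 1 + x by rewrite ltr_pwDl.
have s0 : 0 < Num.sqrt (1 + x) by rewrite sqrtr_gt0.
have D1 : is_derive x 1 (fun t : R => 1 + t) 1.
  by have := DerD (Der_cst (1 : R)) (@Der_id R) x; rewrite /cst add0r.
have D2 : is_derive x 1 (fun t : R => Num.sqrt (1 + t)) ((2 * Num.sqrt (1 + x))^-1 * 1).
  exact: (@is_derive1_comp _ Num.sqrt (fun t : R => 1 + t) x _ _ (is_derive1_sqrt x1) D1).
have sn : Num.sqrt (1 + x) != 0 by rewrite gt_eqF.
apply: is_derive_eq (@is_deriveV _ (fun t => Num.sqrt (1 + t)) x _ 1 sn D2) _.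
rewrite /GRing.scale/= sqr_sqrtr ?(ltW x1)// mulr1.
by field; rewrite sn gt_eqF.
Qed.

(** The exponent 3/2 is that of v^3 when v^2 (1 + |x|) is bounded. Each half-line contributes at
    most 2, by comparison with -2 (1 + x)^(-1/2). *)
Lemma integ_power_decay : integ (fun x : R => ((1 + `|x|) * Num.sqrt (1 + `|x|))^-1).
Proof.
set d := fun x => _.
have d0 x : 0 <= d x by rewrite invr_ge0 mulr_ge0 ?sqrtr_ge0// addr_ge0.
have cn : continuous (fun x : R => 1 + `|x|).
  by move=> x; apply: cvgD; [exact: cvg_cst|exact: norm_continuous].
have cd : continuous d.
  move=> x; apply: cvgV; first by rewrite gt_eqF// mulr_gt0// ltr_pwDl.
  apply: cvgM; first exact: cn.
  by apply: (continuous_comp (cn x)); exact: sqrt_continuous.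
have [W DW] := continuous_primitive cd.
apply: (@integ_of_primitive _ _ _ 4 cd d0 DW) => n.
have n0 : 0 <= n%:R :> R by [].
have q1 (x : R) : 0 <= x -> 0 < (Num.sqrt (1 + x))^-1.
  by move=> x0; rewrite invr_gt0 sqrtr_gt0 ltr_pwDl.
have h1 : W n%:R + 2 * (Num.sqrt (1 + n%:R))^-1 <= W 0 + 2.
  have D (x : R) : 0 <= x -> is_derive x 1 (fun t => W t + 2 * (Num.sqrt (1 + t))^-1) 0.
    move=> x0; have h := sqrt_Der x0; have hW := DW x.
    apply: is_derive_eq (is_deriveD hW (is_deriveZ 2 h)) _.
    rewrite /GRing.scale/= /d ger0_norm//.
    have x1 : 0 < 1 + x by rewrite ltr_pwDl.
    by field; rewrite !gt_eqF ?sqrtr_gt0.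
  have := nincr_on n0 (fun x (h : 0 <= x <= n%:R) => D x (proj1 (andP h))).
  by rewrite /= addr0 sqrtr1 invr1 mulr1; apply.
have h2 : W 0 - 2 <= W (- n%:R) - 2 * (Num.sqrt (1 + n%:R))^-1.
  have D (x : R) : 0 <= x -> is_derive x 1 (fun t => W (- t) - 2 * (Num.sqrt (1 + t))^-1) 0.
    move=> x0; have h := sqrt_Der x0.
    have hW : is_derive x 1 (fun t => W (- t)) (- d (- x)).
      by have := Der_reflect 0 DW x; under eq_fun do rewrite sub0r; rewrite sub0r.
    apply: is_derive_eq (is_deriveB hW (is_deriveZ 2 h)) _.
    rewrite /GRing.scale/= /d normrN ger0_norm//.
    have x1 : 0 < 1 + x by rewrite ltr_pwDl.
    by field; rewrite !gt_eqF ?sqrtr_gt0.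
  have := ndecr_on n0 (fun x (h : 0 <= x <= n%:R) => D x (proj1 (andP h))).
  by rewrite /= oppr0 addr0 sqrtr1 invr1 mulr1; apply.
have := q1 _ n0; lra.
Qed.

End PowerDecay.

Section Compactness.
Variable R : realType.

(* A cluster point in the product topology is approached on the finite grids
   {j/(k+1) : |j| <= (k+1)^2}; equicontinuity does the rest. *)
Lemma equilipschitz_subsequence (v : nat -> R -> R) (M L : R) :
  (forall n x, 0 <= v n x <= M) ->
  (forall n x z, `|v n x - v n z| <= L * `|x - z|) ->
  exists (sg : nat -> nat) (u : R -> R), (forall n, (n <= sg n)%N) /\
    forall x, v (sg n) x @[n --> \oo] --> u x.
Proof.
move=> vM vL.
have cT : compact [set g : prod_topology (fun _ : R => R : topologicalType) |
    forall x, `[0, M]%classic (g x)].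
  by apply: (@tychonoff R (fun=> R : topologicalType) (fun=> `[0, M]%classic)) => x; exact: segment_compact.
have vA : (v @ \oo) [set g : prod_topology (fun _ : R => R : topologicalType) |
    forall x, `[0, M]%classic (g x)].
  by exists 0%N => // n _ /= x; rewrite in_itv/=; exact: vM.
have [u [_ cu]] := cT (v @ \oo) (fmap_proper_filter v _) vA.
have approx (e : R) (s : seq R) (N : nat) : 0 < e ->
    exists2 n, (N <= n)%N & forall x, x \in s -> `|u x - v n x| < e.
  move=> e0.
  have nu : nbhs u [set g : prod_topology (fun _ : R => R : topologicalType) |
      forall x, x \in s -> `|u x - g x| < e].
    have FU : Filter (nbhs u) := nbhs_filter u.
    elim: s => [|x s IH]; first by apply: (@filterS _ _ FU setT) filterT => g _ x; rewrite in_nil.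
    have cx : nbhs u [set g : prod_topology (fun _ : R => R : topologicalType) | `|u x - g x| < e].
      have := @proj_continuous R (fun=> R : topologicalType) x u.
      by move=> /cvgrPdist_lt/(_ e e0).
    apply: (@filterS2 _ _ FU _ _ _ _ IH cx) => g gs gx z; rewrite inE => /orP[/eqP->//|]; exact: gs.
  have nN : (v @ \oo) [set g | exists2 n, (N <= n)%N & g = v n].
    by exists N => // n Nn; exists n.
  have [g [[n Nn ->] gs]] := cu _ _ nN nu.
  by exists n.
pose grid (k : nat) : seq R :=
  [seq j%:R / k.+1%:R | j <- iota 0 (k.+1 ^ 2).+1] ++
  [seq - (j%:R / k.+1%:R) | j <- iota 0 (k.+1 ^ 2).+1].
have e0 k : 0 < k.+1%:R^-1 :> R by rewrite invr_gt0.
(* The condition k <= n keeps the chosen terms at least as good as the k-th; this is how the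
   energies along [sg] tend to the infimum. *)
have sgP k : exists n, (k <= n)%N /\ forall x, x \in grid k -> `|u x - v n x| < k.+1%:R^-1.
  by have [n kn h] := approx _ (grid k) k (e0 k); exists n.
have [sg sgE] := choice sgP.
exists sg, u; split=> [k|x]; first by case: (sgE k).
have L0 : 0 <= L.
  have := vL 0%N 1 0; rewrite subr0 normr1 mulr1; apply: le_trans; exact: normr_ge0.
have uL y z : `|u y - u z| <= L * `|y - z|.
  apply/ler_addgt0Pr => e e_gt0; have e2 : 0 < e / 2 by rewrite divr_gt0.
  have [n _ h] := approx _ [:: y; z] 0%N e2.
  have h1 : `|u y - v n y| < e / 2 by apply: h; rewrite !inE eqxx.
  have h2 : `|u z - v n z| < e / 2 by apply: h; rewrite !inE eqxx orbT.
  have -> : u y - u z = (u y - v n y) + (v n y - v n z) - (u z - v n z) by ring.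
  apply: le_trans (ler_normB _ _) _.
  have := ler_normD (u y - v n y) (v n y - v n z); have := vL n y z; lra.
have near_grid k : `|x| <= k.+1%:R -> exists2 z, z \in grid k & `|x - z| <= k.+1%:R^-1.
  move=> xk; pose j := Num.truncn (`|x| * k.+1%:R).
  have x0 : 0 <= `|x| * k.+1%:R by rewrite mulr_ge0.
  have /andP[jx xj] := truncn_itv x0.
  have jk : (j <= k.+1 ^ 2)%N.
    rewrite -(ler_nat R); apply: le_trans jx _.
    by rewrite natrX expr2 ler_wpM2r.
  have jz : `| `|x| - j%:R / k.+1%:R| <= k.+1%:R^-1.
    rewrite -(@ler_pM2r _ k.+1%:R)// mulVf ?pnatr_eq0//.
    rewrite -[X in _ * X](@ger0_norm _ k.+1%:R)// -normrM mulrBl divfK ?pnatr_eq0//.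
    by rewrite ger0_norm ?subr_ge0// lerBlDr addrC natr1 ltW.
  have [x_ge0|x_lt0] := leP 0 x.
  - exists (j%:R / k.+1%:R); last by move: jz; rewrite (ger0_norm x_ge0).
    rewrite mem_cat; apply/orP; left; apply: (map_f (fun j => j%:R / k.+1%:R)).
    by rewrite mem_iota/= add0n ltnS.
  - exists (- (j%:R / k.+1%:R)).
      rewrite mem_cat; apply/orP; right; apply: (map_f (fun j => - (j%:R / k.+1%:R))).
      by rewrite mem_iota/= add0n ltnS.
    by move: jz; rewrite (ltr0_norm x_lt0) -opprD normrN opprK.
apply/cvgrPdist_lt => e e_gt0.
have eL : 0 < e / (2 * L + 1) by rewrite divr_gt0// ltr_wpDl// mulr_ge0.
near=> k.
have xk : `|x| <= k.+1%:R.
  apply: ltW; apply: lt_le_trans (archi_boundP (normr_ge0 x)) _; rewrite ler_nat leqW//.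
  by near: k; exact: nbhs_infty_ge.
have ke : k.+1%:R^-1 < e / (2 * L + 1).
  by near: k; exact: (near_infty_natSinv_lt (PosNum eL)).
have [z zg xz] := near_grid k xk.
have h := (sgE k).2 z zg.
have -> : u x - v (sg k) x = (u x - u z) + (u z - v (sg k) z) - (v (sg k) x - v (sg k) z) by ring.
apply: le_lt_trans (ler_normB _ _) _.
have h1 := ler_normD (u x - u z) (u z - v (sg k) z).
have h2 := uL x z; have h3 := vL (sg k) x z.
have h4 : L * `|x - z| <= L * k.+1%:R^-1 by rewrite ler_wpM2l.
move: ke; rewrite ltr_pdivlMr ?ltr_wpDl ?mulr_ge0//.
move: (k.+1%:R^-1) h h4 => ki h h4; rewrite mulrDr mulr1 mulrCA [ki * L]mulrC => ke; lra.
Unshelve. all: by end_near. Qed.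


End Compactness.

(** * Nehari manifold and minimization *)

Lemma lipschitz_within (R : realType) (g : R -> R) (a b L : R) :
  (forall x y, a <= x -> x <= y -> y <= b -> `|g x - g y| <= L * (y - x)) ->
  {within `[a, b], continuous g}.
Proof.
move=> gL; apply/subspace_continuousP => x /=; rewrite in_itv/= => /andP[ax xb].
have L0 : 0 < `|L| + 1 by rewrite ltr_wpDl.
apply/cvgrPdist_lt => e e0; rewrite near_withinE; near=> y; rewrite /= in_itv/= => /andP[ay yb].
have xy : `|x - y| < e / (`|L| + 1).
  near: y; apply: (@cvgr_dist_lt _ _ _ _ _ id x cvg_id _ _).
  by rewrite divr_gt0.
have gxy : `|g x - g y| <= `|L| * `|x - y|.
  have [h|/ltW h] := leP x y.
    apply: le_trans (gL x y ax h yb) _; rewrite distrC (@ger0_norm _ (y - x)) ?subr_ge0//.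
    by rewrite ler_wpM2r ?subr_ge0// ler_norm.
  rewrite distrC; apply: le_trans (gL y x ay h xb) _; rewrite (@ger0_norm _ (x - y)) ?subr_ge0//.
  by rewrite ler_wpM2r ?subr_ge0// ler_norm.
apply: le_lt_trans gxy _; move: xy; rewrite ltr_pdivlMr//; apply: le_lt_trans.
by rewrite mulrDr mulr1 mulrC lerDl.
Unshelve. all: by end_near. Qed.

Section GroundState.
Variables (R : realType) (s : seq R) (p : R) (f f' F : R -> R).
Hypothesis nl : nonlinearity p f f'.
Hypotheses (s_gt0 : (0 < size s)%N) (s_pos : all (fun a : R => 0 < a) s).
Hypotheses (FD : Der F f) (F0 : F 0 = 0).
Implicit Types (w u v : R -> R).

Definition even_decr w := (forall x, w (- x) = w x) /\
  (forall x y, 0 <= x -> x <= y -> w y <= w x).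

Definition cone w := [/\ G1 w, forall x, 0 <= w x & even_decr w].

Let F_cont : continuous F := Der_cont FD.

Lemma even_decr_le w x : even_decr w -> w x <= w 0.
Proof.
move=> [ew dw]; have -> : w x = w `|x| by case: (ger0P x) => // _; rewrite ew.
by apply: dw.
Qed.

Lemma cone_Kop w : cone w -> cone (Kop s w).
Proof.
move=> [gw w0 [ew dw]]; split; [exact: Kop_G1|exact: (Kop_ge0 s_pos gw.1)|].
exact: Kop_even_mono s_pos gw.1 ew dw.
Qed.

Lemma coneZ (t : R) w : 0 <= t -> cone w -> cone (fun x => t * w x).
Proof.
move=> t0 [gw w0 [ew dw]]; split; [exact: G1Z|by move=> x; rewrite mulr_ge0|].
by split=> [x|x y x0 xy]; [rewrite ew|rewrite ler_wpM2l// dw].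
Qed.

Lemma comp_cont (g : R -> R) u : continuous g -> continuous u -> continuous (fun x => g (u x)).
Proof. by move=> cg cu x; apply: continuous_comp; [exact: cu|exact: cg]. Qed.

Lemma nl_G1 u : BC u -> (forall x, 0 <= u x) -> integ (fun x => u x ^+ 2) ->
  G1 (fun x => f (u x)).
Proof.
move=> bu u0 iu; have bf := nl_BC nl bu u0; split=> //.
have [M uM] := bu.2; have [C C0 fC] := nl_small nl M.
apply: integ_cont_le (integZ C iu); first exact: bf.1.
move=> x; rewrite ger0_norm ?(nl_ge0 nl)//; apply: (nl_quadratic nl C0 fC).
by rewrite u0 (le_trans (ler_norm _)).
Qed.

Lemma cone_f u : BC u -> (forall x, 0 <= u x) -> integ (fun x => u x ^+ 2) -> even_decr u ->
  cone (fun x => f (u x)).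
Proof.
move=> bu u0 iu [eu du]; split; [exact: nl_G1|by move=> x; apply: (nl_ge0 nl)|].
split=> [x|x y x0 xy]; first by rewrite eu.
by apply: (nl_le nl) => //; exact: du.
Qed.

Lemma G1_sqr u : G1 u -> integ (fun x => u x ^+ 2).
Proof. by move=> gu; exact: (G1M gu.1 gu).2. Qed.

Lemma integ_f u v : BC u -> BC v -> (forall x, 0 <= v x) -> integ (fun x => v x ^+ 2) ->
  integ (fun x => u x * f (v x)).
Proof. by move=> bu bv v0 iv; apply: (G1M bu (nl_G1 bv v0 iv)).2. Qed.

Lemma integ_F v : BC v -> (forall x, 0 <= v x) -> integ (fun x => v x ^+ 2) ->
  integ (fun x => F (v x)).
Proof.
move=> bv v0 iv; apply: integ_cont_le (integ_f bv bv v0 iv).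
  exact: comp_cont F_cont bv.1.
move=> x; rewrite ger0_norm ?(potential_ge0 nl FD)//.
exact: (potential_le_prod nl FD).
Qed.

Definition energy w := II (fun x => w x * Kop s w x) / 2 - II (fun x => F (Kop s w x)).

(** In the cone [w 0] is the maximum, so [0 < w 0] means w is not 0. The equation says that the
    energy of t w is stationary in t at t = 1. *)
Definition nehari w := [/\ cone w, 0 < w 0 &
  II (fun x => w x * Kop s w x) = II (fun x => Kop s w x * f (Kop s w x))].

Lemma Kop_cone_gt0 w : cone w -> 0 < w 0 -> forall x, 0 < Kop s w x.
Proof. by move=> [gw w0 _] w00; apply: (Kop_gt0 s_gt0 s_pos gw.1 w0); exists 0. Qed.

(** With u = K w the condition for t w reads n(t) = t b. Since n(t)/t^p is nondecreasing and p > 1,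
    n(t) lies below t b for small t and above it for large t; the intermediate value theorem
    applies, n being Lipschitz on compact intervals. *)
Lemma nehari_scaling w : cone w -> 0 < w 0 ->
  exists2 t, 0 < t & nehari (fun x => t * w x).
Proof.
move=> cw w00; have [gw w_ge0 _] := cw; have [gu u_ge0 _] := cone_Kop cw.
have u_gt0 := Kop_cone_gt0 cw w00.
set u := Kop s w in gu u_ge0 u_gt0.
pose b := II (fun x => w x * u x).
have iuZ (t : R) : 0 <= t -> integ (fun x => u x * f (t * u x)).
  move=> t0; apply: integ_f; [exact: gu.1|exact: BCZ gu.1| |].
  - by move=> x; rewrite mulr_ge0.
  - exact: (G1_sqr (G1Z t gu)).
pose n t := II (fun x => u x * f (t * u x)).
have b0 : 0 < b.
  apply: II_gt0; [exact: (G1M gw.1 gu).1.1| |exact: (G1M gw.1 gu).2|].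
  - by move=> x; rewrite mulr_ge0.
  - by exists 0; rewrite mulr_gt0.
have A0 : 0 < n 1.
  have gf : G1 (fun x => f (u x)) by apply: nl_G1 (G1_sqr gu) => //; exact: gu.1.
  have -> : n 1 = II (fun x => u x * f (u x)) by apply: eq_II => x; rewrite mul1r.
  apply: II_gt0; [exact: (G1M gu.1 gf).1.1| |exact: (G1M gu.1 gf).2|].
  - by move=> x; rewrite mulr_ge0// (nl_ge0 nl).
  - by exists 0; rewrite mulr_gt0// (nl_gt0 nl).
have p1 : 0 < p - 1 by rewrite subr_gt0 (nl_p nl).
have n_large t : 0 <= t -> expR (p * t) * n 1 <= n (expR t).
  move=> t0; rewrite /n -IIZ; last exact: iuZ.
  apply: II_le; [by apply: integZ; exact: iuZ|by apply: iuZ; exact: expR_ge0|].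
  move=> x; rewrite mul1r mulrCA ler_wpM2l// [expR t * _]mulrC.
  exact: (nl_scale nl).
have n_small t : 0 <= t -> expR (p * t) * n (expR (- t)) <= n 1.
  move=> t0; rewrite /n -IIZ; last by apply: iuZ; exact: expR_ge0.
  apply: II_le; [by apply: integZ; apply: iuZ; exact: expR_ge0|exact: iuZ|].
  move=> x; rewrite mul1r mulrCA ler_wpM2l//.
  have e0 : 0 <= expR (- t) * u x by rewrite mulr_ge0// expR_ge0.
  have := nl_scale nl e0 t0; rewrite mulrAC -expRD addNr expR0 mul1r.
  exact.
(* t1 and t0 are such that the surplus factor e^((p-1)t) outweighs the ratio of b and n(1), in
   either direction. *)
have [t1 t1_ge0 ht1] := expR_unbounded b p1 A0.
have [t0 t0_ge0 ht0] := expR_unbounded (n 1) p1 b0.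
pose T0 := expR (- t0); pose T1 := expR t1.
have T00 : 0 < T0 := expR_gt0 _; have T10 : 0 < T1 := expR_gt0 _.
have T01 : T0 <= T1 by rewrite ler_expR (@le_trans _ _ 0)// oppr_le0.
have nT0 : n T0 <= T0 * b.
  rewrite -(@ler_pM2l _ (expR (p * t0))) ?expR_gt0//; apply: le_trans (n_small _ t0_ge0) _.
  rewrite /T0 mulrA -expRD mulrC; apply: le_trans (ltW ht0) _.
  by rewrite le_eqVlt; apply/predU1P; left; congr (_ * expR _); ring.
have nT1 : T1 * b <= n T1.
  apply: le_trans (n_large _ t1_ge0).
  have -> : expR (p * t1) = T1 * expR ((p - 1) * t1) by rewrite -expRD; congr expR; ring.
  by rewrite -mulrA ler_pM2l// mulrC ltW.
have [U uU] := gu.1.2.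
have U_ge0 : 0 <= U := le_trans (normr_ge0 _) (uU 0).
have uU' x : u x <= U := le_trans (ler_norm _) (uU x).
have [C C0 fC] := nl_small nl (T1 * U).
have n_lip x y : T0 <= x -> x <= y -> y <= T1 ->
    `|n x - n y| <= (C * T1 * U * II (fun x => u x ^+ 2)) * (y - x).
  move=> T0x xy yT1; have x0 : 0 <= x := le_trans (ltW T00) T0x.
  have y0 := le_trans x0 xy; have ix := iuZ _ x0; have iy := iuZ _ y0.
  have fle t : f (x * u t) <= f (y * u t) by rewrite (nl_le nl) ?mulr_ge0// ler_wpM2r.
  have nxy : n x <= n y by apply: II_le => // t; rewrite ler_wpM2l.
  rewrite distrC ger0_norm ?subr_ge0// /n -(IIB iy ix).
  rewrite mulrAC -IIZ; last exact: G1_sqr.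
  apply: II_le; [exact: integB|by apply: integZ; exact: G1_sqr|move=> t].
  have h : f (y * u t) - f (x * u t) <= C * (y * u t) * (y * u t - x * u t).
    apply: (nl_increment nl C0 fC); [by rewrite mulr_ge0|by rewrite ler_wpM2r|].
    by apply: ler_pM.
  rewrite -mulrBr; apply: le_trans (ler_wpM2l (u_ge0 t) h) _.
  have -> : u t * (C * (y * u t) * (y * u t - x * u t)) = y * u t * (C * (y - x) * u t ^+ 2) by ring.
  have -> : C * T1 * U * (y - x) * u t ^+ 2 = T1 * U * (C * (y - x) * u t ^+ 2) by ring.
  rewrite ler_wpM2r//; last by apply: ler_pM.
  by rewrite mulr_ge0 ?sqr_ge0// mulr_ge0 ?subr_ge0// ltW.
have g_cont : {within `[T0, T1], continuous (fun t => n t - t * b)}.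
  apply: (lipschitz_within (L := C * T1 * U * II (fun x => u x ^+ 2) + b)) => x y h1 h2 h3.
  have -> : n x - x * b - (n y - y * b) = (n x - n y) + (y - x) * b by ring.
  apply: le_trans (ler_normD _ _) _; rewrite [leRHS]mulrDl lerD ?n_lip//.
  by rewrite ger0_norm ?mulr_ge0 ?subr_ge0 ?(ltW b0)// mulrC.
have [|t] := IVT T01 g_cont (v := 0).
  by rewrite ge_min le_max subr_le0 nT0 (subr_ge0 (T1 * b)) nT1 orbT.
rewrite in_itv/= => /andP[T0t tT1] /eqP; rewrite subr_eq0 => /eqP nt.
have t_gt0 := lt_le_trans T00 T0t; exists t => //; split.
- by apply: coneZ => //; exact: ltW.
- exact: mulr_gt0.
- rewrite KopZ//; last exact: gw.1.
  rewrite -/u; have -> : (fun x => t * w x * (t * u x)) = (fun x => t ^+ 2 * (w x * u x)).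
    by apply/funext => x; ring.
  rewrite IIZ; last exact: (G1M gw.1 gu).2.
  have -> : (fun x => t * u x * f (t * u x)) = (fun x => t * (u x * f (t * u x))).
    by apply/funext => x; ring.
  rewrite IIZ; last by apply: iuZ; exact: ltW.
  by rewrite -/(n t) nt -/b expr2 mulrA.
Qed.

End GroundState.

Section Minimization.
Variables (R : realType) (s : seq R) (p : R) (f f' F : R -> R).
Hypothesis nl : nonlinearity p f f'.
Hypotheses (s_gt0 : (0 < size s)%N) (s_pos : all (fun a : R => 0 < a) s).
Hypotheses (FD : Der F f) (F0 : F 0 = 0).
Implicit Types (w u v : R -> R).
Notation nehari := (nehari s f).
Notation energy := (energy s F).

Let P := \prod_(a <- s) a ^+ 2.

Let P_gt0 : 0 < P.
Proof.
rewrite /P; elim: s s_pos => [|a s' IH] /=; first by rewrite big_nil.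
by move=> /andP[a0 /IH h]; rewrite big_cons mulr_gt0// exprn_gt0.
Qed.

Let p1 : 0 < p + 1. Proof. have := nl_p nl; lra. Qed.

Lemma II_potential_le v : BC v -> (forall x, 0 <= v x) -> integ (fun x => v x ^+ 2) ->
  (p + 1) * II (fun x => F (v x)) <= II (fun x => v x * f (v x)).
Proof.
move=> bv v0 iv; have iF := integ_F nl FD F0 bv v0 iv.
rewrite -IIZ//; apply: II_le; [exact: integZ|exact: (integ_f nl)|move=> x].
exact: (potential_le nl).
Qed.

(** This is 1/2 - 1/(p + 1): the part of the quadratic term left after bounding the potential by int
    v f(v) / (p + 1). *)
Let theta := (p - 1) / (2 * (p + 1)).

Let theta_gt0 : 0 < theta.
Proof. by rewrite divr_gt0 ?mulr_gt0// subr_gt0 (nl_p nl). Qed.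

Lemma nehari_energy w : nehari w -> theta * II (fun x => w x * Kop s w x) <= energy w.
Proof.
move=> [cw w0 qE]; have [gv v0 _] := cone_Kop s_pos cw.
have := II_potential_le gv.1 v0 (G1_sqr gv); rewrite -qE /energy.
set q := II _; set I := II _; rewrite mulrC -ler_pdivlMr// => h.
apply: le_trans (lerB (lexx _) h); rewrite le_eqVlt; apply/predU1P; left.
by rewrite /theta; field; rewrite gt_eqF.
Qed.

Lemma nehari_gt0 w : nehari w -> 0 < II (fun x => w x * Kop s w x).
Proof.
move=> [cw w0 _]; have [gw w_ge0 _] := cw; have [gv v_ge0 _] := cone_Kop s_pos cw.
apply: II_gt0; [exact: (G1M gw.1 gv).1.1| |exact: (G1M gw.1 gv).2|].
- by move=> x; rewrite mulr_ge0.
- by exists 0; rewrite mulr_gt0// (Kop_cone_gt0 s_gt0 s_pos cw w0).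
Qed.

Lemma square_primitive v : continuous v -> exists V, Der V (fun x => v x ^+ 2).
Proof. by move=> cv; apply: continuous_primitive => x; exact: cvgM (cv x) (cv x). Qed.

(** The energy bounds int w v, coercivity turns this into int v^2 <= Q, and the Harnack inequality
    into a pointwise bound. For the lower bound, P int v^2 <= int w v = int v f(v) <= C v(0) int v^2
    forces v(0) >= P/C, which keeps limits away from 0. *)
Lemma nehari_bounds (B : R) : exists a M L d Q : R, [/\ 0 < d & forall w, nehari w ->
  energy w <= B -> let v := Kop s w in
  [/\ forall x, 0 <= v x <= M, forall x z, `|v x - v z| <= L * `|x - z|, d <= v 0,
      II (fun x => v x ^+ 2) <= Q & forall x h, expR (- a * `|h|) * v x <= v (x + h)]].
Proof.
have [a a0 aP] := Kop_derive s_gt0 s_pos.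
pose Q := B / theta / P; pose k := expR (- a).
have k0 : 0 < k := expR_gt0 _.
(* The Harnack inequality on [0, 1] gives (k v(0))^2 <= Q, and v(0) <= 1 + v(0)^2. *)
pose M := 1 + Q / k ^+ 2.
have [C C0 fC] := nl_small nl M.
exists a, M, (a * M), (P / C), Q; split; first exact: divr_gt0.
move=> w nw wB v; have [cw w0 qE] := nw; have [gw w_ge0 _] := cw.
have [gv v0 ev] := cone_Kop s_pos cw; rewrite -/v in gv v0 ev qE.
have [d [vd bd /(_ w_ge0) dv]] := aP w gw.1; rewrite -/v in vd dv.
have coer := Kop_coercive s_pos gw; rewrite -/v -/P in coer.
have qB : II (fun x => w x * v x) <= B / theta.
  by rewrite ler_pdivlMr// mulrC (le_trans (nehari_energy nw)).
have q0 : 0 < II (fun x => w x * v x) := nehari_gt0 nw.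
have IQ : II (fun x => v x ^+ 2) <= Q.
  by rewrite /Q ler_pdivlMr// mulrC (le_trans coer).
have har := harnack vd dv.
have v0M : v 0 <= M.
  have [V DV] := square_primitive gv.1.1.
  have [c /andP[c0 c1] E] := MVT_on (@ltr01 R) (fun t _ => DV t).
  have vc : k * v 0 <= v c.
    have := har 0 c; rewrite add0r; apply: le_trans.
    by rewrite ler_wpM2r// ler_expR mulNr lerN2 ler_piMr ?(ltW a0)// gtr0_norm// ltW.
  have : (k * v 0) ^+ 2 <= Q.
    apply: le_trans IQ; apply: (@le_trans _ _ (v c ^+ 2)).
      by rewrite ler_sqr ?nnegrE ?mulr_ge0// ltW.
    have := integ_primitive_le (@ler01 R) _ (fun x => sqr_ge0 (v x)) (G1_sqr gv) DV.
    rewrite E subr0 mulr1; apply.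
    by move=> x; exact: cvgM (gv.1.1 x) (gv.1.1 x).
  rewrite exprMn mulrC -ler_pdivlMr ?exprn_gt0// => h.
  by rewrite /M; have := sqr_ge0 (v 0 - 1); nra.
have vM x : 0 <= v x <= M by rewrite v0 (le_trans (even_decr_le x ev)).
split => //.
- apply: (Der_lipschitz vd) => x; apply: le_trans (dv x) _.
  by rewrite ler_pM2l//; case/andP: (vM x).
- rewrite ler_pdivrMr// mulrC.
  have ifv := integ_f nl gv.1 gv.1 v0 (G1_sqr gv).
  have h : II (fun x => v x * f (v x)) <= C * v 0 * II (fun x => v x ^+ 2).
    rewrite -IIZ; last exact: G1_sqr.
    apply: II_le => //; first by apply: integZ; exact: G1_sqr.
    move=> x; apply: (@le_trans _ _ (v x * (C * v x ^+ 2))).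
      by rewrite ler_wpM2l// (nl_quadratic nl C0 fC).
    rewrite mulrCA -mulrA ler_pM2l// ler_wpM2r ?sqr_ge0//; exact: even_decr_le.
  rewrite -qE in h.
  rewrite -(@ler_pM2r _ (II (fun x => w x * v x)))//.
  apply: le_trans (ler_wpM2l (ltW P_gt0) h) _.
  rewrite mulrCA; apply: ler_wpM2l => //; first by rewrite mulr_ge0// ltW.
Qed.

End Minimization.

(** * Compactness on the cone and identification of the minimizer *)

Section Existence.
Variables (R : realType) (s : seq R) (p : R) (f f' F : R -> R).
Hypothesis nl : nonlinearity p f f'.
Hypotheses (s_gt0 : (0 < size s)%N) (s_pos : all (fun a : R => 0 < a) s).
Hypotheses (FD : Der F f) (F0 : F 0 = 0).
Implicit Types (w u v : R -> R).
Notation nehari := (nehari s f).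
Notation energy := (energy s F).

(** It serves twice: as a nonzero element of the cone, so that the Nehari set is not empty, and as
    the integrable majorant for v f(v). *)
Let dec (x : R) := ((1 + `|x|) * Num.sqrt (1 + `|x|))^-1.

Lemma lipschitz_continuous (g : R -> R) (L : R) :
  (forall x z, `|g x - g z| <= L * `|x - z|) -> continuous g.
Proof.
move=> gL x; have L0 : 0 < `|L| + 1 by rewrite ltr_wpDl.
apply/cvgrPdist_lt => e e0; near=> y.
have xy : `|x - y| < e / (`|L| + 1).
  near: y; apply: (@cvgr_dist_lt _ _ _ _ _ id x cvg_id _ _).
  by rewrite divr_gt0.
apply: le_lt_trans (gL x y) _; move: xy; rewrite ltr_pdivlMr//; apply: le_lt_trans.
by rewrite mulrC ler_wpM2l//; have := ler_norm L; lra.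
Unshelve. all: by end_near. Qed.

Lemma dec_cone : cone dec.
Proof.
have q0 (x : R) : 0 < 1 + `|x| by rewrite ltr_pwDl.
have d0 x : 0 <= dec x by rewrite invr_ge0 mulr_ge0 ?sqrtr_ge0// ltW.
have dmono (x y : R) : 0 <= x -> x <= y -> dec y <= dec x.
  move=> x0 xy; have y0 := le_trans x0 xy.
  have h : 1 + `|x| <= 1 + `|y| by rewrite lerD2l !ger0_norm.
  rewrite /dec lef_pV2 ?posrE ?mulr_gt0 ?sqrtr_gt0//.
  by apply: ler_pM; rewrite ?ler_sqrt ?sqrtr_ge0 ?(ltW (q0 _)).
have ev : even_decr dec by split=> // x; rewrite /dec normrN.
have cn : continuous (fun x : R => 1 + `|x|).
  by move=> x; apply: cvgD; [exact: cvg_cst|exact: norm_continuous].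
have cd : continuous dec.
  move=> x; apply: cvgV; first by rewrite gt_eqF// mulr_gt0// sqrtr_gt0.
  apply: cvgM; first exact: cn.
  by apply: (continuous_comp (cn x)); exact: sqrt_continuous.
split => //; split; last exact: integ_power_decay.
by split=> //; exists (dec 0) => x; rewrite ger0_norm// even_decr_le.
Qed.

(** As v decreases on the positive half-line, v(x)^2 |x| <= int v^2 <= Q, so v^2 (1 + |x|) <= M^2 +
    Q; the power 3/2 of this bounds v^3, and v f(v) <= C v^3. *)
Lemma power_decay_bound v (Q M C x : R) : cone v -> (forall x, v x <= M) ->
  II (fun x => v x ^+ 2) <= Q -> 0 < C -> (forall r, 0 <= r <= M -> f' r <= C * r) ->
  v x * f (v x) <= C * ((M ^+ 2 + Q) * Num.sqrt (M ^+ 2 + Q)) * dec x.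
Proof.
move=> [gv v0 [ev dv]] vM vQ C0 fC; set K := M ^+ 2 + Q; set r := 1 + `|x|.
have r0 : 0 < r by rewrite ltr_pwDl.
have c2 : continuous (fun x => v x ^+ 2) by move=> t; exact: cvgM (gv.1.1 t) (gv.1.1 t).
have hx : v x ^+ 2 * `|x| <= Q.
  have [V DV] := continuous_primitive c2.
  have -> : v x = v `|x| by case: (ger0P x) => // _; rewrite ev.
  have := normr_ge0 x; rewrite le_eqVlt => /predU1P[<-|x0].
    by rewrite mulr0; apply: le_trans vQ; apply: II_ge0 => t; exact: sqr_ge0.
  apply: le_trans vQ.
  apply: le_trans (integ_primitive_le (ltW x0) c2 (fun t => sqr_ge0 _) (G1_sqr gv) DV).
  have [c /andP[c0 cx] ->] := MVT_on x0 (fun t _ => DV t).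
  rewrite subr0 ler_wpM2r// ler_sqr ?nnegrE//.
  by apply: dv; exact: ltW.
have M0 : 0 <= M := le_trans (v0 0) (vM 0).
have hr : v x ^+ 2 * r <= K.
  rewrite /r mulrDr mulr1; apply: lerD => //.
  by rewrite ler_sqr ?nnegrE.
have Q0 : 0 <= Q by apply: le_trans vQ; apply: II_ge0 => t; exact: sqr_ge0.
have K0 : 0 <= K by rewrite addr_ge0// sqr_ge0.
have hs : v x * Num.sqrt r <= Num.sqrt K.
  rewrite -(@ler_sqr _ (v x * _)) ?nnegrE ?sqrtr_ge0 ?mulr_ge0 ?sqrtr_ge0//.
  by rewrite exprMn !sqr_sqrtr// ltW.
apply: (@le_trans _ _ (C * (v x ^+ 2 * v x))).
  rewrite [v x * f _]mulrC mulrA ler_wpM2r//.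
  by apply: (nl_quadratic nl C0 fC); rewrite v0 vM.
rewrite -mulrA ler_pM2l// /dec ler_pdivlMr; last by rewrite mulr_gt0// sqrtr_gt0.
have -> : v x ^+ 2 * v x * ((1 + `|x|) * Num.sqrt (1 + `|x|)) =
  (v x ^+ 2 * r) * (v x * Num.sqrt r) by rewrite /r; ring.
apply: ler_pM => //; first by rewrite mulr_ge0 ?sqr_ge0// ltW.
by rewrite mulr_ge0// sqrtr_ge0.
Qed.

Lemma ground_state : exists v, [/\ BC v, forall x, 0 < v x, integ (fun x => v x ^+ 2) &
  v = Kop s (fun x => f (v x))].
Proof.
pose E := [set energy w | w in nehari].
have Ege0 : lbound E 0.
  move=> _ [w nw <-]; apply: le_trans (nehari_energy nl s_pos FD F0 nw).
  rewrite mulr_ge0 ?divr_ge0 ?mulr_ge0 ?(ltW (nehari_gt0 s_gt0 s_pos nw))//.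
    by rewrite subr_ge0 ltW// (nl_p nl).
  by have := nl_p nl; lra.
have E0 : E !=set0.
  have d0 : 0 < dec 0 by rewrite invr_gt0 mulr_gt0 ?sqrtr_gt0 ?normr0 ?addr0.
  have [t _ nt] := nehari_scaling nl s_gt0 s_pos dec_cone d0.
  by exists (energy (fun x => t * dec x)), (fun x => t * dec x).
have Einf : has_inf E by split=> //; exists 0.
pose c0 := inf E.
have c0_le w : nehari w -> c0 <= energy w.
  by move=> nw; apply: ge_inf; [exact: Einf.2|exists w].
have wP n : exists w, nehari w /\ energy w < c0 + n.+1%:R^-1.
  have e0 : 0 < n.+1%:R^-1 :> R by rewrite invr_gt0.
  by have [_ [w nw <-] h] := inf_adherent e0 Einf; exists w.
have [w0 w0P] := choice wP.
have [a [M [L [d [Q [d0 bounds]]]]]] := nehari_bounds nl s_gt0 s_pos FD F0 (c0 + 1).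
have bnd n := bounds (w0 n) (w0P n).1.
have le1 n : energy (w0 n) <= c0 + 1.
  by apply: ltW; apply: lt_le_trans (w0P n).2 _; rewrite lerD2l invf_le1// ler1n.
have [sg [v [sgn cv]]] := @equilipschitz_subsequence R (fun n => Kop s (w0 n)) M L
  (fun n => let: And5 h _ _ _ _ := bnd n (le1 n) in h)
  (fun n => let: And5 _ h _ _ _ := bnd n (le1 n) in h).
pose w n := w0 (sg n); pose vn n := Kop s (w n).
have {bnd}bnd n := bnd (sg n) (le1 (sg n)).
have nw n : nehari (w n) := (w0P (sg n)).1.
have cw n : cone (w n) by case: (nw n).
have cvn n : cone (vn n) := cone_Kop s_pos (cw n).
have {}cv x : vn n x @[n --> \oo] --> v x := cv x.
have v_ge0 x : 0 <= v x.
  by apply: (cvgr_to_ge (cv x)); apply: nearW => n; case: (cvn n).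
have vn_le n x : vn n x <= M by case: (bnd n) => /(_ x)/andP[].
have v_le x : v x <= M by apply: (cvgr_to_le (cv x)); apply: nearW => n.
have v_lip x z : `|v x - v z| <= L * `|x - z|.
  apply: (cvgr_to_le (cvg_norm (cvgB (cv x) (cv z)))); apply: nearW => n.
  by case: (bnd n) => _ h _ _ _; exact: h.
have v_cont := lipschitz_continuous v_lip.
have v_BC : BC v by split=> //; exists M => x; rewrite ger0_norm.
have v0_gt0 : 0 < v 0.
  by apply: lt_le_trans d0 _; apply: (cvgr_to_ge (cv 0)); apply: nearW => n; case: (bnd n).
have v_gt0 x : 0 < v x.
  apply: (@lt_le_trans _ _ (expR (- a * `|x|) * v 0)); first by rewrite mulr_gt0 ?expR_gt0.
  rewrite -subr_ge0; apply: (cvgr_to_ge (cvgB (cv x) (cvgMr (cv 0)))); apply: nearW => n.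
  by rewrite subr_ge0; case: (bnd n) => _ _ _ _ /(_ 0 x); rewrite add0r.
have v_even : even_decr v.
  split=> [x|x y x0 xy].
    apply/eqP; rewrite -subr_eq0; apply/eqP.
    apply: (cvg_unique _ (cvgB (cv (- x)) (cv x))) => //.
    apply: (cvg_eqfun _ (@cvg_cst _ (0 : R) _ _ _)) => n /=.
    by case: (cvn n) => _ _ [/(_ x) e _]; apply/eqP; rewrite subr_eq0; apply/eqP; exact: e.
  rewrite -subr_ge0; apply: (cvgr_to_ge (cvgB (cv x) (cv y))); apply: nearW => n.
  by rewrite subr_ge0; case: (cvn n) => _ _ [_ h]; exact: h.
have v2_integ : integ (fun x => v x ^+ 2).
  apply: (@fatou_II _ (fun n x => vn n x ^+ 2) _ Q _ _ _ _).1.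
  - by move=> n; apply: G1_sqr; case: (cvn n).
  - by move=> n x; exact: sqr_ge0.
  - by move=> x; exact: cvgM (cv x) (cv x).
  - by move=> n; case: (bnd n).
pose g x := f (v x).
have cg : cone g by exact: (cone_f nl v_BC v_ge0 v2_integ v_even).
have [gg g_ge0 _] := cg.
have g0 : 0 < g 0 by exact: (nl_gt0 nl v0_gt0).
pose u := Kop s g.
have [gu u_ge0 _] := cone_Kop s_pos cg; rewrite -/u in gu u_ge0.
have [C C0 fC] := nl_small nl M.
pose D x := C * ((M ^+ 2 + Q) * Num.sqrt (M ^+ 2 + Q)) * dec x.
have D_integ : integ D by apply: integZ; exact: integ_power_decay.
have vn_D n x : vn n x * f (vn n x) <= D x.
  by apply: power_decay_bound => //; case: (bnd n).
have vn_ge0 n x : 0 <= vn n x by case: (cvn n).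
have vn_cont n : continuous (vn n) by case: (cvn n) => -[[]].
have vnf_cont n : continuous (fun x => f (vn n x)) := comp_cont (nl_cont nl) (vn_cont n).
have vnF_cont n : continuous (fun x => F (vn n x)) := comp_cont (Der_cont FD) (vn_cont n).
have fcv x : f (vn n x) @[n --> \oo] --> f (v x).
  exact: (@continuous_cvg _ _ _ _ _ (fun n => vn n x) f (v x) (@nl_cont _ _ _ _ nl (v x)) (cv x)).
pose A := II (fun x => v x * f (v x)).
have [_ lim1] := @dominated_II R (fun n x => vn n x * f (vn n x)) (fun x => v x * f (v x)) D
  (fun n => continuous_measurable_fun (fun x => cvgM (vn_cont n x) (vnf_cont n x)))
  (fun x => cvgM (cv x) (fcv x))
  (fun n x => eq_ind_r (fun t => t <= D x) (vn_D n x)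
     (ger0_norm (mulr_ge0 (vn_ge0 n x) (nl_ge0 nl (vn_ge0 n x))))) D_integ.
have [||||_ lim2] := @dominated_II R (fun n x => F (vn n x)) (fun x => F (v x)) D.
- by move=> n; apply: continuous_measurable_fun; exact: vnF_cont.
- by move=> x; exact: (@continuous_cvg _ _ _ _ _ (fun n => vn n x) F (v x) (@Der_cont _ _ _ FD (v x)) (cv x)).
- move=> n x; rewrite ger0_norm ?(potential_ge0 nl FD)//.
  exact: le_trans (potential_le_prod nl FD F0 (vn_ge0 n x)) (vn_D n x).
- exact: D_integ.
have [||||_ lim3] := @dominated_II R (fun n x => vn n x * g x) (fun x => v x * g x) (fun x => M * g x).
- by move=> n; apply: continuous_measurable_fun => x; exact: cvgM (vn_cont n x) (gg.1.1 x).
- by move=> x; apply: cvgMl; exact: cv.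
- by move=> n x; rewrite ger0_norm ?mulr_ge0// ler_wpM2r.
- by apply: integZ; exact: gg.2.
(* On the Nehari set int w_n v_n equals int v_n f(v_n), so the energy involves v_n alone and passes
   to the limit. *)
have c0E : c0 = A / 2 - II (fun x => F (v x)).
  have l1 : energy (w n) @[n --> \oo] --> c0.
    apply: (@squeeze_cvgr _ _ _ _ (fun=> c0) (fun n => c0 + n.+1%:R^-1)).
    - apply: nearW => n; rewrite c0_le//=; apply: (le_trans (ltW (w0P (sg n)).2)).
      by rewrite lerD2l lef_pV2 ?posrE// ler_nat ltnS.
    - exact: cvg_cst.
    - by rewrite -[X in _ --> X]addr0; apply: cvgD; [exact: cvg_cst|exact: cvg_harmonic].
  apply: (cvg_unique _ l1) => //.
  apply: cvg_eqfun (cvgB (cvgMl (lim1)) lim2) => n.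
  by rewrite /energy; case: (nw n) => _ _ ->.
pose b := II (fun x => g x * u x).
have Ab : A <= b.
  (* Symmetry of K turns int w_n u into int v_n g, so w_n disappears from the expanded quadratic
     form; its limit is A - 2A + b. *)
  have pos n : 0 <= II (fun x => vn n x * f (vn n x)) - 2 * II (fun x => vn n x * g x) + b.
    have [gw _ _] := cw n; have [gvn _ _] := cvn n.
    have gd := G1B gw gg.
    have : 0 <= II (fun x => (w n x - g x) * Kop s (fun x => w n x - g x) x).
      apply: le_trans (Kop_coercive s_pos gd); rewrite mulr_ge0//.
        by apply: prodr_ge0 => j _; exact: sqr_ge0.
      by apply: II_ge0 => x; exact: sqr_ge0.
    rewrite KopB//; [|exact: gw.1|exact: gg.1].
    rewrite -/(vn n) -/u.
    have -> : (fun x => (w n x - g x) * (vn n x - u x)) =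
      (fun x => (w n x * vn n x - w n x * u x) - (g x * vn n x - g x * u x)).
      by apply/funext => x; ring.
    have i1 := (G1M gw.1 gvn); have i2 := (G1M gw.1 gu); have i3 := (G1M gg.1 gvn).
    have i4 := (G1M gg.1 gu).
    rewrite IIB; [|exact: (G1B i1 i2).2|exact: (G1B i3 i4).2].
    rewrite (IIB i1.2 i2.2) (IIB i3.2 i4.2).
    have -> : II (fun x => w n x * u x) = II (fun x => vn n x * g x) by rewrite /u Kop_sym.
    have -> : II (fun x => g x * vn n x) = II (fun x => vn n x * g x).
      by apply: eq_II => x; rewrite mulrC.
    have -> : II (fun x => w n x * vn n x) = II (fun x => vn n x * f (vn n x)).
      by case: (nw n).
    rewrite -/b; lra.
  have : 0 <= A - 2 * A + b.
    apply: (cvgr_to_ge (cvgD (cvgB lim1 (cvgMr lim3)) (@cvg_cst _ b _ _ _))).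
    exact: nearW.
  lra.
have [t t0 [_ _ nt]] := nehari_scaling nl s_gt0 s_pos cg g0.
have c0_le_t : c0 <= t ^+ 2 * b / 2 - II (fun x => F (t * u x)).
  have nt' : nehari (fun x => t * g x).
    by split=> //; [apply: coneZ => //; exact: ltW|exact: mulr_gt0].
  have := c0_le _ nt'; rewrite /energy KopZ//; last exact: gg.1.
  rewrite -/u; have -> : (fun x => t * g x * (t * u x)) = (fun x => t ^+ 2 * (g x * u x)).
    by apply/funext => x; ring.
  by rewrite IIZ//; exact: (G1M gg.1 gu).2.
pose rho x := g x / v x.
have rho_cont : continuous rho.
  move=> x; apply: cvgM; first exact: gg.1.1.
  by apply: cvgV; [rewrite gt_eqF|exact: v_cont].
have rho_ge0 x : 0 <= rho x by rewrite divr_ge0.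
have rho_BC : BC rho.
  split=> //; exists (C * M) => x; rewrite ger0_norm// ler_pdivrMr//.
  apply: le_trans (nl_quadratic nl C0 fC _) _; first by rewrite v_ge0 v_le.
  by rewrite expr2 mulrA ler_wpM2r// ler_pM2l.
have rho_v x : rho x * v x = g x by rewrite /rho divfK// gt_eqF.
pose c' := II (fun x => rho x * u x * u x).
have i_ruu := G1M (BCM rho_BC gu.1) gu.
have i_gu := G1M gg.1 gu.
have i_vg : integ (fun x => v x * g x) by exact: (G1M v_BC gg).2.
(* The convexity inequality at v(x) with r = t u(x), integrated. Inserted into [c0_le_t] together
   with [c0E], it cancels the terms in F and A and leaves t^2 c' <= t^2 b. *)
have convex : t ^+ 2 * c' / 2 - A / 2 <= II (fun x => F (t * u x)) - II (fun x => F (v x)).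
  have tu_BC := BCZ t gu.1.
  have tu_ge0 x : 0 <= t * u x by rewrite mulr_ge0// ltW.
  have iF := integ_F nl FD F0 tu_BC tu_ge0 (G1_sqr (G1Z t gu)).
  have iFv := integ_F nl FD F0 v_BC v_ge0 v2_integ.
  have iL : integ (fun x => t ^+ 2 / 2 * (rho x * u x * u x) - 2^-1 * (v x * g x)).
    by apply: integB; apply: integZ => //; exact: i_ruu.2.
  have := II_le iL (integB iF iFv); rewrite (IIB iF iFv).
  rewrite (IIB (integZ _ i_ruu.2) (integZ _ i_vg)) (IIZ _ i_ruu.2) (IIZ _ i_vg).
  rewrite -/c' -/A => h.
  have -> : t ^+ 2 * c' / 2 - A / 2 = t ^+ 2 / 2 * c' - 2^-1 * A by ring.
  apply: h => x; apply: le_trans (potential_convex nl FD (v_gt0 x) (tu_ge0 x)).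
  rewrite -/(rho x) le_eqVlt; apply/predU1P; left.
  by rewrite -[g x]rho_v; field.
have sq : II (fun x => rho x * (v x - u x) ^+ 2) = A - 2 * b + c'.
  have -> : (fun x => rho x * (v x - u x) ^+ 2) =
      (fun x => (v x * g x - 2 * (g x * u x)) + rho x * u x * u x).
    by apply/funext => x; rewrite -[g x]rho_v; ring.
  rewrite IID; [|by apply: integB => //; apply: integZ; exact: i_gu.2|exact: i_ruu.2].
  by rewrite IIB ?IIZ//; [exact: i_gu.2|apply: integZ; exact: i_gu.2].
have t2 : 0 < t ^+ 2 by rewrite exprn_gt0.
have c'b : c' <= b.
  rewrite -(@ler_pM2l _ (t ^+ 2))//; move: c0_le_t convex; rewrite c0E; lra.
have sq_le0 : II (fun x => rho x * (v x - u x) ^+ 2) <= 0 by rewrite sq; lra.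
exists v; split => //; apply/funext => x; apply/eqP; rewrite -/g -/u -subr_eq0.
apply/negPn/negP => vu; move: sq_le0; rewrite leNgt => /negP; apply.
have cI : continuous (fun x => rho x * (v x - u x) ^+ 2).
  move=> y; apply: cvgM; first exact: rho_cont.
  have h : (fun y => v y - u y) @ y --> v y - u y by apply: cvgB; [exact: v_cont|exact: gu.1.1].
  exact: (cvgM h h).
apply: II_gt0 => //.
- by move=> y; rewrite mulr_ge0// sqr_ge0.
- have -> : (fun x => rho x * (v x - u x) ^+ 2) =
      (fun x => (v x * g x - 2 * (g x * u x)) + rho x * u x * u x).
    by apply/funext => y; rewrite -[g y]rho_v; ring.
  apply: integD; last exact: i_ruu.2.
  by apply: integB => //; apply: integZ; exact: i_gu.2.
- exists x; rewrite mulr_gt0//; first by rewrite divr_gt0// (nl_gt0 nl).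
  by rewrite exprn_even_gt0.
Qed.

End Existence.

(** * Regularity and the theorem *)

Section Regularity.
Variable R : realType.
Implicit Types (w g : R -> R) (s a : seq R).
Notation allpos s := (all (fun a : R => 0 < a) s).

(** One derivative is charged to each resolvent: the derivative of the first resolvent of w is again
    in [G1], and the remaining ones act on it. *)
Lemma Kop_dern s w : allpos s -> G1 w -> forall k, (k <= size s)%N ->
  G1 (dern k (Kop s w)) /\
  ((k < size s)%N -> Der (dern k (Kop s w)) (dern k.+1 (Kop s w))).
Proof.
elim: s w => [|b s IH] w; first by move=> _ gw [|//] _.
move=> s0 gw; have /andP[b0 s0'] := s0.
have gy := resolvent_G1 b0 gw; have [d [yd _ gd]] := resolvent_derive_G1 b0 gw.
have Kd := Kop_Der s0' gy.1 gd.1 yd.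
case=> [_|k ks].
  split; first exact: (Kop_G1 (s := b :: s)).
  by move=> _; rewrite dernS (Der_derive1 Kd).
have E j : dern j.+1 (Kop (b :: s) w) = dern j (Kop s d) by rewrite dernS (Der_derive1 Kd).
by rewrite !E; exact: IH.
Qed.

Lemma G1_L2 g : G1 g -> L2 g.
Proof.
move=> gg; split; first exact: continuous_measurable_fun gg.1.1.
have /integrableP[_] := (G1M gg.1 gg).2; apply: le_lt_trans.
rewrite le_eqVlt; apply/predU1P; left; apply: eq_integral => x _ /=.
by rewrite normrM expr2.
Qed.

Lemma Kop_weak_deriv s w k : allpos s -> G1 w -> (k <= size s)%N ->
  weak_deriv k (Kop s w) (dern k (Kop s w)).
Proof.
move=> s0 gw; elim: k => [|k IH] ks psi tp.
  by rewrite expr0 mul1r.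
have kl := ltnW ks; have [gk Dk] := Kop_dern s0 gw kl.
have [gk1 _] := Kop_dern s0 gw ks.
have tp1 := test_derive1 tp; rewrite dernS (IH kl _ tp1) exprS mulN1r mulNr -mulrN.
congr (_ * _); have D := DerM (Dk ks) (smooth_Der1 (test_smooth tp)).
have i1 := G1M gk1.1 (test_G1 tp); have i2 := G1M gk.1 (test_G1 tp1).
have := II_derivative D (G1D i1 i2).1.1 (G1M gk.1 (test_G1 tp)).2 (G1D i1 i2).2.
rewrite (IID i1.2 i2.2) /II; lra.
Qed.

(** The weak equation is the symmetry of K applied to f(v) and L psi, followed by K (L psi) =
    psi. *)
Lemma Kop_pos_solution a (f v : R -> R) : all (fun c => c != 0) a -> BC v ->
  (forall x, 0 < v x) -> G1 (fun x => f (v x)) -> integ (fun x => v x ^+ 2) ->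
  v = Kop [seq `|c| | c <- a] (fun x => f (v x)) -> pos_solution a f v.
Proof.
move=> a0 vBC v0 gw iv vE; have s0 := norms_pos a0.
have sz : size [seq `|c| | c <- a] = size a by rewrite size_map.
have vG : G1 v by rewrite vE; exact: Kop_G1.
split; first split; first exact: G1_L2.
- move=> k /andP[_ ka]; exists (dern k v); split; rewrite vE.
    by apply: G1_L2; apply: (Kop_dern s0 gw _).1; rewrite sz.
  by apply: Kop_weak_deriv; rewrite ?sz.
split; first exact: vBC.1.
split=> // psi tp; have sp := test_SG tp; have gL := SG_G1 (SG_Lop a sp).
rewrite -[LHS]/(II (fun x => v x * Lop a psi x)) -[RHS]/(II (fun x => f (v x) * psi x)).
by rewrite {1}vE -(Kop_sym s0 gw gL) Kop_Lop.
Qed.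

End Regularity.

(** (F3) at r = 0 gives f'(0) = 0, and the mean value theorem bounds f'(r)/r by the maximum of f''
    on a compact interval. *)
Lemma nonlinearity_of_conditions (R : realType) (p q1 q2 C : R) (f : R -> R) :
  C2 f -> f 0 = 0 -> (forall r, 0 < r -> 0 < f r) -> 1 < p ->
  (forall r, p * (r * f r) <= r ^+ 2 * derive1 f r) -> 2 <= q1 -> q1 <= q2 ->
  (forall r, `|derive1 f r| <= C * (`|r| `^ (q1 - 1) + `|r| `^ (q2 - 1))) ->
  nonlinearity p f (derive1 f).
Proof.
move=> [f1 [f2 f3]] f0 f_gt0 p1 F2 q1_ge q12 F3; split => //.
- exact: derivable_Der.
- by move=> r r0; rewrite -(@ler_pM2l _ r)//; have := F2 r; lra.
- move=> M; have M0 : 0 <= `|M| by [].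
  have [c _ cmax] := EVT_max M0 (continuous_subspaceT f3).
  exists (`|dern 2 f c| + 1); first by rewrite ltr_wpDl.
  have d0 : derive1 f 0 = 0.
    apply/eqP; rewrite -normr_le0; apply: le_trans (F3 0) _.
    (* The power of 0 vanishes only for a nonzero exponent; here q1 - 1 and q2 - 1 are at least
       1. *)
    by rewrite normr0 !powR0 ?addr0 ?mulr0// gt_eqF//; lra.
  move=> r /andP[]; rewrite le_eqVlt => /predU1P[<-|r0] rM; first by rewrite d0 mulr0.
  have [t /andP[t0 tr]] := MVT_on r0 (fun x _ => derivable_Der f2 x).
  rewrite d0 !subr0 => ->; rewrite ler_pM2r//.
  have h : dern 2 f t <= dern 2 f c.
    apply: cmax; rewrite in_itv/= (ltW t0)/=; apply: le_trans (ltW tr) _.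
    by apply: le_trans rM _; exact: ler_norm.
  by apply: le_trans h _; have := ler_norm (dern 2 f c); lra.
Qed.

Theorem theorem3p8 (R : realType) (a : seq R) (f : R -> R) :
  (0 < size a)%N ->
  all (fun ai => ai != 0) a ->
  C2 f ->
  (* (F1) *)
  f 0 = 0 -> (forall r, 0 < r -> 0 < f r) ->
  (* (F2) *)
  (exists p : R, 1 < p /\ forall r, p * (r * f r) <= r ^+ 2 * derive1 f r) ->
  (* (F3) *)
  (exists q1 q2 C : R, 2 <= q1 /\ q1 <= q2 /\ 0 < C /\
     forall r, `|derive1 f r| <= C * (`|r| `^ (q1 - 1) + `|r| `^ (q2 - 1))) ->
  (exists phi, pos_solution a f phi) /\
  (forall phi, pos_solution a f phi ->
     exists lam : R, forall x, phi (2 * lam - x) = phi x).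
Proof.
move=> a_gt0 a_neq0 fC2 f0 f_gt0 [p [p1 F2]] [q1 [q2 [C [q1_ge [q12 [_ F3]]]]]].
have nl := nonlinearity_of_conditions fC2 f0 f_gt0 p1 F2 q1_ge q12 F3.
split; last by move=> phi; exact: (solution_symmetric nl).
have [F0 DF0] := continuous_primitive (nl_cont nl).
have DF : Der (fun x => F0 x - F0 0) f.
  by have := DerB DF0 (Der_cst (F0 0)); apply: Der_eq => x; rewrite subr0.
have s_gt0 : (0 < size [seq `|c|%R | c <- a])%N by rewrite size_map.
have [v [vBC v0 iv vE]] := ground_state nl s_gt0 (norms_pos a_neq0) DF (subrr _).
exists v; apply: Kop_pos_solution => //.
by apply: (nl_G1 nl vBC _ iv) => x; exact: ltW.
Qed.
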